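(* Let $n\ge 1$. For $\sigma\in S_n$ and standard Young tableaux $P,Q$ of a common shape $\lambda\vdash n$, define \[ \mathcal{P}(\sigma\rightarrow P,Q)=\sum_{\Lambda:\sigma\rightarrow P,Q}\mathcal{P}(\Lambda),\qquad \overline{\mathcal{P}}(\sigma\leftarrow P,Q)=\sum_{\Lambda:\sigma\rightarrow P,Q}\overline{\mathcal{P}}(\Lambda), \] where the sums run over all growths $\Lambda$ associated with $\sigma$ with $P(\Lambda)=P$ and $Q(\Lambda)=Q$. Set $\omega(\sigma)=\frac{(1-t)^n}{(1-q)^n}$ for $\sigma\in S_n$ and $\overline{\omega}(P,Q)=\psi_P(q,t)\varphi_Q(q,t)$. Then $\mathcal{P},\overline{\mathcal{P}}$ form a probabilistic bijection from $(S_n,\omega)$ to $\left(\bigsqcup_{\lambda\vdash n}\mathrm{SYT}(\lambda)\times\mathrm{SYT}(\lambda),\overline{\omega}\right)$, i.e.: (1) for each $\sigma\in S_n$, $\sum_{(P,Q)}\mathcal{P}(\sigma\rightarrow P,Q)=1$, the sum over all pairs of standard Young tableaux of a common shape $\lambda\vdash n$; (2) for each such pair $(P,Q)$, $\sum_{\sigma\in S_n}\overline{\mathcal{P}}(\sigma\leftarrow P,Q)=1$; (3) for all $\sigma$ and $(P,Q)$, $\omega(\sigma)\mathcal{P}(\sigma\rightarrow P,Q)=\overline{\mathcal{P}}(\sigma\leftarrow P,Q)\,\overline{\omega}(P,Q)$. Moreover, $\mathcal{P}(\sigma\rightarrow P,Q)$ and $\overline{\mathcal{P}}(\sigma\leftarrow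 P,Q)$ take values in $[0,1]$ when $q,t\in[0,1)$ or $q,t\in(1,\infty)$.
   Context: All quantities are rational functions of indeterminates $q,t$. Partitions $\lambda$ are identified with Young diagrams in French convention: the set of cells $(x,y)\in\mathbb{Z}_{>0}^2$ with $x\le\lambda_y$; $\lambda'$ is the conjugate partition. For a cell $c=(x,y)\in\lambda$: arm $a_\lambda(c)=\lambda_y-x$, leg $\ell_\lambda(c)=\lambda'_x-y$. Let $n(\kappa)=\sum_{c\in\kappa}\ell_\kappa(c)$, $n'(\kappa)=\sum_{c\in\kappa}a_\kappa(c)$, and for $\lambda\subseteq\nu$, $n(\nu/\lambda)=n(\nu)-n(\lambda)$, $n'(\nu/\lambda)=n'(\nu)-n'(\lambda)$. Write $\mu\lessdot\lambda$ if $\mu\subseteq\lambda$ and $\lambda/\mu$ is a single cell; $\mathcal{U}(\lambda)=\{\nu:\lambda\lessdot\nu\}$, $\mathcal{D}(\lambda)=\{\mu:\mu\lessdot\lambda\}$, $\mathcal{D}^*(\lambda)=\mathcal{D}(\lambda)\cup\{\lambda\}$. For $\mu\subseteq\lambda$, $\mathcal{R}_{\lambda/\mu}$ (resp. $\mathcal{C}_{\lambda/\mu}$) is the set of cells of $\mu$ lying in a row (resp. column) containing a cell of $\lambda/\mu$. Put $[i,j]=1-q^it^j$, $b_{i,j}=[i,j+1]/[i+1,j]$, $b_\lambda(c)=b_{a_\lambda(c),\ell_\lambda(c)}$. For $\lambda\lessdot\nu$: $\psi_{\nu/\lambda}=\prod_{c\in\mathcal{R}_{\nu/\lambda}}\frac{b_\lambda(c)}{b_\nu(c)}$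 and $\varphi_{\nu/\lambda}=\frac{1-t}{1-q}\prod_{c\in\mathcal{C}_{\nu/\lambda}}\frac{b_\nu(c)}{b_\lambda(c)}$; set $\psi_{\lambda/\lambda}=\varphi_{\lambda/\lambda}=1$. For a standard Young tableau $T$ of shape $\lambda\vdash n$, let $T^{(i)}$ be the shape of the subtableau of entries $\le i$, and $\psi_T=\prod_{i=1}^n\psi_{T^{(i)}/T^{(i-1)}}$, $\varphi_T=\prod_{i=1}^n\varphi_{T^{(i)}/T^{(i-1)}}$. For $\lambda\lessdot\nu$: $\alpha_{\nu/\lambda}=\prod_{c\in\mathcal{R}_{\nu/\lambda}}\frac{[a_\lambda(c),\ell_\lambda(c)+1]}{[a_\nu(c),\ell_\nu(c)+1]}\prod_{c\in\mathcal{C}_{\nu/\lambda}}\frac{[a_\lambda(c)+1,\ell_\lambda(c)]}{[a_\nu(c)+1,\ell_\nu(c)]}$, $\overline{\alpha}_{\nu/\lambda}=\prod_{c\in\mathcal{R}_{\nu/\lambda}}\frac{[a_\lambda(c)+1,\ell_\lambda(c)]}{[a_\nu(c)+1,\ell_\nu(c)]}\prod_{c\in\mathcal{C}_{\nu/\lambda}}\frac{[a_\lambda(c),\ell_\lambda(c)+1]}{[a_\nu(c),\ell_\nu(c)+1]}$; for $\mu\lessdot\lambda$, $\beta_{\lambda/\mu}=1/\alpha_{\lambda/\mu}$, $\overline{\beta}_{\lambda/\mu}=1/\overline{\alpha}_{\lambda/\mu}$. For $\mu\in\mathcal{D}(\lambda)$, $\nu\in\mathcal{U}(\lambda)$, let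 $A=n'(\lambda/\mu)-n'(\nu/\lambda)$, $B=n(\nu/\lambda)-n(\lambda/\mu)$ and $\gamma_{\nu/\lambda/\mu}=\frac{(1-q^{A}t^{B})(1-q^{A+1}t^{B-1})}{(1-q)(1-t)}$. Local probabilities: for $\nu\in\mathcal{U}(\lambda)$, $\mathcal{P}_\lambda(\lambda\rightarrow\nu)=t^{n(\nu/\lambda)}\alpha_{\nu/\lambda}$, $\overline{\mathcal{P}}_\lambda(\lambda\leftarrow\nu)=t^{n(\nu/\lambda)}\overline{\alpha}_{\nu/\lambda}$; for $\mu\in\mathcal{D}(\lambda)$, $\mathcal{P}_\lambda(\mu\rightarrow\nu)=t^{B-1}\frac{\alpha_{\nu/\lambda}\beta_{\lambda/\mu}}{\gamma_{\nu/\lambda/\mu}}$, $\overline{\mathcal{P}}_\lambda(\mu\leftarrow\nu)=t^{B-1}\frac{\overline{\alpha}_{\nu/\lambda}\overline{\beta}_{\lambda/\mu}}{\gamma_{\nu/\lambda/\mu}}$. Growths: for $\sigma\in S_n$, consider the $n\times n$ grid of squares with vertices $(i,j)$, $0\le i,j\le n$ (matrix coordinates, $i$ = row index increasing downward); square $(i,j)$ has vertices $(i-1,j-1)$ (NW), $(i-1,j)$ (NE), $(i,j-1)$ (SW), $(i,j)$ (SE), and it ''contains a 1'' iff $i=\sigma(j)$. A growth associated with $\sigma$ is a labeling $\Lambda=(\Lambda_{ij})$ of vertices by partitions with $\Lambda_{ij}\subseteq\Lambda_{i,j+1}$, $\Lambda_{ij}\subseteq\Lambda_{i+1,j}$, and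 $|\Lambda_{ij}|$ equal to the number of squares $(i',j')$ with $i'\le i$, $j'\le j$ containing a 1. Then $\Lambda_{0,n}\subseteq\Lambda_{1,n}\subseteq\cdots\subseteq\Lambda_{n,n}$ and $\Lambda_{n,0}\subseteq\cdots\subseteq\Lambda_{n,n}$ are saturated chains from $\emptyset$ to $\Lambda_{nn}$; $P(\Lambda)$ (resp. $Q(\Lambda)$) is the standard Young tableau with entry $i$ in the cell $\Lambda_{i,n}/\Lambda_{i-1,n}$ (resp. $\Lambda_{n,i}/\Lambda_{n,i-1}$). A square is of type III if its NE and SW vertices are both labeled $\lambda$, its NW vertex $\mu\in\mathcal{D}^*(\lambda)$ and its SE vertex $\nu\in\mathcal{U}(\lambda)$; then $\mathcal{P}(\square)=\mathcal{P}_\lambda(\mu\rightarrow\nu)$, $\overline{\mathcal{P}}(\square)=\overline{\mathcal{P}}_\lambda(\mu\leftarrow\nu)$, and $\mathcal{P}(\square)=\overline{\mathcal{P}}(\square)=1$ for all other squares. $\mathcal{P}(\Lambda)=\prod_\square\mathcal{P}(\square)$, $\overline{\mathcal{P}}(\Lambda)=\prod_\square\overline{\mathcal{P}}(\square)$. *)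

(* Defs.v *)
From HB Require Import structures.
From mathcomp Require Import all_boot all_order all_algebra all_fingroup.
From mathcomp Require Import fraction.
Set Implicit Arguments. Unset Strict Implicit. Unset Printing Implicit Defensive.
Import Order.TTheory GRing.Theory Num.Theory.
Local Open Scope ring_scope.

(* ---------- Partitions, as sequences of parts (trailing zeros allowed) ---------- *)
Definition part (lam : seq nat) (y : nat) : nat := nth 0%N lam y.-1.
Definition conj_part (lam : seq nat) (x : nat) : nat := count (fun p => x <= p)%N lam.
Definition is_partition (lam : seq nat) : bool := sorted geq lam.
Definition psize (lam : seq nat) : nat := sumn lam.
Definition cells (lam : seq nat) : seq (nat * nat) :=
  [seq (x, y) | y <- iota 1 (size lam), x <- iota 1 (part lam y)].
Definition in_cells (lam : seq nat) (c : nat * nat) : bool :=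
  [&& 1 <= c.1, 1 <= c.2 & c.1 <= part lam c.2]%N.
Definition subp (mu lam : seq nat) : bool :=
  all (fun y => part mu y <= part lam y)%N (iota 1 (maxn (size mu) (size lam))).
Definition covers (mu lam : seq nat) : bool :=
  subp mu lam && (psize lam == (psize mu).+1)%N.

Definition arm (lam : seq nat) (c : nat * nat) : nat := (part lam c.2 - c.1)%N.
Definition leg (lam : seq nat) (c : nat * nat) : nat := (conj_part lam c.1 - c.2)%N.
Definition nleg (lam : seq nat) : nat := sumn [seq leg lam c | c <- cells lam].
Definition narm (lam : seq nat) : nat := sumn [seq arm lam c | c <- cells lam].

Definition skew (lam mu : seq nat) : seq (nat * nat) :=
  [seq c <- cells lam | ~~ in_cells mu c].
Definition Rset (lam mu : seq nat) : seq (nat * nat) :=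
  [seq c <- cells mu | has (fun d => d.2 == c.2) (skew lam mu)].
Definition Cset (lam mu : seq nat) : seq (nat * nat) :=
  [seq c <- cells mu | has (fun d => d.1 == c.1) (skew lam mu)].

Section Weights.
Variables (K : fieldType) (q t : K).

Definition brk (i j : nat) : K := 1 - q ^+ i * t ^+ j.
Definition bij (i j : nat) : K := brk i j.+1 / brk i.+1 j.
Definition bcell (lam : seq nat) (c : nat * nat) : K := bij (arm lam c) (leg lam c).

Definition psi1 (lam nu : seq nat) : K :=
  \prod_(c <- Rset nu lam) (bcell lam c / bcell nu c).
Definition phi1 (lam nu : seq nat) : K :=
  (1 - t) / (1 - q) * \prod_(c <- Cset nu lam) (bcell nu c / bcell lam c).

Definition alpha (lam nu : seq nat) : K :=
  (\prod_(c <- Rset nu lam)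
     (brk (arm lam c) (leg lam c).+1 / brk (arm nu c) (leg nu c).+1)) *
  (\prod_(c <- Cset nu lam)
     (brk (arm lam c).+1 (leg lam c) / brk (arm nu c).+1 (leg nu c))).
Definition alphabar (lam nu : seq nat) : K :=
  (\prod_(c <- Rset nu lam)
     (brk (arm lam c).+1 (leg lam c) / brk (arm nu c).+1 (leg nu c))) *
  (\prod_(c <- Cset nu lam)
     (brk (arm lam c) (leg lam c).+1 / brk (arm nu c) (leg nu c).+1)).
Definition beta (mu lam : seq nat) : K := (alpha mu lam)^-1.
Definition betabar (mu lam : seq nat) : K := (alphabar mu lam)^-1.

Definition nskew (nu lam : seq nat) : int := (nleg nu)%:Z - (nleg lam)%:Z.
Definition nskew' (nu lam : seq nat) : int := (narm nu)%:Z - (narm lam)%:Z.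
Definition Aexp (mu lam nu : seq nat) : int := nskew' lam mu - nskew' nu lam.
Definition Bexp (mu lam nu : seq nat) : int := nskew nu lam - nskew lam mu.
Definition gamma (mu lam nu : seq nat) : K :=
  let A := Aexp mu lam nu in let B := Bexp mu lam nu in
  (1 - q ^ A * t ^ B) * (1 - q ^ (A + 1) * t ^ (B - 1)) / ((1 - q) * (1 - t)).

Definition Pup (lam nu : seq nat) : K := t ^ nskew nu lam * alpha lam nu.
Definition Pbarup (lam nu : seq nat) : K := t ^ nskew nu lam * alphabar lam nu.
Definition Pdiag (mu lam nu : seq nat) : K :=
  t ^ (Bexp mu lam nu - 1) * (alpha lam nu * beta mu lam) / gamma mu lam nu.
Definition Pbardiag (mu lam nu : seq nat) : K :=
  t ^ (Bexp mu lam nu - 1) * (alphabar lam nu * betabar mu lam) / gamma mu lam nu.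

Definition typeIII (nw ne sw se : seq nat) : bool :=
  [&& ne == sw, (nw == ne) || covers nw ne & covers ne se].
Definition sqw (nw ne sw se : seq nat) : K :=
  if typeIII nw ne sw se then
    (if nw == ne then Pup ne se else Pdiag nw ne se) else 1.
Definition sqwbar (nw ne sw se : seq nat) : K :=
  if typeIII nw ne sw se then
    (if nw == ne then Pbarup ne se else Pbardiag nw ne se) else 1.
End Weights.

(* a partition of size <= n, written as its n first parts (padded with zeros) *)
Definition ptn (n : nat) := n.-tuple 'I_n.+1.
Definition pseq n (l : ptn n) : seq nat := map val l.

(* a standard Young tableau with n cells, encoded by its chain of shapes
   T^(0) = empty, ..., T^(n); T^(i) is the shape of the entries <= i *)
Definition chain (n : nat) := {ffun 'I_n.+1 -> ptn n}.
Definition cv n (T : chain n) (i : nat) : seq nat := pseq (T (inord i)).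
Definition is_syt n (T : chain n) : bool :=
  [&& psize (cv T 0) == 0%N,
      [forall i : 'I_n.+1, is_partition (pseq (T i))] &
      [forall i : 'I_n, covers (cv T i) (cv T i.+1)]].
Definition syt_shape n (T : chain n) : seq nat := cv T n.

Definition labeling (n : nat) := {ffun 'I_n.+1 * 'I_n.+1 -> ptn n}.
Definition gv n (L : labeling n) (i j : nat) : seq nat := pseq (L (inord i, inord j)).
(* square (i,j) (1-based) contains a 1 iff i = sigma(j); with 0-based ordinals
   j' : 'I_n stands for the column j'+1 and sigma j' for the row sigma(j'+1) - 1 *)
Definition ones_NW n (s : 'S_n) (i j : nat) : nat :=
  #|[set j' : 'I_n | (j' < j)%N && (s j' < i)%N]|.
Definition is_growth n (s : 'S_n) (L : labeling n) : bool :=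
  [&& [forall v, is_partition (pseq (L v))],
      [forall i : 'I_n.+1, forall j : 'I_n, subp (gv L i j) (gv L i j.+1)],
      [forall i : 'I_n, forall j : 'I_n.+1, subp (gv L i j) (gv L i.+1 j)] &
      [forall i : 'I_n.+1, forall j : 'I_n.+1, psize (gv L i j) == ones_NW s i j]].
Definition Ptab n (L : labeling n) : chain n := [ffun i => L (i, ord_max)].
Definition Qtab n (L : labeling n) : chain n := [ffun j => L (ord_max, j)].

Section GrowthWeights.
Variables (K : fieldType) (q t : K).
Definition growth_weight n (L : labeling n) : K :=
  \prod_(i < n) \prod_(j < n)
    sqw q t (gv L i j) (gv L i j.+1) (gv L i.+1 j) (gv L i.+1 j.+1).
Definition growth_weightbar n (L : labeling n) : K :=
  \prod_(i < n) \prod_(j < n)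
    sqwbar q t (gv L i j) (gv L i j.+1) (gv L i.+1 j) (gv L i.+1 j.+1).

Definition Pfwd n (s : 'S_n) (P Q : chain n) : K :=
  \sum_(L : labeling n | [&& is_growth s L, Ptab L == P & Qtab L == Q]) growth_weight L.
Definition Pbwd n (s : 'S_n) (P Q : chain n) : K :=
  \sum_(L : labeling n | [&& is_growth s L, Ptab L == P & Qtab L == Q]) growth_weightbar L.

Definition psiT n (T : chain n) : K := \prod_(i < n) psi1 q t (cv T i) (cv T i.+1).
Definition phiT n (T : chain n) : K := \prod_(i < n) phi1 q t (cv T i) (cv T i.+1).
Definition omega (n : nat) : K := ((1 - t) ^+ n) / ((1 - q) ^+ n).
Definition omegabar n (P Q : chain n) : K := psiT P * phiT Q.
End GrowthWeights.

Definition QT := {fraction {poly {poly rat}}}.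
Definition qQT : QT := FracField.tofrac (('X : {poly rat})%:P).
Definition tQT : QT := FracField.tofrac ('X : {poly {poly rat}}).

Definition ev2 (R : realFieldType) (a b : R) (p : {poly {poly rat}}) : R :=
  (map_poly (fun c : {poly rat} => (map_poly (@ratr R) c).[a]) p).[b].
Definition rf_value (R : realFieldType) (f : QT) (a b v : R) : Prop :=
  exists p1 p2 : {poly {poly rat}},
    [/\ ev2 a b p2 != 0, f = FracField.tofrac p1 / FracField.tofrac p2
      & v = ev2 a b p1 / ev2 a b p2].

(* Main.v *)
(* Put z_j = q^(-lam_j) t^j for the rows j = 0, 1, ..., n of lam, the last one being empty.
   Telescoping the products over arms and legs turns the probability of adding a box in
   row k into prod_(j<n) (z_k - t z_j) / prod_(j<=n, j<>k) (z_k - z_j), and the other three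
   kinds of local probabilities into similar ratios; they vanish by themselves at the rows
   where no box can be added or removed.  So the three identities saying that the local
   probabilities sum to 1 are instances of Lagrange interpolation: the sum over the nodes x
   of p(x) / prod_(y<>x) (x - y) is the top coefficient of p.
   Revealing the labels of a growth from the NW corner (resp. from the SE boundary) gives (1)
   (resp. (2)).  For (3), in every square the two local probabilities differ by the ratio of
   the psi and phi weights of opposite edges, and these ratios telescope over the grid.
   Finally, at the given real points all local probabilities are regular and nonnegative, and
   a nonnegative number that belongs to a family with sum 1 is at most 1. *)

Require Import Defs.
From HB Require Import structures.
From mathcomp Require Import all_boot all_order all_algebra all_fingroup.
From mathcomp Require Import fraction.
From mathcomp Require Import zify ring lra.
Set Implicit Arguments. Unset Strict Implicit. Unset Printing Implicit Defensive.
Import Order.TTheory GRing.Theory Num.Theory.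
Local Open Scope ring_scope.

(** * Lagrange interpolation *)

(** The identities are proved over any field in which $q$, $t$ and the brackets $1-q^it^j$ with
    $i+j>0$ are nonzero; the denominators are nonzero because one minus a quotient of comparable
    nodes is such a bracket. A list of length $n$ offers $n$ rows for a new box, but there are $n+1$
    nodes. The term of the surplus node vanishes because a shape with fewer than $n$ cells also has
    an empty last row. For $\mu\lessdot\lambda$ with the box in row $m$, one factor of [gamma]
    cancels the zero of the numerator at $t z_m$, and the other adds the node $q z_m$, which is the
    node of row $m$ in $\mu$. The degree is then too small for a top coefficient, and the term at
    the added node becomes the normalisation. In the backward sum numerator and denominator change
    places: the nodes are the $t z_m$ and $t z_k/q$. Since (2) also sums over the permutations, no
    positions of 1s are prescribed there; the local rules and the boundary force them to form a
    permutation matrix. *)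

Lemma lagrange_lead_coef (K : fieldType) (rs : seq K) (p : {poly K}) :
  uniq rs -> (size p <= size rs)%N ->
  \sum_(x <- rs) p.[x] / \prod_(y <- rs | y != x) (x - y) = p`_(size rs).-1.
Proof.
move=> urs sp.
pose l (x : K) := \prod_(y <- rs | y != x) ('X - y%:P).
have lE x : l x = \prod_(y <- [seq y <- rs | y != x]) ('X - y%:P).
  by rewrite /l big_filter.
have szl x : x \in rs -> size (l x) = size rs.
  move=> xrs; rewrite lE size_prod_XsubC -rem_filter // size_rem //.
  by rewrite prednK //; case: (rs) xrs.
have lX x : (l x).[x] = \prod_(y <- rs | y != x) (x - y).
  by rewrite horner_prod; apply: eq_bigr => y _; rewrite hornerXsubC.
have l0 x y : y \in rs -> y != x -> (l x).[y] = 0.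
  move=> yrs yx; apply/eqP; rewrite lE; apply/eqP/rootP.
  by rewrite root_prod_XsubC mem_filter yx.
have d0 x : \prod_(y <- rs | y != x) (x - y) != 0.
  by rewrite prodf_seq_neq0; apply/allP => y _; apply/implyP => yx; rewrite subr_eq0 eq_sym.
pose c x := p.[x] / \prod_(y <- rs | y != x) (x - y).
(* Both sides have size at most [size rs] and agree at the points of [rs]. Each [l x] is monic of
   degree [(size rs).-1], so the top coefficient is the sum of the [c x]. *)
have -> : p = \sum_(x <- rs) c x *: l x.
  apply/eqP; rewrite -subr_eq0; apply/eqP.
  apply: (@roots_geq_poly_eq0 _ _ rs) => //.
    apply/allP => y yrs; apply/rootP.
    rewrite hornerD hornerN horner_sum (bigD1_seq y) //= big1_seq; last first.
      by move=> x /andP[xy xrs]; rewrite hornerZ l0 ?mulr0 // eq_sym.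
    by rewrite hornerZ lX addr0 divfK // subrr.
  rewrite (leq_trans (size_polyD _ _)) // size_polyN geq_max sp /=.
  rewrite big_seq; apply: (leq_trans (size_sum _ _ _)).
  apply/bigmax_leqP_seq => x xrs _.
  by rewrite (leq_trans (size_scale_leq _ _)) // szl.
rewrite coef_sum [LHS]big_seq [RHS]big_seq; apply: eq_bigr => x xrs.
rewrite coefZ -(szl x) // -lead_coefE lE (monicP (monic_prod_XsubC _ _ _)) mulr1.
rewrite -lX horner_sum (bigD1_seq x) //= big1_seq ?addr0.
  by rewrite hornerZ lX mulfK.
by move=> y /andP[yx yrs]; rewrite hornerZ l0 ?mulr0 // eq_sym.
Qed.

(** * Partitions and cells *)

Lemma is_partitionP (lam : seq nat) :
  reflect (forall i, nth 0%N lam i.+1 <= nth 0%N lam i)%N (is_partition lam).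
Proof.
apply: (iffP idP) => [/(sortedP 0%N) h i|h].
  case: (ltnP i.+1 (size lam)) => [/h //|ge]; by rewrite nth_default.
by apply/(sortedP 0%N) => i _; apply: h.
Qed.

Lemma partition_nth_le (lam : seq nat) i j :
  is_partition lam -> (i <= j)%N -> (nth 0%N lam j <= nth 0%N lam i)%N.
Proof.
move=> /is_partitionP h /subnKC <-; elim: (j - i)%N => [|d IH]; first by rewrite addn0.
by rewrite addnS (leq_trans (h _)).
Qed.

Lemma addable_lt (lam : seq nat) k j :
  is_partition (incr_nth lam k) -> (j < k)%N -> (nth 0%N lam k < nth 0%N lam j)%N.
Proof.
move=> plk jk; have := partition_nth_le plk (ltnW jk).
by rewrite !nth_incr_nth eqxx gtn_eqF.
Qed.

Lemma size_incr (lam : seq nat) k : (k < size lam)%N -> size (incr_nth lam k) = size lam.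
Proof. by move=> kn; rewrite size_incr_nth kn. Qed.

Lemma mem_cells (lam : seq nat) c : (c \in cells lam) = in_cells lam c.
Proof.
case: c => x y; rewrite /in_cells /=; apply/allpairsPdep/and3P => /=.
  case=> y' [x' [+ + [-> ->]]]; rewrite !mem_iota => /andP[-> _] /andP[-> xl].
  by split=> //; lia.
case=> x1 y1 xl; exists y, x; split=> //; rewrite mem_iota.
  rewrite y1 /=; case: (ltnP y (1 + size lam)) => // ge.
  by move: xl; rewrite /part nth_default //; lia.
by rewrite x1 /=; lia.
Qed.

Lemma part_incr (lam : seq nat) k y :
  part (incr_nth lam k) y.+1 = ((k == y) + part lam y.+1)%N.
Proof. by rewrite /part nth_incr_nth. Qed.

Lemma mem_skew_incr (lam : seq nat) k c :
  (c \in Defs.skew (incr_nth lam k) lam) = (c == ((nth 0%N lam k).+1, k.+1))%N.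
Proof.
rewrite mem_filter mem_cells /in_cells; case: c => x [|y] /=.
  by rewrite andbF xpair_eqE /= andbF.
rewrite part_incr xpair_eqE eqSS [k == y]eq_sym /part /=.
by case: eqP => [->|_] /=; lia.
Qed.

Lemma has_skew_incr (lam : seq nat) k (p : pred (nat * nat)) :
  has p (Defs.skew (incr_nth lam k) lam) = p ((nth 0%N lam k).+1, k.+1)%N.
Proof.
apply/hasP/idP => [[c]|pc].
  by rewrite mem_skew_incr => /eqP ->.
by exists ((nth 0%N lam k).+1, k.+1)%N; rewrite // mem_skew_incr.
Qed.

Lemma big_iota0 (R : Type) (idx : R) (op : R -> R -> R) n (P : pred nat) (F : nat -> R) :
  \big[op/idx]_(i <- iota 0 n | P i) F i = \big[op/idx]_(i < n | P i) F i.
Proof. by rewrite -(big_mkord P F) /index_iota subn0. Qed.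

Lemma big_cells (R : Type) (idx : R) (op : Monoid.law idx) (lam : seq nat)
    (P : pred (nat * nat)) (F : nat * nat -> R) :
  \big[op/idx]_(c <- cells lam | P c) F c =
  \big[op/idx]_(y < size lam) \big[op/idx]_(x < nth 0%N lam y | P (x.+1, y.+1)) F (x.+1, y.+1).
Proof.
rewrite big_mkcond big_allpairs_dep /=.
rewrite (iotaDl 1 0) big_map /= big_iota0.
apply: eq_bigr => y _; rewrite (iotaDl 1 0) big_map /= big_iota0.
by rewrite /part /= -big_mkcond.
Qed.

Lemma big_Rset (K : fieldType) (lam : seq nat) k (F : nat * nat -> K) : (k < size lam)%N ->
  \prod_(c <- Rset (incr_nth lam k) lam) F c = \prod_(x < nth 0%N lam k) F (x.+1, k.+1).
Proof.
move=> kn; rewrite big_filter.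
under eq_bigl do rewrite has_skew_incr /=.
rewrite big_cells (bigD1 (Ordinal kn)) //= [X in _ * X]big1 ?mulr1.
  by apply: eq_bigl => x /=; rewrite eqxx.
move=> y yk; rewrite big_pred0 // => x /=.
by apply/negbTE; apply: contraNneq yk => -[yk]; apply/eqP/val_inj.
Qed.

Lemma big_Cset (K : fieldType) (lam : seq nat) k (F : nat * nat -> K) :
  is_partition lam -> (k < size lam)%N -> is_partition (incr_nth lam k) ->
  \prod_(c <- Cset (incr_nth lam k) lam) F c
  = \prod_(0 <= y < k) F ((nth 0%N lam k).+1, y.+1).
Proof.
move=> pl kn plk; rewrite big_filter.
under eq_bigl do rewrite has_skew_incr /=.
rewrite big_cells -(big_mkord xpredT (fun y => \prod_(x < nth 0%N lam y | (nth 0%N lam k).+1 == x.+1) F (x.+1, y.+1))).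
rewrite (@big_cat_nat _ _ _ k) //=; last exact: ltnW.
rewrite [X in _ * X]big_nat [X in _ * X]big1 ?mulr1.
  apply: eq_big_nat => y /andP[_ yk].
  have lt := addable_lt plk yk.
  rewrite (bigD1 (Ordinal lt)) //= ?eqxx // big_pred0 ?mulr1 // => x.
  by rewrite eqSS -val_eqE /= [_ == val x]eq_sym andbN.
move=> y /andP[ky _]; rewrite big_pred0 // => x; rewrite eqSS.
have := partition_nth_le pl ky; case: x => x /=; lia.
Qed.

Lemma count_geq_le (l : seq nat) x m :
  path geq m l -> (m < x)%N -> count (fun p => x <= p)%N l = 0%N.
Proof.
elim: l m => //= p l IH m /andP[pm pl] mx.
by rewrite (IH p) //; lia.
Qed.

Lemma conj_part_split (lam : seq nat) k x : is_partition lam -> (k < size lam)%N ->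
  (x <= nth 0%N lam k)%N ->
  conj_part lam x = (k.+1 + count (fun p => x <= p)%N (drop k.+1 lam))%N.
Proof.
move=> pl kn xk; rewrite /conj_part -[in LHS](cat_take_drop k.+1 lam) count_cat; congr addn.
have /eqP sz : size (take k.+1 lam) == k.+1 by rewrite size_take_min; lia.
rewrite -[RHS]sz; apply/eqP; rewrite -all_count; apply/(all_nthP 0%N) => i; rewrite sz => ik.
by rewrite nth_take //; apply: leq_trans xk (partition_nth_le pl _).
Qed.

(** The column of the new box meets exactly the $k$ rows before it: these are longer than row $k$
    because the box can be added, and the rows from $k$ on end before that column. *)
Lemma conj_part_addable (lam : seq nat) k : is_partition lam -> (k < size lam)%N ->
  is_partition (incr_nth lam k) -> conj_part lam (nth 0%N lam k).+1 = k.
Proof.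
move=> pl kn plk; have [a aE] : {a | a = nth 0%N lam k} by exists (nth 0%N lam k).
rewrite -aE /conj_part -[in LHS](cat_take_drop k lam) count_cat.
have /eqP sz : size (take k lam) == k by rewrite size_take_min; lia.
rewrite (@count_geq_le (drop k lam) a.+1 a) //; last first.
  by have := drop_sorted k pl; rewrite (drop_nth 0%N kn) /= -aE leqnn.
rewrite addn0 -[RHS]sz; apply/eqP; rewrite -all_count.
apply/(all_nthP 0%N) => i; rewrite sz => ik.
by rewrite nth_take // aE; apply: addable_lt.
Qed.

Lemma conj_part_incr (lam : seq nat) k x : (k < size lam)%N ->
  conj_part (incr_nth lam k) x = (conj_part lam x + (x == (nth 0%N lam k).+1))%N.
Proof.
rewrite /conj_part; elim: lam k => // a l IH [|k] /= kn; last by rewrite IH // addnA.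
by lia.
Qed.

(** The first row always accepts a box, and any other row is blocked only by a previous row of the
    same length. In terms of nodes this is the coincidence $z_k = t z_{k-1}$. *)
Lemma non_addable lam k : is_partition lam -> ~~ is_partition (incr_nth lam k) ->
  exists2 j, k = j.+1 & nth 0%N lam j = nth 0%N lam k.
Proof.
move=> /is_partitionP pl npl; case: k npl => [|k] npl.
  case/negP: npl; apply/is_partitionP => i; rewrite !nth_incr_nth /=.
  exact: leq_trans (pl i) (leq_addl _ _).
exists k => //; apply/eqP; rewrite eqn_leq pl andbT leqNgt.
apply: contra npl => lt; apply/is_partitionP => i; rewrite !nth_incr_nth eqSS.
by case: eqP => [<-|_]; [rewrite gtn_eqF | have := pl i; lia].
Qed.

Lemma telescope_prodf_le (K : fieldType) (m n : nat) (f : nat -> K) :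
  (forall k, (m <= k < n)%N -> f k != 0) -> f n != 0 -> (m <= n)%N ->
  \prod_(m <= k < n) (f k.+1 / f k) = f n / f m.
Proof.
move=> f0 fn0; rewrite leq_eqVlt => /predU1P[-> | mn].
  by rewrite big_geq // divff.
by rewrite telescope_prodf // => k /andP[/ltnW mk kn]; rewrite f0 // mk.
Qed.

(* The column heights of the diagram of [l] are constant between consecutive parts, so the
   product telescopes there. *)
Lemma prod_telescope_conj (K : fieldType) (h : nat -> nat -> K) (l : seq nat) M :
  (forall x j, (x <= M)%N -> h x j != 0) -> path geq M l ->
  \prod_(x < M) (h x.+1 (count (fun p => x.+1 <= p)%N l) / h x (count (fun p => x.+1 <= p)%N l))
  = h M 0%N / h 0%N (size l) * \prod_(i < size l) (h (nth 0%N l i) i.+1 / h (nth 0%N l i) i).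
Proof.
elim: l h M => [|p l IH] h M h0 /=.
  move=> _; rewrite big_ord0 mulr1 -(big_mkord xpredT (fun x => h x.+1 0%N / h x 0%N)).
  by rewrite telescope_prodf_le // ?h0 // => k /= kM; rewrite h0 // ltnW.
case/andP => pM pl; rewrite big_ord_recl /=.
rewrite -(big_mkord xpredT (fun x => h x.+1 ((x.+1 <= p) + count (fun p => x.+1 <= p) l)%N
  / h x ((x.+1 <= p) + count (fun p => x.+1 <= p) l)%N)).
(* Up to column [p] the row of length [p] adds one to the column heights of [l]; beyond it the
   columns are empty, since [p] bounds all parts of [l]. *)
rewrite (@big_cat_nat _ _ _ p) //=.
have -> : \prod_(0 <= x < p) (h x.+1 ((x.+1 <= p) + count (fun p => x.+1 <= p) l)%N
  / h x ((x.+1 <= p) + count (fun p => x.+1 <= p) l)%N) = \prod_(x < p) (h x.+1 (count (fun p => x.+1 <= p) l).+1%N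
  / h x (count (fun p => x.+1 <= p) l).+1%N).
  by rewrite big_mkord; apply: eq_bigr => x _; rewrite ltn_ord.
rewrite (IH (fun x j => h x j.+1)) //; last by move=> x j xp; rewrite h0 // (leq_trans xp).
have -> : \prod_(p <= x < M) (h x.+1 ((x.+1 <= p) + count (fun p => x.+1 <= p) l)%N
  / h x ((x.+1 <= p) + count (fun p => x.+1 <= p) l)%N) = h M 0%N / h p 0%N.
  rewrite -(telescope_prodf_le (f := fun x => h x 0%N)) ?h0 //; last first.
    by move=> k /andP[_ /ltnW kM]; rewrite h0.
  apply: eq_big_nat => x /andP[px _].
  by rewrite ltnNge px /= (count_geq_le pl).

have h1 := h0 p 0%N pM; have h2 := h0 p 1%N pM; have h3 := h0 0%N (size l).+1 isT.
by field; rewrite h3 h1.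
Qed.

(** * Arms, legs and bracket products when a box is added in row [k] *)

Section LocalWeights.
Variables (K : fieldType) (q t : K).
Hypothesis brk_neq0 : forall i j, (0 < i + j)%N -> brk q t i j != 0.
Hypotheses (q_neq0 : q != 0) (t_neq0 : t != 0).
Variables (lam : seq nat) (k : nat).
Hypotheses (pl : is_partition lam) (kn : (k < size lam)%N) (plk : is_partition (incr_nth lam k)).
Local Notation nu := (incr_nth lam k).
Local Notation a := (nth 0%N lam k).
Local Notation n := (size lam).

Lemma arm_row x : arm lam (x.+1, k.+1)%N = (a - x.+1)%N.
Proof. by []. Qed.
Lemma arm_row_incr x : arm nu (x.+1, k.+1)%N = (a - x)%N.
Proof. by rewrite /arm /= part_incr eqxx add1n subSS. Qed.
Lemma leg_row x : (x < a)%N ->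
  leg lam (x.+1, k.+1) = count (fun p => x.+1 <= p)%N (drop k.+1 lam).
Proof. by move=> xa; rewrite /leg /= (@conj_part_split _ k) // addKn. Qed.
Lemma leg_row_incr x : (x < a)%N ->
  leg nu (x.+1, k.+1) = count (fun p => x.+1 <= p)%N (drop k.+1 lam).
Proof. by move=> xa; rewrite -leg_row // /leg /= conj_part_incr // eqSS ltn_eqF // addn0. Qed.
Lemma arm_col y : arm lam (a.+1, y.+1) = (nth 0%N lam y - a.+1)%N.
Proof. by []. Qed.
Lemma arm_col_incr y : (y < k)%N -> arm nu (a.+1, y.+1) = (nth 0%N lam y - a.+1)%N.
Proof. by move=> yk; rewrite /arm /= part_incr gtn_eqF. Qed.
Lemma leg_col y : (y < k)%N -> leg lam (a.+1, y.+1) = (k - y.+1)%N.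
Proof. by move=> yk; rewrite /leg /= conj_part_addable. Qed.
Lemma leg_col_incr y : (y < k)%N -> leg nu (a.+1, y.+1) = (k - y)%N.
Proof. by move=> yk; rewrite /leg /= conj_part_incr // conj_part_addable // eqxx addn1 subSS. Qed.

Lemma path_drop : path geq a (drop k.+1 lam).
Proof. by have := drop_sorted k pl; rewrite (drop_nth 0%N kn). Qed.

(** Adding a box at the end of row $k$ keeps the legs of this row and shifts its arms by one. Each
    cell thus contributes a ratio of [h] at consecutive columns with the same leg, for either kind
    of bracket. *)
Lemma prod_row_telescope (h : nat -> nat -> K) :
  (forall x j, (x <= a)%N -> h x j != 0) ->
  \prod_(c <- Rset nu lam) (h c.1 (leg lam c) / h c.1.-1 (leg nu c))
  = h a 0%N / h 0%N (n - k.+1)%N *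
    \prod_(k.+1 <= j < n) (h (nth 0%N lam j) (j - k)%N / h (nth 0%N lam j) (j - k.+1)%N).
Proof.
move=> h0; rewrite big_Rset //=.
transitivity (h a 0%N / h 0%N (size (drop k.+1 lam)) * \prod_(i < size (drop k.+1 lam))
   (h (nth 0%N (drop k.+1 lam) i) i.+1 / h (nth 0%N (drop k.+1 lam) i) i)).
  rewrite -prod_telescope_conj //; last exact: path_drop.
  by apply: eq_bigr => x _; rewrite leg_row ?leg_row_incr.
rewrite size_drop -[in RHS](add0n k.+1) big_addn big_mkord; congr (_ * _).
by apply: eq_bigr => i _; rewrite nth_drop addnK [(k.+1 + i)%N]addnC addnS -addSn addnK.
Qed.

Lemma row_brkE :
  \prod_(c <- Rset nu lam) (brk q t (arm lam c) (leg lam c).+1 / brk q t (arm nu c) (leg nu c).+1)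
  = brk q t 0 1 / brk q t a (n - k) *
    \prod_(k.+1 <= j < n) (brk q t (a - nth 0%N lam j) (j - k).+1 / brk q t (a - nth 0%N lam j) (j - k)).
Proof.
rewrite big_Rset // -(subnSK kn).
pose h x j := brk q t (a - x) j.+1.
transitivity (\prod_(c <- Rset nu lam) (h c.1 (leg lam c) / h c.1.-1 (leg nu c))).
  by rewrite big_Rset //; apply: eq_bigr => x _; rewrite arm_row arm_row_incr.
rewrite prod_row_telescope => [|x j _]; last by rewrite brk_neq0 // addnS.
rewrite /h subnn subn0; congr (_ * _).
by apply: eq_big_nat => j /andP[kj _]; rewrite subnSK.
Qed.

Lemma row_brkbarE :
  \prod_(c <- Rset nu lam) (brk q t (arm lam c).+1 (leg lam c) / brk q t (arm nu c).+1 (leg nu c))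
  = brk q t 1 0 / brk q t a.+1 (n - k.+1) *
    \prod_(k.+1 <= j < n)
      (brk q t (a - nth 0%N lam j).+1 (j - k) / brk q t (a - nth 0%N lam j).+1 (j - k.+1)).
Proof.
pose h x j := brk q t (a - x).+1 j.
transitivity (\prod_(c <- Rset nu lam) (h c.1 (leg lam c) / h c.1.-1 (leg nu c))).
  by rewrite !big_Rset //; apply: eq_bigr => x _; rewrite arm_row arm_row_incr.
rewrite prod_row_telescope => [|x j _]; last by rewrite brk_neq0.
by rewrite /h subnn subn0.
Qed.

Lemma col_brkE :
  \prod_(c <- Cset nu lam) (brk q t (arm lam c).+1 (leg lam c) / brk q t (arm nu c).+1 (leg nu c))
  = \prod_(0 <= j < k) (brk q t (nth 0%N lam j - a) (k - j.+1) / brk q t (nth 0%N lam j - a) (k - j)).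
Proof.
rewrite big_Cset //; apply: eq_big_nat => y /andP[_ yk].
by rewrite arm_col arm_col_incr // leg_col // leg_col_incr // subnSK // addable_lt.
Qed.

Lemma col_brkbarE :
  \prod_(c <- Cset nu lam) (brk q t (arm lam c) (leg lam c).+1 / brk q t (arm nu c) (leg nu c).+1)
  = \prod_(0 <= j < k)
      (brk q t (nth 0%N lam j - a.+1) (k - j) / brk q t (nth 0%N lam j - a.+1) (k - j).+1).
Proof.
rewrite big_Cset //; apply: eq_big_nat => y /andP[_ yk].
by rewrite arm_col arm_col_incr // leg_col // leg_col_incr // subnSK.
Qed.

Lemma narm_incr : narm nu = (narm lam + a)%N.
Proof.
have nE l : narm l = (\sum_(y < size l) \sum_(x < nth 0%N l y) (nth 0%N l y - x.+1))%N.
  by rewrite /narm sumnE big_map big_cells.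
rewrite !nE size_incr // (bigD1 (Ordinal kn)) //= [in RHS](bigD1 (Ordinal kn)) //=.
(* The arms of a row of length $b+1$ are those of a row of length $b$ together with $b$ itself. *)
have T b : (\sum_(x < b.+1) (b.+1 - x.+1) = \sum_(x < b) (b - x.+1) + b)%N.
  rewrite big_ord_recl addnC /= subn1; congr (_ + _)%N.
rewrite nth_incr_nth eqxx add1n T -addnA [(a + _)%N]addnC addnA; congr (_ + _ + _)%N.
apply: eq_bigr.
by move=> y yk; rewrite nth_incr_nth -val_eqE /= eq_sym in yk *; rewrite (negbTE yk).
Qed.

End LocalWeights.

Lemma sum_count_geq (l : seq nat) M : path geq M l ->
  (\sum_(x < M) count (fun p => x.+1 <= p) l = sumn l)%N.
Proof.
move=> pl; have {pl} : all (fun p => p <= M)%N l.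
  by have := order_path_min _ pl; apply => x y z /= h1 h2; apply: leq_trans h2 h1.
elim: l => [|p l IH] /=; first by rewrite big1.
case/andP=> pM /IH <-; rewrite big_split /=; congr addn.
rewrite -(subnKC pM) big_split_ord /= [X in (_ + X)%N]big1 => [|i _]; last by lia.
rewrite addn0 (eq_bigr (fun _ => 1%N)) ?sum1_card ?card_ord // => i _.
by rewrite ltn_ord.
Qed.

Lemma sumn_drop_incr (l : seq nat) m k : (k < size l)%N ->
  sumn (drop m (incr_nth l k)) = (sumn (drop m l) + (m <= k))%N.
Proof.
elim: l m k => // p l IH [|m] [|k] //= kl; last by rewrite IH.
- by rewrite addn1.
- by have := IH 0%N k kl; rewrite !drop0 => ->; rewrite addnA.
by rewrite addn0.
Qed.

(** The legs of the cells of row $y$ count the cells of all later rows, column by column. A box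
    added in row $k$ is therefore counted once for each of the $k$ rows before it. *)
Lemma nlegE (lam : seq nat) : is_partition lam ->
  nleg lam = (\sum_(y < size lam) sumn (drop y.+1 lam))%N.
Proof.
move=> pl; rewrite /nleg sumnE big_map big_cells; apply: eq_bigr => y _.
rewrite -(@sum_count_geq _ (nth 0%N lam y)).
  by apply: eq_bigr => x _; rewrite leg_row.
by have := drop_sorted y pl; rewrite (drop_nth 0%N).
Qed.

Lemma nleg_incr (lam : seq nat) k : is_partition lam -> (k < size lam)%N ->
  is_partition (incr_nth lam k) -> nleg (incr_nth lam k) = (nleg lam + k)%N.
Proof.
move=> pl kn plk; rewrite !nlegE // size_incr //.
under eq_bigr do rewrite sumn_drop_incr //.
rewrite big_split /=; congr addn.
rewrite -(subnKC (ltnW kn)) big_split_ord /= [X in (_ + X)%N]big1 => [|i _]; last by lia.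
rewrite addn0 (eq_bigr (fun _ => 1%N)) ?sum1_card ?card_ord // => i _.
by rewrite ltn_ord.
Qed.

(** * Local probabilities in terms of nodes *)

Lemma big_nat_splitD1 (K : fieldType) (f : nat -> K) (k n : nat) : (k < n)%N ->
  \prod_(0 <= j < n) f j = \prod_(0 <= j < k) f j * (f k * \prod_(k.+1 <= j < n) f j).
Proof.
by move=> kn; rewrite (@big_cat_nat _ _ _ k) ?(ltnW kn) //= (big_ltn kn).
Qed.

Lemma big_nat_splitC1 (K : fieldType) (f : nat -> K) (k n : nat) : (k < n)%N ->
  \prod_(0 <= j < n | j != k) f j = \prod_(0 <= j < k) f j * \prod_(k.+1 <= j < n) f j.
Proof.
move=> kn; rewrite big_mkcond (big_nat_splitD1 _ kn) eqxx mul1r /=.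
by congr (_ * _); apply: eq_big_nat => j /andP[h1 h2]; rewrite ?(ltn_eqF h2) ?(gtn_eqF h1).
Qed.

Lemma big_nat_D1 (K : fieldType) (f : nat -> K) (k n : nat) : (k < n)%N ->
  \prod_(0 <= j < n) f j = f k * \prod_(0 <= j < n | j != k) f j.
Proof. by move=> kn; rewrite (big_nat_splitD1 _ kn) (big_nat_splitC1 _ kn) mulrCA. Qed.

Section Nodes.
Variables (K : fieldType) (q t : K).
Hypothesis brk_neq0 : forall i j, (0 < i + j)%N -> brk q t i j != 0.
Hypotheses (q_neq0 : q != 0) (t_neq0 : t != 0).

Definition mono (j b : nat) : K := t ^+ j / q ^+ b.
(* [lam] is extended by 0, so that [node lam (size lam)] belongs to an empty row. *)
Definition node (lam : seq nat) (j : nat) : K := mono j (nth 0%N lam j).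

Lemma mono_neq0 j b : mono j b != 0.
Proof. by rewrite mulf_neq0 ?invr_eq0 ?expf_neq0. Qed.

Lemma mulr_mono j b : t * mono j b = mono j.+1 b.
Proof. by rewrite /mono exprS mulrA. Qed.

Lemma mono_divr j b : mono j b / q = mono j b.+1.
Proof. by rewrite /mono exprSr invfM mulrA. Qed.

Lemma mulq_mono j b : q * mono j b.+1 = mono j b.
Proof. by rewrite -mono_divr mulrC divfK. Qed.

Lemma brk_mono j b i a : (i <= j)%N -> (b <= a)%N ->
  brk q t (a - b) (j - i) = 1 - mono j b / mono i a.
Proof.
move=> ij ba; rewrite /brk /mono !exprB ?unitfE //.
by field; rewrite ?expf_neq0.
Qed.

(** Every later nonvanishing statement about nodes reduces to this one; the order conditions are
    what turns one minus the quotient into a bracket with natural exponents. *)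
Lemma mono_neq j b i a : (i <= j)%N -> (b <= a)%N -> (i < j)%N || (b < a)%N ->
  mono j b != mono i a.
Proof.
move=> ij ba lt; have : brk q t (a - b) (j - i) != 0 by rewrite brk_neq0 //; lia.
by rewrite brk_mono //; apply: contraNneq => ->; rewrite divff ?mono_neq0 // subrr.
Qed.

Lemma node_neq lam i j : is_partition lam -> i != j -> node lam i != node lam j.
Proof.
move=> pl; wlog ij : i j / (i < j)%N => [wl|_].
  by case: (ltngtP i j) => // ij _; [|rewrite eq_sym]; rewrite wl ?ltn_eqF.
have le := partition_nth_le pl (ltnW ij).
by rewrite eq_sym mono_neq //; lia.
Qed.

(** Addability of row $k$ rules out the only possible coincidence, $z_k = t z_{k-1}$. *)
Lemma node_neq_mult lam k j : is_partition lam -> is_partition (incr_nth lam k) ->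
  node lam k != t * node lam j.
Proof.
move=> pl plk; rewrite mulr_mono; case: (leqP k j) => kj.
  have le := partition_nth_le pl kj.
  by rewrite eq_sym mono_neq //; lia.
have lt := addable_lt plk kj.
by rewrite mono_neq //; lia.
Qed.

(** The monomial $t z_k/q$ is that of row $k+1$ and length $\lambda_k+1$, hence comparable with the
    nodes of all rows but $k$. For $j=k$ one would need $t\neq q$, which is not a statement about
    brackets. *)
Lemma cornode_neq_node lam k j : is_partition lam -> is_partition (incr_nth lam k) ->
  j != k -> t * node lam k / q != node lam j.
Proof.
move=> pl plk jk; rewrite mulr_mono mono_divr; case: (ltngtP k j) jk => // kj _.
  have := partition_nth_le pl (ltnW kj) => le.
  by rewrite eq_sym mono_neq //; lia.
have lt := addable_lt plk kj.
by rewrite mono_neq //; lia.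
Qed.

Lemma cornode_neq_mult lam k j : is_partition lam -> is_partition (incr_nth lam k) ->
  t * node lam k / q != t * node lam j.
Proof.
move=> pl plk; rewrite !mulr_mono mono_divr; case: (leqP k j) => kj.
  have := partition_nth_le pl kj => le.
  by rewrite eq_sym mono_neq //; lia.
have lt := addable_lt plk kj.
by rewrite mono_neq //; lia.
Qed.

Lemma node_incr mu m j : node mu j = (if j == m then q else 1) * node (incr_nth mu m) j.
Proof.
rewrite /node nth_incr_nth; case: (eqVneq j m) => [->|jm].
  by rewrite mulq_mono.
by rewrite mul1r.
Qed.

(* At w = z_k this is the probability of adding a box in row k, at w = t z_k / q the one of
   removing it again. *)
Definition nodeprod (z : nat -> K) (n k : nat) (w : K) : K :=
  \prod_(0 <= j < n) (w - t * z j) / \prod_(0 <= j < n.+1 | j != k) (w - z j).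

(** The left side has the shape delivered by the arm and leg products. Its isolated fraction pairs
    the numerator factor of row $k$ with the denominator factor of the empty row $n$; each row
    before $k$ yields a factor $t^{-1}$, and these use up $t^k$. *)
Lemma nodeprodE (z : nat -> K) (n k : nat) (w : K) : (k < n)%N -> w != 0 ->
  (forall j, z j != 0) -> (forall j, j != k -> w != z j) ->
  t ^+ k * ((1 - t * z k / w) / (1 - z n / w) *
    \prod_(k.+1 <= j < n) ((1 - t * z j / w) / (1 - z j / w)) *
    \prod_(0 <= j < k) ((1 - w / (t * z j)) / (1 - w / z j))) = nodeprod z n k w.
Proof.
move=> kn w0 z0 wz; rewrite /nodeprod (big_nat_splitD1 _ kn).
rewrite (big_nat_splitC1 _ (leqW kn)) big_nat_recr //=.
have -> : \prod_(k.+1 <= j < n) ((1 - t * z j / w) / (1 - z j / w))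
    = \prod_(k.+1 <= j < n) ((w - t * z j) / (w - z j)).
  apply: eq_big_nat => j /andP[kj _].
  have := wz j; rewrite gtn_eqF // => /(_ isT) wzj.
  by field; rewrite w0 subr_eq0 wzj.
have -> : \prod_(0 <= j < k) ((1 - w / (t * z j)) / (1 - w / z j))
    = \prod_(0 <= j < k) (t^-1 * ((w - t * z j) / (w - z j))).
  apply: eq_big_nat => j /andP[_ jk].
  have := wz j; rewrite ltn_eqF // => /(_ isT) wzj.
  by field; rewrite t_neq0 z0 !subr_eq0 wzj eq_sym wzj.
rewrite !big_split /= !prodfV prodr_const_nat subn0.
have wzn : w - z n != 0 by rewrite subr_eq0 wz // gtn_eqF.
have n1 : \prod_(0 <= j < k) (w - z j) != 0.
  rewrite prodf_seq_neq0; apply/allP => j; rewrite mem_index_iota /= => jk.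
  by rewrite subr_eq0 wz // ltn_eqF.
have n2 : \prod_(k.+1 <= j < n) (w - z j) != 0.
  rewrite prodf_seq_neq0; apply/allP => j; rewrite mem_index_iota => /andP[jk _] /=.
  by rewrite subr_eq0 wz // gtn_eqF.
have tk : t ^+ k != 0 by rewrite expf_neq0.
by field; rewrite tk n1 n2 wzn w0.
Qed.

Section Up.
Variables (lam : seq nat) (k : nat).
Hypotheses (pl : is_partition lam) (kn : (k < size lam)%N) (plk : is_partition (incr_nth lam k)).
Local Notation nu := (incr_nth lam k).
Local Notation n := (size lam).
Local Notation z := (node lam).

Lemma expz_nskew : t ^ nskew nu lam = t ^+ k.
Proof. by rewrite /nskew nleg_incr // PoszD addrC addKr. Qed.

(** The row product of [alpha] gives the factors of the rows after $k$ and of the empty row, the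
    column product those of the rows before $k$. *)
Lemma Pup_nodeprod : Pup q t lam nu = nodeprod z n k (z k).
Proof.
rewrite /Pup expz_nskew -nodeprodE ?mono_neq0 //; last first.
- by move=> j jk; rewrite node_neq // eq_sym.
- by move=> j; rewrite mono_neq0.
congr (_ * _); rewrite /alpha row_brkE // col_brkE // /node (nth_default _ (leqnn n)).
congr (_ / _ * _ * _).
- by rewrite mulr_mono -brk_mono // subnn subSnn.
- rewrite -brk_mono ?subn0 //; exact: ltnW.
- apply: eq_big_nat => j /andP[kj _]; have := partition_nth_le pl (ltnW kj) => le.
  by rewrite !mulr_mono -!brk_mono ?subSn ?(ltnW kj) ?(leqW (ltnW kj)).
- apply: eq_big_nat => j /andP[_ jk]; have := addable_lt plk jk => lt.
  by rewrite !mulr_mono -!brk_mono ?(ltnW lt) ?(ltnW jk).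
Qed.

Lemma Pbarup_nodeprod : Pbarup q t lam nu = nodeprod z n k (t * z k / q).
Proof.
rewrite /Pbarup expz_nskew -nodeprodE //; last first.
- by move=> j jk; rewrite cornode_neq_node // eq_sym.
- by move=> j; rewrite mono_neq0.
- by rewrite mulr_mono mono_divr mono_neq0.
congr (_ * _); rewrite /alphabar row_brkbarE // col_brkbarE // /node (nth_default _ (leqnn n)).
congr (_ / _ * _ * _).
- by rewrite mulr_mono mono_divr -brk_mono // subnn subSnn.
- by rewrite mulr_mono mono_divr -brk_mono // ?subn0.
- apply: eq_big_nat => j /andP[kj _]; have := partition_nth_le pl (ltnW kj) => le.
  by rewrite !mulr_mono !mono_divr -!brk_mono ?(leqW le) ?ltnS ?(ltnW kj) // ?subSS !(subSn le).
- apply: eq_big_nat => j /andP[_ jk]; have := addable_lt plk jk => lt.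
  by rewrite !mulr_mono !mono_divr -!brk_mono ?(leqW (ltnW jk)) // ?ltnS ?(ltnW jk) // ?subSS !(subSn (ltnW jk)).
Qed.

Lemma Pup_neq0 : Pup q t lam nu != 0.
Proof.
rewrite Pup_nodeprod mulf_neq0 // ?invr_eq0 prodf_seq_neq0; apply/allP => j _ /=.
  by rewrite subr_eq0 node_neq_mult.
by apply/implyP => jk; rewrite subr_eq0 node_neq // eq_sym.
Qed.

Lemma Pbarup_neq0 : Pbarup q t lam nu != 0.
Proof.
rewrite Pbarup_nodeprod mulf_neq0 // ?invr_eq0 prodf_seq_neq0; apply/allP => j _ /=.
  by rewrite subr_eq0 cornode_neq_mult.
by apply/implyP => jk; rewrite subr_eq0 cornode_neq_node.
Qed.

End Up.

End Nodes.

Lemma monic_prod_nodes (K : fieldType) (P : pred nat) (z : nat -> K) N :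
  \prod_(0 <= j < N | P j) ('X - (z j)%:P) \is monic.
Proof. by apply: monic_prod => j _; apply: monicXsubC. Qed.

Lemma size_prod_nodes (K : fieldType) (z : nat -> K) N :
  size (\prod_(0 <= j < N) ('X - (z j)%:P)) = N.+1.
Proof. by rewrite size_prod_XsubC size_iota subn0. Qed.

Lemma size_prod_nodesC1 (K : fieldType) (z : nat -> K) N k : (k < N)%N ->
  size (\prod_(0 <= j < N | j != k) ('X - (z j)%:P)) = N.
Proof.
move=> kN; rewrite -big_filter size_prod_XsubC -[filter _ _]/(filter (predC1 k) _).
rewrite -rem_filter ?iota_uniq // size_rem ?mem_index_iota // size_iota subn0.
by rewrite prednK // (leq_ltn_trans _ kN).
Qed.

Lemma horner_prod_nodes (K : fieldType) (P : pred nat) (z : nat -> K) N w :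
  (\prod_(0 <= j < N | P j) ('X - (z j)%:P)).[w] = \prod_(0 <= j < N | P j) (w - z j).
Proof. by rewrite horner_prod; apply: eq_bigr => j _; rewrite hornerXsubC. Qed.

Lemma lagrange_nodes (K : fieldType) (z : nat -> K) N (p : {poly K}) :
  injective z -> (size p <= N)%N ->
  \sum_(0 <= k < N) p.[z k] / \prod_(0 <= j < N | j != k) (z k - z j) = p`_N.-1.
Proof.
move=> zi sp; have := @lagrange_lead_coef K [seq z j | j <- index_iota 0 N] p.
rewrite map_inj_uniq // iota_uniq size_map size_iota subn0 => /(_ isT sp) <-.
rewrite big_map; apply: eq_bigr => k _; rewrite big_map; congr (_ / _).
by apply: eq_bigl => j; rewrite (inj_eq zi).
Qed.

(** The diagonal sums need one node outside the family: $q z_m$ next to the $z_k$ forwards, $t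
    z_k/q$ next to the $t z_m$ backwards. *)
Lemma lagrange_nodes_cons (K : fieldType) (z : nat -> K) N (w : K) (p : {poly K}) :
  injective z -> (forall j, z j != w) -> (size p <= N.+1)%N ->
  p.[w] / \prod_(0 <= j < N) (w - z j) +
  \sum_(0 <= k < N) p.[z k] / ((z k - w) * \prod_(0 <= j < N | j != k) (z k - z j)) = p`_N.
Proof.
move=> zi wz sp; have := @lagrange_lead_coef K (w :: [seq z j | j <- index_iota 0 N]) p.
rewrite /= map_inj_uniq // iota_uniq andbT size_map size_iota subn0.
have -> : w \notin [seq z j | j <- index_iota 0 N].
  by apply/mapP => -[j _ wj]; have := wz j; rewrite wj eqxx.
move=> /(_ isT sp) <-; rewrite big_cons; congr (_ / _ + _).
  by rewrite big_cons eqxx big_map; apply: eq_bigl => j; rewrite wz.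
rewrite big_map; apply: eq_bigr => k _; rewrite big_cons eq_sym wz big_map; congr (_ / (_ * _)).
by apply: eq_bigl => j; rewrite (inj_eq zi).
Qed.

Lemma expz_subn (K : fieldType) (x : K) (a b : nat) : x != 0 ->
  x ^ (a%:Z - b%:Z) = x ^+ a / x ^+ b.
Proof. by move=> x0; rewrite expfzDr // -invr_expz. Qed.

Lemma AexpE (mu : seq nat) m k : (m < size mu)%N -> (k < size mu)%N ->
  Aexp mu (incr_nth mu m) (incr_nth (incr_nth mu m) k) =
  (nth 0%N mu m)%:Z - (nth 0%N (incr_nth mu m) k)%:Z.
Proof. by move=> mn kn; rewrite /Aexp /nskew' !narm_incr ?size_incr //; lia. Qed.

Lemma BexpE (mu : seq nat) m k : is_partition mu -> (m < size mu)%N ->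
  is_partition (incr_nth mu m) -> (k < size mu)%N ->
  is_partition (incr_nth (incr_nth mu m) k) ->
  Bexp mu (incr_nth mu m) (incr_nth (incr_nth mu m) k) = k%:Z - m%:Z.
Proof. by move=> pm mn pl kn plk; rewrite /Bexp /nskew !nleg_incr ?size_incr //; lia. Qed.

(** * The local probabilities sum to 1 *)

Section LocalSums.
Variables (K : fieldType) (q t : K).
Hypothesis brk_neq0 : forall i j, (0 < i + j)%N -> brk q t i j != 0.
Hypotheses (q_neq0 : q != 0) (t_neq0 : t != 0).
Local Notation node := (node q t).

Lemma node_inj lam : is_partition lam -> injective (node lam).
Proof. by move=> pl i j; apply: contra_eq; apply: node_neq. Qed.

Lemma Pup_non_addable lam k : is_partition lam -> (k < size lam)%N ->
  ~~ is_partition (incr_nth lam k) -> exists2 j, (j < size lam)%N /\ k = j.+1 & node lam k = t * node lam j.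
Proof.
move=> pl kn npl; have [j kj lj] := non_addable pl npl.
exists j; first by split=> //; rewrite -ltnS -kj ltnW.
by rewrite /node -lj kj mulr_mono.
Qed.

Lemma node_last lam n : is_partition lam -> size lam = n.+1 -> nth 0%N lam n = 0%N ->
  node lam n.+1 = t * node lam n.
Proof. by move=> pl sz l0; rewrite /node l0 nth_default ?sz // mulr_mono. Qed.

Lemma nodeprod_eq0 z n k j : (j < n)%N -> z k = t * z j -> nodeprod t z n k (z k) = 0.
Proof.
move=> jn zk; rewrite /nodeprod (_ : \prod_(0 <= j < n) _ = 0) ?mul0r //.
by rewrite (big_nat_D1 _ jn) zk subrr mul0r.
Qed.

(** The numerator is monic of degree $n+1$ and there are $n+2$ nodes, so the top coefficient is
    1. *)
Lemma sum_Pup lam n : is_partition lam -> size lam = n.+1 -> nth 0%N lam n = 0%N ->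
  \sum_(0 <= k < n.+1 | is_partition (incr_nth lam k)) Pup q t lam (incr_nth lam k) = 1.
Proof.
move=> pl sz last0; set z := node lam.
pose p := \prod_(0 <= j < n.+1) ('X - (t * z j)%:P).
have sp : size p = n.+2 by apply: (size_prod_nodes (fun j => t * z j)).
have := lagrange_nodes (node_inj pl) (eq_leq sp).
rewrite -[n.+2.-1]/(n.+2).-1 -sp -lead_coefE.
rewrite (monicP (monic_prod_nodes xpredT (fun j => t * z j) n.+1)) sp => {}sp.
rewrite -[RHS]sp big_nat_recr //= -/z.
have pz k : p.[z k] / \prod_(0 <= j < n.+2 | j != k) (z k - z j) = nodeprod t z n.+1 k (z k).
  by rewrite (horner_prod_nodes xpredT (fun j => t * z j)).
(* Row $n+1$ lies outside the list. As row $n$ is empty too, their nodes differ by the factor $t$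
   and this term is zero. *)
rewrite pz (nodeprod_eq0 (ltnSn n) (node_last pl sz last0)) addr0 big_mkcond /=.
apply: eq_big_nat => k /andP[_ kn]; rewrite pz; case: ifPn => plk.
  by rewrite Pup_nodeprod // sz.
rewrite -sz in kn *; have [j [jn _] kj] := Pup_non_addable pl kn plk.
by rewrite (nodeprod_eq0 jn kj).
Qed.

Section Diag.
Variables (mu : seq nat) (m k : nat).
Local Notation lam := (incr_nth mu m).
Local Notation nu := (incr_nth lam k).
Hypotheses (pm : is_partition mu) (mn : (m < size mu)%N) (pl : is_partition lam).
Hypotheses (kn : (k < size mu)%N) (plk : is_partition nu).
Local Notation z := (node lam).

Lemma node_mu : node mu m = q * z m.
Proof. by rewrite (node_incr _ _ _ m) // eqxx. Qed.

Lemma gammaE : gamma q t mu lam nu =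
  (1 - z k / (q * z m)) * (1 - z k / (t * z m)) / ((1 - q) * (1 - t)).
Proof.
have zA : q ^ Aexp mu lam nu * t ^ Bexp mu lam nu = z k / (q * z m).
  rewrite -node_mu AexpE ?BexpE // !expz_subn // /node /mono.
  by field; rewrite !expf_neq0.
rewrite /gamma zA expfzDr // [t ^ (_ - 1)]expfzDr // mulrACA zA expr1z exprN1.
congr (_ * (1 - _) / _); field.
by rewrite t_neq0 q_neq0 mono_neq0.
Qed.

(** Since $B=k-m$, the power $t^{B-1}$ is $t^k/t^m/t$: a diagonal probability is a quotient of two
    plain ones corrected by [gamma], and the node formulas can be reused. *)
Lemma Pdiag_ratio : Pdiag q t mu lam nu =
  Pup q t lam nu / Pup q t mu lam / (t * gamma q t mu lam nu).
Proof.
rewrite /Pdiag /Pup /beta !expz_nskew ?size_incr // BexpE // expfzDr // expz_subn // exprN1.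
by rewrite !invfM; ring.
Qed.

Lemma Pbardiag_ratio : Pbardiag q t mu lam nu =
  Pbarup q t lam nu / Pbarup q t mu lam / (t * gamma q t mu lam nu).
Proof.
rewrite /Pbardiag /Pbarup /betabar !expz_nskew ?size_incr // BexpE // expfzDr // expz_subn // exprN1.
by rewrite !invfM; ring.
Qed.

(** The shapes [mu] and [lam] differ in row $m$ only, so the nodes of [mu] are those of [lam] with
    $q z_m$ in place of $z_m$. *)
Lemma Pup_base : Pup q t mu lam =
  (q * z m - t * (q * z m)) * \prod_(0 <= j < size mu | j != m) (q * z m - t * z j)
  / \prod_(0 <= j < (size mu).+1 | j != m) (q * z m - z j).
Proof.
rewrite Pup_nodeprod // /nodeprod (big_nat_D1 _ mn) node_mu; congr (_ * _ / _).
  by apply: eq_bigr => j jm; rewrite (node_incr t q_neq0 mu m j) (negbTE jm) mul1r.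
by apply: eq_bigr => j jm; rewrite (node_incr t q_neq0 mu m j) (negbTE jm) mul1r.
Qed.

Lemma Pbarup_base : Pbarup q t mu lam =
  (t * z m - t * (q * z m)) * \prod_(0 <= j < size mu | j != m) (t * z m - t * z j)
  / \prod_(0 <= j < (size mu).+1 | j != m) (t * z m - z j).
Proof.
rewrite Pbarup_nodeprod // /nodeprod (big_nat_D1 _ mn) node_mu.
have -> : t * (q * z m) / q = t * z m by field.
congr (_ * _ / _).
  by apply: eq_bigr => j jm; rewrite (node_incr t q_neq0 mu m j) (negbTE jm) mul1r.
by apply: eq_bigr => j jm; rewrite (node_incr t q_neq0 mu m j) (negbTE jm) mul1r.
Qed.

Lemma onem_t_neq0 : 1 - t != 0.
Proof. by have := brk_neq0 (isT : 0 < 0 + 1)%N; rewrite /brk expr0 mul1r expr1. Qed.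

Lemma onem_q_neq0 : 1 - q != 0.
Proof. by have := brk_neq0 (isT : 0 < 1 + 0)%N; rewrite /brk expr0 mulr1 expr1. Qed.

Lemma node_neq_qnode j : z j != q * z m.
Proof.
rewrite -node_mu; have := node_incr t q_neq0 mu m j.
case: (eqVneq j m) => [-> _|jm]; last by rewrite mul1r => <-; rewrite node_neq.
by rewrite node_mu -subr_eq0 -[X in X - _]mul1r -mulrBl mulf_neq0 ?mono_neq0 ?onem_q_neq0.
Qed.

(** The first factor is independent of $k$: it is minus the inverse of the Lagrange term at the
    added node $q z_m$. The second factor is the Lagrange term at $z_k$. *)
Lemma Pdiag_node : Pdiag q t mu lam nu =
  - (\prod_(0 <= j < (size mu).+1) (q * z m - z j)
     / \prod_(0 <= j < size mu | j != m) (q * z m - t * z j))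
  * (\prod_(0 <= j < size mu | j != m) (z k - t * z j)
     / ((z k - q * z m) * \prod_(0 <= j < (size mu).+1 | j != k) (z k - z j))).
Proof.
have := Pup_neq0 brk_neq0 q_neq0 t_neq0 pm mn pl.
rewrite Pdiag_ratio Pup_base => P0.
rewrite Pup_nodeprod ?size_incr // /nodeprod (big_nat_D1 _ mn) gammaE.
rewrite (big_nat_D1 _ (leqW mn)).
set D := \prod_(0 <= j < _ | j != k) _; set G := \prod_(0 <= j < _ | j != m) (z k - _).
set E := \prod_(0 <= j < _ | j != m) (_ - z j) in P0 *.
set F := \prod_(0 <= j < _ | j != m) _ in P0 *.
have E0 : E != 0 by apply: contraNneq P0 => ->; rewrite invr0 mulr0.
have F0 : F != 0 by apply: contraNneq P0 => ->; rewrite mulr0 mul0r.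
have D0 : D != 0.
  rewrite prodf_seq_neq0; apply/allP => j _; apply/implyP => jk.
  by rewrite subr_eq0 node_neq // eq_sym.
have zm0 : z m != 0 by rewrite mono_neq0.
have h1 := onem_t_neq0; have h2 := onem_q_neq0.
have h3 := node_neq_qnode k.
have h4 : z k != t * z m by rewrite node_neq_mult.
have h5 : q * z m - t * (q * z m) != 0.
  have -> : q * z m - t * (q * z m) = (1 - t) * (q * z m) by ring.
  exact: (mulf_neq0 h1 (mulf_neq0 q_neq0 zm0)).
field.
by rewrite D0 E0 F0 zm0 h1 h2 h5 t_neq0 q_neq0 !subr_eq0 h3 ![_ * _ == z k]eq_sym h3 h4.
Qed.

(** Read as a function of $m$, the second factor is the Lagrange term at $t z_m$ of the polynomial
    $\prod_{j\ne k}(X-z_j)$, with $t z_k/q$ as the added node. *)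
Lemma Pbardiag_node : Pbardiag q t mu lam nu =
  - Pbarup q t lam nu *
  (\prod_(0 <= j < (size mu).+1 | j != k) (t * z m - z j)
   / ((t * z m - t * z k / q) * \prod_(0 <= j < size mu | j != m) (t * z m - t * z j))).
Proof.
have := Pbarup_neq0 brk_neq0 q_neq0 t_neq0 pm mn pl.
rewrite Pbardiag_ratio Pbarup_base gammaE => P0.
have := big_nat_D1 (fun j => t * z m - z j) (leqW kn).
rewrite (big_nat_D1 _ (leqW mn)).
set H := \prod_(0 <= j < _ | j != k) _.
set E := \prod_(0 <= j < _ | j != m) (_ - z j) in P0 *.
set F := \prod_(0 <= j < _ | j != m) _ in P0 *.
set C := Pbarup _ _ _ _.
have E0 : E != 0 by apply: contraNneq P0 => ->; rewrite invr0 mulr0.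
have F0 : F != 0 by apply: contraNneq P0 => ->; rewrite mulr0 mul0r.
have zm0 : z m != 0 by rewrite mono_neq0.
have h1 := onem_t_neq0; have h2 := onem_q_neq0.
have h3 := node_neq_qnode k.
have h4 : z k != t * z m by rewrite node_neq_mult.
have h5 : t * z m - z k != 0 by rewrite subr_eq0 eq_sym.
(* The product [H] omits row $k$ and [E] omits row $m$; expressing one by the other leaves [field]
   with a single unknown product. *)
move=> HE; have -> : H = (t * z m - z m) * E / (t * z m - z k) by rewrite HE mulrC mulKf.
have h6 : t * z m - t * z k / q != 0.
  rewrite subr_eq0; apply: contra h3 => /eqP h; apply/eqP/(mulfI t_neq0).
  by rewrite [RHS]mulrCA h [RHS]mulrC divfK.
have h8 : q * z m - z k != 0 by rewrite subr_eq0 eq_sym.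
have h7 : t * z m * q - t * z k != 0.
  have -> : t * z m * q - t * z k = t * (q * z m - z k) by ring.
  exact: mulf_neq0.
have h9 : t * z m - t * (q * z m) != 0.
  have -> : t * z m - t * (q * z m) = (1 - q) * (t * z m) by ring.
  exact: (mulf_neq0 h2 (mulf_neq0 t_neq0 zm0)).
field.
by rewrite q_neq0 F0 h7 h5 h1 h2 zm0 t_neq0 h8 E0 h9.
Qed.

End Diag.

Lemma sum_Pdiag mu m n : is_partition mu -> (m < size mu)%N -> is_partition (incr_nth mu m) ->
  size mu = n.+1 -> nth 0%N (incr_nth mu m) n = 0%N ->
  \sum_(0 <= k < n.+1 | is_partition (incr_nth (incr_nth mu m) k))
     Pdiag q t mu (incr_nth mu m) (incr_nth (incr_nth mu m) k) = 1.
Proof.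
move=> pm mn pl sz last0; set lam := incr_nth mu m in pl last0 *; set z := node lam.
have szl : size lam = n.+1 by rewrite size_incr.
have mn1 : (m < n.+1)%N by rewrite -sz.
pose p := \prod_(0 <= j < n.+1 | j != m) ('X - (t * z j)%:P).
have sp : (size p <= n.+3)%N.
  by rewrite (size_prod_nodesC1 (fun j => t * z j) mn1); lia.
have pE w : p.[w] = \prod_(0 <= j < n.+1 | j != m) (w - t * z j).
  by rewrite (horner_prod_nodes _ (fun j => t * z j)).
have := lagrange_nodes_cons (node_inj pl) (node_neq_qnode m pm) sp.
(* The polynomial has degree $n$ and there are $n+3$ nodes, so all terms add up to 0 and those at
   the $z_k$ to minus the term at $q z_m$. *)
have -> : p`_n.+2 = 0.
  apply: nth_default.
  by rewrite (size_prod_nodesC1 (fun j => t * z j) mn1); lia.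
rewrite -/lam -/z => /eqP; rewrite addrC addr_eq0 => /eqP S.
have c0 : p.[q * z m] != 0.
  rewrite pE prodf_seq_neq0; apply/allP => j _; apply/implyP => jm.
  rewrite subr_eq0 -node_mu (_ : z j = node mu j) ?node_neq_mult //.
  by rewrite (node_incr t q_neq0 mu m j) (negbTE jm) mul1r.
have d0 : \prod_(0 <= j < n.+2) (q * z m - z j) != 0.
  rewrite prodf_seq_neq0; apply/allP => j _ /=.
  by rewrite subr_eq0 eq_sym node_neq_qnode.
have zero k j : (j < n.+1)%N -> j != m -> z k = t * z j -> p.[z k] = 0.
  move=> jn jm zk; apply/eqP; rewrite pE prodf_seq_eq0; apply/hasP.
  by exists j; rewrite ?mem_index_iota // jm zk subrr eqxx.
have nm : n != m.
  by apply: contra_eq_neq last0 => ->; rewrite nth_incr_nth eqxx.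
transitivity (- ((\prod_(0 <= j < n.+2) (q * z m - z j)) / p.[q * z m]) *
   \sum_(0 <= k < n.+2) p.[z k] / ((z k - q * z m) * \prod_(0 <= j < n.+2 | j != k) (z k - z j))).
  rewrite [X in _ = _ * X]big_nat_recr //= (zero n.+1 n (ltnSn n) nm (node_last pl szl last0)) mul0r addr0 mulr_sumr.
  rewrite big_mkcond; apply: eq_big_nat => k /andP[_ kn]; case: ifPn => plk.
    by rewrite Pdiag_node ?sz // -!pE.
  rewrite -szl in kn; have [j kj lj] := non_addable pl plk.
  have zk : z k = t * z j by rewrite /z /node -lj kj mulr_mono.
  rewrite (zero k j) ?mul0r ?mulr0 // -?szl; first by rewrite -ltnS -kj ltnW.
  (* The root $t z_m$ is missing from [p], but row $m$ cannot be the blocking row: it has just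
     received a box and is strictly longer than row $m+1$. *)
  apply: contra_eq_neq lj => jm; have := partition_nth_le pm (leqnSn m).
  by rewrite kj jm !nth_incr_nth eqxx (ltn_eqF (ltnSn m)); lia.
rewrite S; field.
by rewrite c0 d0.
Qed.

Definition decr_nth (lam : seq nat) m := set_nth 0%N lam m (nth 0%N lam m).-1.

Lemma incr_decr_nth lam m : (m < size lam)%N -> (0 < nth 0%N lam m)%N ->
  incr_nth (decr_nth lam m) m = lam.
Proof.
move=> mn lm0; have sz : size (decr_nth lam m) = size lam.
  by rewrite size_set_nth (maxn_idPr mn).
apply: (@eq_from_nth _ 0%N); first by rewrite size_incr sz.
move=> i _; rewrite nth_incr_nth nth_set_nth /=.
by case: (eqVneq m i) => [<-|]; rewrite ?eqxx ?add1n ?prednK // eq_sym => /negbTE ->.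
Qed.

Lemma size_decr_nth lam m : (m < size lam)%N -> size (decr_nth lam m) = size lam.
Proof. by move=> mn; rewrite size_set_nth (maxn_idPr mn). Qed.

Definition removable lam m := (0 < nth 0%N lam m)%N && is_partition (decr_nth lam m).

Lemma removableN lam m : is_partition lam -> ~~ removable lam m ->
  nth 0%N lam m.+1 = nth 0%N lam m.
Proof.
move=> /is_partitionP pl; rewrite negb_and -eqn0Ngt => /orP[/eqP lm0|npl].
  by apply/eqP; rewrite eqn_leq pl lm0.
apply/eqP; rewrite eqn_leq pl leqNgt; apply: contra npl => lt.
apply/is_partitionP => i; rewrite !nth_set_nth /=.
have := pl i; case: (eqVneq i.+1 m) => [e|_]; case: (eqVneq i m) => [e'|_]; subst; lia.
Qed.

(** The polynomial is monic of degree $n$ and there are $n+1$ nodes: the $t z_m$ with $m<n$, and $t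
    z_k/q$, which accounts for the transition to the NW label [lam] itself. *)
Lemma sum_Pbardiag lam k : is_partition lam -> (k < size lam)%N ->
  is_partition (incr_nth lam k) ->
  Pbarup q t lam (incr_nth lam k) +
  \sum_(0 <= m < size lam | removable lam m)
    Pbardiag q t (decr_nth lam m) lam (incr_nth lam k) = 1.
Proof.
move=> pl kn plk; set z := node lam; set n := size lam in kn *.
pose p := \prod_(0 <= j < n.+1 | j != k) ('X - (z j)%:P).
have sp : size p = n.+1 by rewrite (size_prod_nodesC1 z (leqW kn)).
have pE w : p.[w] = \prod_(0 <= j < n.+1 | j != k) (w - z j).
  by rewrite (horner_prod_nodes _ z).
have tzi : injective (fun j => t * z j) by move=> i j /(mulfI t_neq0) /(node_inj pl).
have wz j : t * z j != t * z k / q by rewrite eq_sym cornode_neq_mult.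
have := lagrange_nodes_cons tzi wz (eq_leq sp).
have -> : p`_n = 1 by rewrite -[n]/(n.+1.-1) -sp -lead_coefE (monicP (monic_prod_nodes _ _ _)).
move=> S; have C0 := Pbarup_neq0 brk_neq0 q_neq0 t_neq0 pl kn plk.
have CE := Pbarup_nodeprod brk_neq0 q_neq0 t_neq0 pl kn plk.
rewrite /nodeprod -pE -/z in CE.
transitivity (Pbarup q t lam (incr_nth lam k) * (1 - \sum_(0 <= m < n)
   p.[t * z m] / ((t * z m - t * z k / q) * \prod_(0 <= j < n | j != m) (t * z m - t * z j)))).
  rewrite mulrBr mulr1; congr (_ + _); rewrite -mulrN -sumrN mulr_sumr big_mkcond.
  apply: eq_big_nat => m /andP[_ mn]; case: ifPn => [/andP[lm0 pd]|nr].
    have E := incr_decr_nth mn lm0.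
    have := @Pbardiag_node (decr_nth lam m) m k; rewrite E size_decr_nth // => ->//.
    by rewrite -pE mulNr mulrN.
  (* If no box can be removed from row $m$, then $t z_m$ is a root of [p]. The only node missing
     among the roots is $z_k$, and $k=m+1$ would contradict that row $k$ accepts a box. *)
  have zm : t * z m = z m.+1 by rewrite /z /node (removableN pl nr) mulr_mono.
  have mk : m.+1 != k.
    apply/eqP => mk; have := @addable_lt lam k m plk.
    by rewrite -mk => /(_ (ltnSn m)); rewrite (removableN pl nr) ltnn.
  suff -> : p.[t * z m] = 0 by rewrite mul0r oppr0 mulr0.
  apply/eqP; rewrite pE prodf_seq_eq0; apply/hasP.
  by exists m.+1; rewrite ?mem_index_iota // mk zm subrr eqxx.
(* By [CE] the Lagrange term at $t z_k/q$ is the inverse of [Pbarup]. *)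
rewrite (_ : 1 - _ = (Pbarup q t lam (incr_nth lam k))^-1) ?mulfV //.
by apply/eqP; rewrite subr_eq CE invf_div S.
Qed.
End LocalSums.

(** * Local rules *)

Lemma psize_incr (lam : seq nat) k : psize (incr_nth lam k) = (psize lam).+1.
Proof.
rewrite /psize; elim: lam k => [|a l IH] [|k] //=; last by rewrite IH addnS.
by elim: k.
Qed.

Lemma incr_nth_neq (lam : seq nat) k : incr_nth lam k != lam.
Proof. by apply/eqP => /(congr1 psize); rewrite psize_incr => /esym/n_Sn. Qed.

Lemma subpP (mu lam : seq nat) : size mu = size lam ->
  reflect (forall i, nth 0%N mu i <= nth 0%N lam i)%N (subp mu lam).
Proof.
move=> sz; apply: (iffP allP) => [h i|h y _]; last exact: h.
case: (ltnP i (size mu)) => im; last by rewrite !nth_default -?sz.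
by apply: (h i.+1); rewrite mem_iota -sz maxnn add1n ltnS.
Qed.

Lemma subp_incr (lam : seq nat) k : (k < size lam)%N -> subp lam (incr_nth lam k).
Proof. by move=> kn; apply/subpP => [|i]; rewrite ?size_incr // nth_incr_nth leq_addl. Qed.

Lemma subp_refl (lam : seq nat) : subp lam lam.
Proof. exact/subpP. Qed.

Lemma subp_trans (mu lam nu : seq nat) : size mu = size lam -> size lam = size nu ->
  subp mu lam -> subp lam nu -> subp mu nu.
Proof.
move=> s1 s2 /(subpP s1) h1 /(subpP s2) h2; apply/subpP => [|i]; first by rewrite s1.
exact: leq_trans (h1 i) (h2 i).
Qed.

Lemma subp_psize (mu lam : seq nat) : size mu = size lam -> subp mu lam ->
  (psize mu <= psize lam)%N.
Proof.
move=> sz /(subpP sz); rewrite /psize; elim: mu lam sz => [|a l IH] [|b l'] //= [sz] h.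
by rewrite leq_add ?(h 0%N) // IH // => i; have := h i.+1.
Qed.

Lemma subp_eq (mu lam : seq nat) : size mu = size lam -> subp mu lam ->
  psize mu = psize lam -> mu = lam.
Proof.
move=> sz /(subpP sz); rewrite /psize; elim: mu lam sz => [|a l IH] [|b l'] //= [sz] h e.
have hl i : (nth 0%N l i <= nth 0%N l' i)%N by have := h i.+1.
have := h 0%N; have /= := subp_psize sz (introT (subpP sz) hl); rewrite /psize => h1 h2.
have eab : a = b by lia.
by rewrite eab (IH l') //; lia.
Qed.

Lemma coversP (mu lam : seq nat) : size mu = size lam ->
  reflect (exists2 k, (k < size mu)%N & lam = incr_nth mu k) (covers mu lam).
Proof.
move=> sz; apply: (iffP andP) => [[/(subpP sz) + /eqP]|[k kn ->]]; last first.
  by rewrite subp_incr // psize_incr.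
elim: mu lam sz => [|a l IH] [|b l'] //= [sz] h; rewrite /psize /= => e.
have hl i : (nth 0%N l i <= nth 0%N l' i)%N by have := h i.+1.
have := h 0%N; rewrite leq_eqVlt => /predU1P[/= ab|/= ab].
  by case: (IH l') => //; [rewrite /psize; lia | move=> k kl ->; exists k.+1; rewrite ?ab].
have := subp_psize sz (introT (subpP sz) hl); rewrite /psize => h1.
exists 0%N => //=; rewrite (@subp_eq l l') //; first (congr cons; lia).
  exact/subpP.
by rewrite /psize; lia.
Qed.

Definition coveq (mu lam : seq nat) : bool := (mu == lam) || covers mu lam.

Lemma covers_incr (lam : seq nat) k : (k < size lam)%N -> covers lam (incr_nth lam k).
Proof. by move=> kn; rewrite /covers subp_incr // psize_incr eqxx. Qed.

Lemma coversN (lam : seq nat) : covers lam lam = false.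
Proof. by rewrite /covers ltn_eqF // andbF. Qed.

Lemma subp_coveq (mu lam : seq nat) : size mu = size lam -> subp mu lam ->
  (psize lam <= (psize mu).+1)%N -> coveq mu lam.
Proof.
move=> sz s h; rewrite /coveq /covers s /=.
have := subp_psize sz s; rewrite leq_eqVlt => /predU1P[e|lt].
  by rewrite (subp_eq sz s e) eqxx.
by apply/orP; right; rewrite eqn_leq h.
Qed.

Lemma coveq_subp (mu lam : seq nat) : coveq mu lam -> subp mu lam.
Proof. by case/orP => [/eqP ->|/andP[]//]; rewrite subp_refl. Qed.

(* The local rule of a growth at one square; [c] tells whether the square contains a 1. *)
Definition local_rule (c : bool) (nw ne sw se : seq nat) : bool :=
  [&& coveq nw ne, coveq nw sw, coveq ne se, coveq sw se,
      psize se + psize nw == psize ne + psize sw + c & c ==> (nw == ne) && (ne == sw)]%N.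

(** The squares of type III are exactly those of [RuleDiag] and [RuleOne]. In the other cases both
    weights are 1, and either of the NW and SE labels is determined by the remaining three. *)
Variant local_rule_spec (nw ne sw se : seq nat) : bool -> Prop :=
| RuleHoriz of nw = ne & sw = se : local_rule_spec nw ne sw se false
| RuleVert of nw = sw & ne = se : local_rule_spec nw ne sw se false
| RuleUnion k m of (k < size nw)%N & (m < size nw)%N & k != m & sw = incr_nth nw k
    & ne = incr_nth nw m & se = incr_nth ne k & se = incr_nth sw m :
    local_rule_spec nw ne sw se false
| RuleDiag k m of (k < size nw)%N & (m < size nw)%N & ne = incr_nth nw m & ne = sw
    & se = incr_nth ne k : local_rule_spec nw ne sw se false
| RuleOne k of (k < size nw)%N & nw = ne & ne = sw & se = incr_nth ne k :
    local_rule_spec nw ne sw se true.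

Lemma local_ruleP c (nw ne sw se : seq nat) :
  size ne = size nw -> size sw = size nw -> size se = size nw ->
  local_rule c nw ne sw se -> local_rule_spec nw ne sw se c.
Proof.
move=> s1 s2 s3 /and5P[c1 c2 c3 c4 /andP[/eqP e]]; case: c e => /= e.
  case/andP=> /eqP e1 /eqP e2 ; subst ne sw; case/orP: c3 => [/eqP E|].
    by rewrite -E in e; lia.
  by case/coversP => // k kn ->; apply: (@RuleOne _ _ _ _ k).
move=> _; case/orP: c1 => [/eqP e1|].
  subst ne; apply: RuleHoriz => //; apply: subp_eq; rewrite ?s2 ?s3 ?(coveq_subp c4) //; lia.
case/coversP => // m mn Em; case/orP: c2 => [/eqP e2|].
  subst sw; apply: RuleVert => //; apply: subp_eq; rewrite ?s1 ?s3 ?(coveq_subp c3) //; lia.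
case/coversP => // k kn Ek.
have psz : psize se = (psize nw).+2 by move: e; rewrite Em Ek !psize_incr; lia.
have Cne : covers ne se.
  case/orP: c3 => // /eqP E; move: psz; rewrite -E Em psize_incr; lia.
have Csw : covers sw se.
  case/orP: c4 => // /eqP E; move: psz; rewrite -E Ek psize_incr; lia.
have [k' k'n Ek'] := coversP (etrans s1 (esym s3)) Cne.
have [m' m'n Em'] := coversP (etrans s2 (esym s3)) Csw.
rewrite s1 in k'n.
case: (eqVneq k m) => [ekm|nkm].
  by apply: (@RuleDiag _ _ _ _ k' m) => //; rewrite Em Ek ekm.
(* Row [k] of [se] has grown through [sw] while [ne] has not touched it, so the last box added to
   [ne] must lie there. *)
have ek : k' = k.
  have := Em'; rewrite Ek' Em Ek => /(congr1 (nth 0%N ^~ k)); rewrite !nth_incr_nth eqxx.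
  by rewrite [m == k]eq_sym (negbTE nkm); case: eqP => // _; lia.
subst k'; apply: (@RuleUnion _ _ _ _ k m) => //.
by rewrite Ek' Em Ek incr_nthC.
Qed.

(** * Weights of edges and the relation between the two weights of a square *)

Section EdgeWeights.
Variables (K : fieldType) (q t : K).
Hypothesis brk_neq0 : forall i j, (0 < i + j)%N -> brk q t i j != 0.

(** Cell by cell the quotient of the factors of [alpha] and [alphabar] is a ratio of two values of
    [bcell]. Up to a power of $t$ this is the relation of (3) for a single square containing a 1. *)
Lemma alpha_psi_phi (lam nu : seq nat) :
  (1 - t) / (1 - q) * alpha q t lam nu = alphabar q t lam nu * (psi1 q t lam nu * phi1 q t lam nu).
Proof.
rewrite /alpha /alphabar /psi1 /phi1.
set Rp := \prod_(c <- Rset nu lam) _; set Cp := \prod_(c <- Cset nu lam) _.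
rewrite [RHS](_ : _ = (1 - t) / (1 - q) *
  ((\prod_(c <- Rset nu lam) (brk q t (arm lam c).+1 (leg lam c) / brk q t (arm nu c).+1 (leg nu c)) *
    \prod_(c <- Rset nu lam) (bcell q t lam c / bcell q t nu c)) *
   (\prod_(c <- Cset nu lam) (brk q t (arm lam c) (leg lam c).+1 / brk q t (arm nu c) (leg nu c).+1) *
    \prod_(c <- Cset nu lam) (bcell q t nu c / bcell q t lam c)))); last by ring.
congr (_ * (_ * _)); rewrite -big_split; apply: eq_bigr => c _ /=; rewrite /bcell /bij.
  by field; rewrite !brk_neq0 ?addnS.
by field; rewrite !brk_neq0 ?addnS.
Qed.

(** As $b_{i,j}$ is a quotient of the two kinds of brackets, [psi1] is the quotient of the row
    products of [alpha] and [alphabar], already telescoped. The column products give [phi1] in the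
    same way. *)
Lemma psi1E (lam : seq nat) k : is_partition lam -> (k < size lam)%N ->
  is_partition (incr_nth lam k) ->
  psi1 q t lam (incr_nth lam k) =
  (brk q t 0 1 / brk q t (nth 0%N lam k) (size lam - k)) /
  (brk q t 1 0 / brk q t (nth 0%N lam k).+1 (size lam - k.+1)) *
  \prod_(k.+1 <= j < size lam)
    (brk q t (nth 0%N lam k - nth 0%N lam j) (j - k).+1 *
     brk q t (nth 0%N lam k - nth 0%N lam j).+1 (j - k.+1) /
     (brk q t (nth 0%N lam k - nth 0%N lam j) (j - k) *
      brk q t (nth 0%N lam k - nth 0%N lam j).+1 (j - k))).
Proof.
move=> pl kn plk.
transitivity (
  \prod_(c <- Rset (incr_nth lam k) lam) (brk q t (arm lam c) (leg lam c).+1 /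
     brk q t (arm (incr_nth lam k) c) (leg (incr_nth lam k) c).+1) /
  \prod_(c <- Rset (incr_nth lam k) lam) (brk q t (arm lam c).+1 (leg lam c) /
     brk q t (arm (incr_nth lam k) c).+1 (leg (incr_nth lam k) c))).
  rewrite -prodfV -big_split; apply: eq_bigr => c _ /=; rewrite /bcell /bij.
  by field; rewrite !brk_neq0 ?addnS.
rewrite row_brkE // row_brkbarE // invfM mulrACA -prodfV -big_split; congr (_ * _).
apply: eq_big_nat => j /andP[kj _] /=.
by field; rewrite !brk_neq0 ?addnS //; lia.
Qed.

Lemma phi1E (lam : seq nat) k : is_partition lam -> (k < size lam)%N ->
  is_partition (incr_nth lam k) ->
  phi1 q t lam (incr_nth lam k) = (1 - t) / (1 - q) *
  \prod_(0 <= j < k)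
    (brk q t (nth 0%N lam j - nth 0%N lam k) (k - j.+1) *
     brk q t (nth 0%N lam j - (nth 0%N lam k).+1) (k - j).+1 /
     (brk q t (nth 0%N lam j - nth 0%N lam k) (k - j) *
      brk q t (nth 0%N lam j - (nth 0%N lam k).+1) (k - j))).
Proof.
move=> pl kn plk; rewrite /phi1; congr (_ * _).
transitivity (
  \prod_(c <- Cset (incr_nth lam k) lam) (brk q t (arm lam c).+1 (leg lam c) /
     brk q t (arm (incr_nth lam k) c).+1 (leg (incr_nth lam k) c)) /
  \prod_(c <- Cset (incr_nth lam k) lam) (brk q t (arm lam c) (leg lam c).+1 /
     brk q t (arm (incr_nth lam k) c) (leg (incr_nth lam k) c).+1)).
  rewrite -prodfV -big_split; apply: eq_bigr => c _ /=; rewrite /bcell /bij.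
  by field; rewrite !brk_neq0 ?addnS.
rewrite col_brkE // col_brkbarE // -prodfV -big_split.
apply: eq_big_nat => j /andP[_ jk] /=; have lt := addable_lt plk jk.
by field; rewrite !brk_neq0 ?addnS //; lia.
Qed.

(* Only the cell in the row of one added box and the column of the other one contributes
   differently to the two sides, and its contributions to psi and phi compensate. *)
Lemma psi_phi_union (mu : seq nat) k m : (k < size mu)%N -> (m < size mu)%N -> k != m ->
  is_partition mu -> is_partition (incr_nth mu k) -> is_partition (incr_nth mu m) ->
  is_partition (incr_nth (incr_nth mu m) k) ->
  psi1 q t mu (incr_nth mu k) * phi1 q t mu (incr_nth mu m) =
  psi1 q t (incr_nth mu m) (incr_nth (incr_nth mu m) k) *
  phi1 q t (incr_nth mu k) (incr_nth (incr_nth mu k) m).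
Proof.
move=> kn mn km pm pk pml pkm.
rewrite !psi1E ?phi1E ?size_incr //; last by rewrite incr_nthC.
case: (ltngtP k m) km => // km _; last first.
  (* For $m<k$ neither weight sees the other box: [psi1] in row $k$ involves only the rows from $k$
     on, [phi1] in row $m$ only those up to $m$. *)
  rewrite nth_incr_nth (ltn_eqF km) add0n.
  rewrite [nth 0%N (incr_nth mu k) m]nth_incr_nth (gtn_eqF km) add0n.
  congr (_ * _ * (_ * _)).
    apply: eq_big_nat => j /andP[kj _].
    by rewrite nth_incr_nth (ltn_eqF (ltn_trans km kj)).
  apply: eq_big_nat => j /andP[_ jm].
  by rewrite nth_incr_nth (gtn_eqF (ltn_trans jm km)).
rewrite nth_incr_nth (gtn_eqF km) add0n.
rewrite [nth 0%N (incr_nth mu k) m]nth_incr_nth (ltn_eqF km) add0n.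
rewrite !(bigD1_seq m (r := index_iota k.+1 _)) ?mem_index_iota ?iota_uniq ?km ?mn //=.
rewrite !(bigD1_seq k (r := index_iota 0 _)) ?mem_index_iota ?iota_uniq ?km ?mn //=.
rewrite !nth_incr_nth !eqxx !add1n.
set P1 := \prod_(k.+1 <= j < _ | j != m) _; set P2 := \prod_(k.+1 <= j < _ | j != m) _.
set Q1 := \prod_(0 <= j < _ | j != k) _; set Q2 := \prod_(0 <= j < _ | j != k) _.
have <- : P1 = P2.
  by apply: eq_bigr => j jm; rewrite nth_incr_nth [m == j]eq_sym (negbTE jm).
have <- : Q1 = Q2.
  by apply: eq_bigr => j jm; rewrite nth_incr_nth [k == j]eq_sym (negbTE jm).
have lt := addable_lt pml km.
have -> : (nth 0%N mu k - nth 0%N mu m = (nth 0%N mu k - (nth 0%N mu m).+1).+1)%N by lia.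
have -> : ((nth 0%N mu k).+1 - nth 0%N mu m = (nth 0%N mu k - (nth 0%N mu m).+1).+2)%N by lia.
have -> : ((nth 0%N mu k).+1 - (nth 0%N mu m).+1 = (nth 0%N mu k - (nth 0%N mu m).+1).+1)%N by lia.
(* [D] is the arm in [mu] of the cell in row $k$ and in the column of the box added in row $m$. *)
set D := (nth 0%N mu k - _)%N.
have lt' : (0 < m - k)%N by rewrite subn_gt0.
have q1 : 1 - q != 0.
  by have := brk_neq0 (isT : 0 < 1 + 0)%N; rewrite /brk expr0 mulr1 expr1.
by field; rewrite q1 !brk_neq0 //; lia.
Qed.

Hypotheses (q_neq0 : q != 0) (t_neq0 : t != 0).

(** [psi_edge] weighs the vertical edges of the grid and [phi_edge] the horizontal ones. Trivial
    edges are treated apart because [phi1] keeps the prefactor $(1-t)/(1-q)$ even when no box is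
    added. *)
Definition psi_edge (mu lam : seq nat) : K := if mu == lam then 1 else psi1 q t mu lam.
Definition phi_edge (mu lam : seq nat) : K := if mu == lam then 1 else phi1 q t mu lam.

Lemma psi_edgexx lam : psi_edge lam lam = 1. Proof. by rewrite /psi_edge eqxx. Qed.
Lemma phi_edgexx lam : phi_edge lam lam = 1. Proof. by rewrite /phi_edge eqxx. Qed.
Lemma psi_edge_incr lam k : psi_edge lam (incr_nth lam k) = psi1 q t lam (incr_nth lam k).
Proof. by rewrite /psi_edge eq_sym (negbTE (incr_nth_neq _ _)). Qed.
Lemma phi_edge_incr lam k : phi_edge lam (incr_nth lam k) = phi1 q t lam (incr_nth lam k).
Proof. by rewrite /phi_edge eq_sym (negbTE (incr_nth_neq _ _)). Qed.

Lemma alpha_neq0 (lam nu : seq nat) : alpha q t lam nu != 0.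
Proof.
rewrite mulf_neq0 // prodf_seq_neq0; apply/allP => c _ /=.
  by rewrite mulf_neq0 ?invr_eq0 // brk_neq0 ?addnS.
by rewrite mulf_neq0 ?invr_eq0 // brk_neq0 ?addnS.
Qed.

Lemma alphabar_neq0 (lam nu : seq nat) : alphabar q t lam nu != 0.
Proof.
rewrite mulf_neq0 // prodf_seq_neq0; apply/allP => c _ /=.
  by rewrite mulf_neq0 ?invr_eq0 // brk_neq0 ?addnS.
by rewrite mulf_neq0 ?invr_eq0 // brk_neq0 ?addnS.
Qed.

Lemma onem_ratio_neq0 : (1 - t) / (1 - q) != 0.
Proof.
have := brk_neq0 (isT : 0 < 1 + 0)%N; have := brk_neq0 (isT : 0 < 0 + 1)%N.
by rewrite /brk !expr0 mulr1 mul1r !expr1 => h1 h2; rewrite mulf_neq0 ?invr_eq0.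
Qed.

(** A square with two different boxes reduces to [psi_phi_union], a square containing a 1 to
    [alpha_psi_phi], and a diagonal square to the quotient of two instances of [alpha_psi_phi], in
    which [gamma] cancels. Each 1 absorbs one factor of $\omega$. *)
Lemma square_relation c nw ne sw se :
  size ne = size nw -> size sw = size nw -> size se = size nw ->
  is_partition nw -> is_partition ne -> is_partition sw -> is_partition se ->
  local_rule c nw ne sw se ->
  ((1 - t) / (1 - q)) ^+ c * sqw q t nw ne sw se * (psi_edge nw sw * phi_edge nw ne) =
  sqwbar q t nw ne sw se * (psi_edge ne se * phi_edge sw se).
Proof.
move=> s1 s2 s3 p1 p2 p3 p4 r.
case: (local_ruleP s1 s2 s3 r) => [e1 e2|e1 e2|k m kn mn km e1 e2 e3 e4|k m kn mn e1 e2 e3|k kn e1 e2 e3].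
- subst ne se; rewrite /sqw /sqwbar /typeIII expr0 mul1r.
  by case: eqP => [<-|_] /=; rewrite ?coversN ?andbF ?phi_edgexx ?psi_edgexx.
- subst sw se; rewrite /sqw /sqwbar /typeIII expr0 mul1r.
  by case: eqP => [<-|_] /=; rewrite ?coversN ?andbF ?phi_edgexx ?psi_edgexx ?mulr1.
- rewrite /sqw /sqwbar /typeIII expr0 mul1r.
  have -> : (ne == sw) = false.
    rewrite e1 e2; apply/eqP => /(congr1 (nth 0%N ^~ k)).
    by rewrite !nth_incr_nth eqxx [m == k]eq_sym (negbTE km) => /n_Sn.
  rewrite /= !mul1r e1 e2 psi_edge_incr phi_edge_incr -e1 -e2 {1}e3 e4 psi_edge_incr phi_edge_incr.
  rewrite e1 e2 psi_phi_union // -?e1 -?e2 // -?e3 //.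
- rewrite /sqw /sqwbar /typeIII -e2 eqxx e3 covers_incr ?s1 // e1 covers_incr // orbT.
  rewrite eq_sym (negbTE (incr_nth_neq _ _)) expr0 mul1r !psi_edge_incr !phi_edge_incr.
  rewrite -e1 -e3 /= /Pdiag /Pbardiag /beta /betabar.
  have r0 := onem_ratio_neq0.
  have A1 := alpha_psi_phi nw ne; have A2 := alpha_psi_phi ne se.
  have a1 := alpha_neq0 nw ne; have a2 := alphabar_neq0 nw ne.
  have a3 := alphabar_neq0 ne se.
  have -> : psi1 q t nw ne * phi1 q t nw ne = (1 - t) / (1 - q) * alpha q t nw ne / alphabar q t nw ne.
    by rewrite A1 mulrAC mulfV // mul1r.
  have -> : psi1 q t ne se * phi1 q t ne se = (1 - t) / (1 - q) * alpha q t ne se / alphabar q t ne se.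
    by rewrite A2 mulrAC mulfV // mul1r.
  set r1 := _ / (1 - q); set g := (gamma _ _ _ _ _)^-1; set T := t ^ _.
  by field; rewrite a1 a2 a3.
- rewrite e3 -e2 -e1 /sqw /sqwbar /typeIII !eqxx covers_incr //=.
  rewrite psi_edgexx phi_edgexx !mulr1 psi_edge_incr phi_edge_incr expr1 /Pup /Pbarup.
  by rewrite [LHS]mulrCA alpha_psi_phi [LHS]mulrA.
Qed.

End EdgeWeights.

(** * Sums over labelings *)

Definition upd (V T : finType) (L : {ffun V -> T}) (v : V) (x : T) : {ffun V -> T} :=
  [ffun u => if u == v then x else L u].

(* The chain rule for conditional probabilities, the labels being revealed in the order
   given by [r]. *)
Lemma sum_prod_sequential (K : comNzRingType) (V T : finType) (r : V -> nat)
    (A : V -> {ffun V -> T} -> bool) (w : V -> {ffun V -> T} -> K) (x0 : T) :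
  injective r ->
  (forall v (L L' : {ffun V -> T}), (forall u, (r u <= r v)%N -> L u = L' u) ->
     A v L = A v L' /\ w v L = w v L') ->
  (forall v L, (forall u, (r u < r v)%N -> A u L) ->
     \sum_(x | A v (upd L v x)) w v (upd L v x) = 1) ->
  \sum_(L : {ffun V -> T} | [forall v, A v L]) \prod_v w v L = 1.
Proof.
move=> r_inj dep step.
(* The labels of rank below $m$ are frozen to those of [L0]; $d$ bounds the number of ranks still to
   be revealed. *)
have key d m : (forall u, r u < m + d)%N -> forall L0, (forall u, (r u < m)%N -> A u L0) ->
  \sum_(L : {ffun V -> T} | [forall u, if (r u < m)%N then L u == L0 u else A u L])
     \prod_(u | (m <= r u)%N) w u L = 1.
  elim: d m => [|d IH] m rm L0 A0.
    have {}rm u : (r u < m)%N by rewrite -(addn0 m).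
    rewrite (big_pred1 L0) => [|L]; last first.
      apply/forallP/eqP => [h|-> u]; last by rewrite rm.
      by apply/ffunP => u; have := h u; rewrite rm => /eqP.
    by rewrite big_pred0 // => u; apply/negbTE; rewrite -ltnNge.
  have rm' u : (r u < m.+1 + d)%N by rewrite addSnnS.
  case: (pickP (fun v => r v == m)) => [v /eqP rv|none]; last first.
    (* Ranks need not be consecutive: if no vertex has rank $m$, nothing is revealed at this
       stage. *)
    have lt u : (r u < m.+1)%N = (r u < m)%N by rewrite ltnS leq_eqVlt none.
    rewrite -[RHS](IH m.+1 rm' L0) => [|u]; last by rewrite lt; apply: A0.
    apply: eq_big => [L|L _]; first by apply: eq_forallb => u; rewrite lt.
    by apply: eq_bigl => u; rewrite leqNgt -lt ltnNge negbK.
  pose L1 x := upd L0 v x.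
  have L1E x u : (r u < m)%N -> L1 x u = L0 u.
    by move=> um; rewrite ffunE; case: eqP => // uv; rewrite uv rv ltnn in um.
  have L1v x : L1 x v = x by rewrite ffunE eqxx.
  have A1 x u : (r u < m)%N -> A u (L1 x).
    move=> um; have [-> _] := @dep u (L1 x) L0 (fun u' h => L1E x u' (leq_ltn_trans h um)).
    exact: A0.
  (* The sum is split by the label $x$ of [v]. With [v] frozen at $x$ the remaining sum is 1 by
     induction, and the sum over $x$ is 1 by [step]. *)
  rewrite (partition_big (fun L : {ffun V -> T} => L v) xpredT) //=.
  rewrite -[RHS](step v L0) => [|u]; last by rewrite rv; apply: A0.
  rewrite [RHS]big_mkcond; apply: eq_bigr => x _; rewrite -/(L1 x).
  have agree (L : {ffun V -> T}) : [forall u, if (r u < m.+1)%N then L u == L1 x u else A u L] ->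
      forall u, (r u <= r v)%N -> L u = L1 x u.
    by move=> /forallP h u; have := h u; rewrite rv ltnS; case: ifP => // _ /eqP.
  have predE (L : {ffun V -> T}) :
      [forall u, if (r u < m)%N then L u == L0 u else A u L] && (L v == x) =
      A v (L1 x) && [forall u, if (r u < m.+1)%N then L u == L1 x u else A u L].
    apply/andP/andP => [[/forallP h /eqP Lv]|[Av h]].
      have hL u : (r u <= r v)%N -> L u = L1 x u.
        rewrite rv leq_eqVlt => /predU1P[|um]; last by rewrite L1E //; have := h u; rewrite um => /eqP.
        by rewrite -rv => /r_inj ->; rewrite L1v.
      have [<- _] := dep v L (L1 x) hL.
      split; first by have := h v; rewrite rv ltnn.
      apply/forallP => u; case: ifP => um; first by rewrite hL ?rv.
      by have := h u; rewrite ltnNge (ltnW _) // ltnNge -ltnS um.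
    have hL := agree L h; rewrite hL // L1v; split=> //.
    apply/forallP => u; case: ifP => um; first by rewrite hL ?rv 1?ltnW // L1E.
    move/forallP/(_ u): h; rewrite ltnS leq_eqVlt um orbF; case: eqP => // e _.
    by have -> : u = v by [apply: r_inj; rewrite rv]; have [-> _] := dep v L (L1 x) hL.
  rewrite (eq_bigl _ _ predE); case: ifP => Av /=; last by rewrite big_pred0.
  rewrite -[RHS]mulr1 -[X in _ = _ * X](IH m.+1 rm' (L1 x)).
    rewrite mulr_sumr; apply: eq_bigr => L h.
    rewrite (bigD1 v) ?rv //=; have [_ ->] := dep v L (L1 x) (agree L h); congr (_ * _).
    apply: eq_bigl => u; rewrite ltn_neqAle andbC; congr (_ && _).
    by rewrite -rv eq_sym (inj_eq r_inj).
  move=> u; rewrite ltnS leq_eqVlt => /predU1P[|]; last exact: A1.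
  by rewrite -rv => /r_inj ->.
have rM u : (r u < 0 + (\max_v r v).+1)%N by rewrite add0n ltnS leq_bigmax.
rewrite -[RHS](key _ 0%N rM [ffun=> x0]) //.
Qed.

Section Ptn.
Variable n : nat.
Implicit Types x y : ptn n.

Lemma size_pseq x : size (pseq x) = n.
Proof. by rewrite size_map size_tuple. Qed.

Lemma pseq_inj : injective (@pseq n).
Proof. by move=> x y /(inj_map val_inj) /val_inj. Qed.

(** [inord] alters no part as long as the total size is at most $n$, which bounds every part. *)
Definition ptn_of (s : seq nat) : ptn n := [tuple inord (nth 0%N s i) | i < n].

Lemma nth_le_psize (s : seq nat) i : (nth 0%N s i <= psize s)%N.
Proof.
rewrite /psize; elim: s i => [|a s IH] [|i] //=; first exact: leq_addr.
exact: leq_trans (IH i) (leq_addl _ _).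
Qed.

Lemma ptn_ofK s : size s = n -> (psize s <= n)%N -> pseq (ptn_of s) = s.
Proof.
move=> sz le; apply: (@eq_from_nth _ 0%N) => [|i]; rewrite size_pseq ?sz // => i_n.
rewrite (nth_map ord0) ?size_tuple // (nth_mktuple _ _ (Ordinal i_n)) /=.
by rewrite inordK // ltnS (leq_trans (nth_le_psize _ _)).
Qed.

Lemma sum_covers_up (K : fieldType) (s : seq nat) (F : seq nat -> K) :
  size s = n -> (psize s < n)%N ->
  \sum_(y : ptn n | is_partition (pseq y) && covers s (pseq y)) F (pseq y) =
  \sum_(0 <= k < n | is_partition (incr_nth s k)) F (incr_nth s k).
Proof.
move=> sz sn; rewrite big_mkord.
pose h (k : 'I_n) := ptn_of (incr_nth s k).
have hK (k : 'I_n) : pseq (h k) = incr_nth s k.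
  by rewrite ptn_ofK ?psize_incr // size_incr ?sz.
pose A := [set k : 'I_n | is_partition (incr_nth s k)].
have inj : {in A &, injective h}.
  by move=> k k' _ _ /(congr1 (@pseq n)); rewrite !hK => /incr_nth_inj /val_inj.
transitivity (\sum_(y in h @: A) F (pseq y)).
  apply: eq_bigl => y; apply/andP/imsetP => [[py]|[k + ->]].
    case/coversP => [|k kn E]; first by rewrite sz size_pseq.
    rewrite sz in kn; exists (Ordinal kn); first by rewrite inE /= -E.
    by apply: pseq_inj; rewrite hK.
  by rewrite inE hK => pk; rewrite covers_incr ?sz.
rewrite big_imset //=; apply: eq_big => [k|k _]; first by rewrite inE.
by rewrite hK.
Qed.

Lemma psize_decr (s : seq nat) m : (m < size s)%N -> (0 < nth 0%N s m)%N ->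
  psize s = (psize (decr_nth s m)).+1.
Proof. by move=> ms sm; rewrite -{1}(incr_decr_nth ms sm) psize_incr. Qed.

Lemma decr_incr_nth (s : seq nat) m : (m < size s)%N -> decr_nth (incr_nth s m) m = s.
Proof.
move=> ms; apply: (@eq_from_nth _ 0%N) => [|i _]; first by rewrite size_decr_nth size_incr.
rewrite nth_set_nth /= !nth_incr_nth eqxx; case: eqP => [->//|].
by rewrite eq_sym; case: eqP.
Qed.

Lemma sum_covers_down (K : fieldType) (s : seq nat) (F : seq nat -> K) :
  size s = n -> (psize s <= n)%N ->
  \sum_(y : ptn n | is_partition (pseq y) && covers (pseq y) s) F (pseq y) =
  \sum_(0 <= m < n | removable s m) F (decr_nth s m).
Proof.
move=> sz sn; rewrite big_mkord.
pose h (k : 'I_n) := ptn_of (decr_nth s k).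
pose A := [set k : 'I_n | removable s k].
have hK (k : 'I_n) : k \in A -> pseq (h k) = decr_nth s k.
  rewrite inE => /andP[k0 _].
  by rewrite ptn_ofK ?size_decr_nth ?sz // ltnW // -psize_decr ?sz.
have hI (k : 'I_n) : k \in A -> incr_nth (pseq (h k)) k = s.
  by move=> kA; rewrite hK //; move: kA; rewrite inE => /andP[k0 _]; rewrite incr_decr_nth ?sz.
have inj : {in A &, injective h}.
  move=> k k' kA kA' e; apply/val_inj/(@incr_nth_inj (pseq (h k))).
  by rewrite hI // e hI.
transitivity (\sum_(y in h @: A) F (pseq y)).
  apply: eq_bigl => y; apply/andP/imsetP => [[py]|[k kA ->]].
    case/coversP => [|k kn E]; first by rewrite sz size_pseq.
    have yE : decr_nth s k = pseq y by rewrite E decr_incr_nth.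
    rewrite size_pseq in kn.
    have kA : Ordinal kn \in A by rewrite inE /removable /= yE py E nth_incr_nth eqxx.
    by exists (Ordinal kn) => //; apply: pseq_inj; rewrite hK.
  split; first by rewrite hK //; move: kA; rewrite inE => /andP[].
  by rewrite -[X in covers _ X](hI k kA) covers_incr // size_pseq.
rewrite big_imset //=; apply: eq_big => [k|k kA]; first by rewrite inE.
by rewrite hK.
Qed.
End Ptn.

Lemma local_ruleN_size nw ne sw se : size nw = size ne -> size nw = size sw ->
  size ne = size se -> size sw = size se ->
  coveq nw ne -> coveq nw sw -> coveq ne se -> coveq sw se ->
  (psize se + psize nw = psize ne + psize sw)%N -> local_rule false nw ne sw se.
Proof. by move=> s1 s2 s3 s4 c1 c2 c3 c4 e; rewrite /local_rule c1 c2 c3 c4 e addn0 eqxx. Qed.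

Lemma coveq_refl lam : coveq lam lam. Proof. by rewrite /coveq eqxx. Qed.

Lemma coveq_incr lam k : (k < size lam)%N -> coveq lam (incr_nth lam k).
Proof. by move=> kn; rewrite /coveq covers_incr ?orbT. Qed.

Lemma covers_coveq mu lam : covers mu lam -> coveq mu lam.
Proof. by rewrite /coveq orbC => ->. Qed.

Lemma partition_union (mu : seq nat) k m : k != m -> is_partition (incr_nth mu k) ->
  is_partition (incr_nth mu m) -> is_partition (incr_nth (incr_nth mu k) m).
Proof.
move=> km /is_partitionP pk /is_partitionP pm; apply/is_partitionP => i.
move: (pk i) (pm i) km; rewrite !nth_incr_nth.
by do 4![case: eqP => ?]; subst; rewrite ?eqxx //; lia.
Qed.

(** If the last of the $n+1$ parts were positive, all of them would be, giving more than $n$ cells.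
    This supplies the empty last row needed by the interpolation sums. *)
Lemma partition_last (s : seq nat) n : is_partition s -> size s = n.+1 ->
  (psize s <= n)%N -> nth 0%N s n = 0%N.
Proof.
move=> ps sz le; apply/eqP; rewrite -leqn0 leqNgt; apply/negP => lt.
have : all (leq 1) s.
  apply/(all_nthP 0%N) => i; rewrite sz ltnS => i_n.
  exact: leq_trans lt (partition_nth_le ps i_n).
move: le; rewrite -ltnS -sz /psize ltnNge => /negP + h; apply.
elim: s h {ps sz lt} => //= a l IH /andP[a1 /IH]; lia.
Qed.

(** * Local rules as transition kernels *)

Section Kernels.
Variables (K : fieldType) (q t : K).
Hypothesis brk_neq0 : forall i j, (0 < i + j)%N -> brk q t i j != 0.
Hypotheses (q_neq0 : q != 0) (t_neq0 : t != 0).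
Variable n : nat.

(** Either the square is of type III, and the sum is [sum_Pup] or [sum_Pdiag], or there is a single
    admissible SE label, of weight 1. The size bound ensures that the SE label still fits into
    [ptn n]. *)
Lemma sum_forward_rule (c : bool) (nw ne sw : seq nat) :
  size nw = n -> size ne = n -> size sw = n ->
  is_partition nw -> is_partition ne -> is_partition sw ->
  coveq nw ne -> coveq nw sw -> c ==> (nw == ne) && (ne == sw) ->
  (psize ne + psize sw + c <= n + psize nw)%N ->
  \sum_(y : ptn n | is_partition (pseq y) && local_rule c nw ne sw (pseq y))
    sqw q t nw ne sw (pseq y) = 1.
Proof.
move=> s1 s2 s3 p1 p2 p3 c1 c2 cc le.
case: c cc le => /= [/andP[/eqP e1 /eqP e2]|_]; rewrite ?addn0 => le.
  subst ne sw; have lt : (psize nw < n)%N by lia.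
  rewrite (eq_bigl (fun y : ptn n => is_partition (pseq y) && covers nw (pseq y))); last first.
    move=> y; rewrite /local_rule !coveq_refl !eqxx /= /coveq; congr (_ && _).
    case C: (covers nw (pseq y)).
      by rewrite !orbT /=; case/andP: C => _ /eqP ->; lia.
    rewrite !orbF; case: eqP => //= <-; lia.
  rewrite (eq_bigr (fun y => Pup q t nw (pseq y))) => [|y /andP[_ C]]; last first.
    by rewrite /sqw /typeIII !eqxx C.
  rewrite (sum_covers_up (Pup q t nw)) //.
  case: n s1 lt {s2 s3 le} => // n' s1 lt.
  by rewrite sum_Pup // partition_last.
have uniq_sum s0 : size s0 = n -> (psize s0 <= n)%N -> is_partition s0 ->
    local_rule false nw ne sw s0 ->
    (forall y, size y = n -> local_rule false nw ne sw y -> y = s0) ->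
    sqw q t nw ne sw s0 = 1 ->
  \sum_(y : ptn n | is_partition (pseq y) && local_rule false nw ne sw (pseq y))
    sqw q t nw ne sw (pseq y) = 1.
  move=> s4 le4 p4 r4 u4 w4; rewrite (big_pred1 (ptn_of n s0)) => [|y].
    by rewrite ptn_ofK.
  apply/andP/eqP => [[_ /u4 e]|->]; last by rewrite ptn_ofK.
  by apply: pseq_inj; rewrite ptn_ofK // e // size_pseq.
case/orP: c1 => [/eqP e1|].
  subst ne; apply: (uniq_sum sw) => //; first lia.
  - by apply: local_ruleN_size; rewrite ?s1 ?coveq_refl // addnC.
  - move=> y sy /and5P[_ _ _ c4 /andP[/eqP e _]]; apply/esym/subp_eq; rewrite ?s3 ?sy //.
      exact: coveq_subp.
    lia.
  by rewrite /sqw /typeIII; case: eqP => //= <-; rewrite coversN andbF.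
case/coversP => [|m mn e1]; first by rewrite s1.
case/orP: c2 => [/eqP e2|].
  subst sw; apply: (uniq_sum ne) => //; first lia.
  - by apply: local_ruleN_size; rewrite ?s1 ?coveq_refl // e1 coveq_incr.
  - move=> y sy /and5P[_ _ c3 _ /andP[/eqP e _]]; apply/esym/subp_eq; rewrite ?s2 ?sy //.
      exact: coveq_subp.
    lia.
  by rewrite /sqw /typeIII coversN !andbF.
case/coversP => [|k kn e2]; first by rewrite s1.
have pse : psize ne = (psize nw).+1 by rewrite e1 psize_incr.
have psw : psize sw = (psize nw).+1 by rewrite e2 psize_incr.
case: (eqVneq k m) => [ekm|km].
  have esw : sw = ne by rewrite e1 e2 ekm.
  have lt : (psize ne < n)%N by lia.
  have Cn : covers nw ne by rewrite e1 covers_incr.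
  rewrite esw (eq_bigl (fun y : ptn n => is_partition (pseq y) && covers ne (pseq y))); last first.
    move=> y; rewrite /local_rule /= andbT (covers_coveq Cn) /=; congr (_ && _); rewrite addn0.
    rewrite andbA andbb /coveq; case C: (covers ne (pseq y)).
      by rewrite orbT /=; case/andP: C => _ /eqP ->; lia.
    by rewrite orbF; case: eqP => //= <-; lia.
  rewrite (eq_bigr (fun y => Pdiag q t nw ne (pseq y))) => [|y /andP[_ C]]; last first.
    rewrite /sqw /typeIII eqxx C Cn orbT /= ifN //.
    by rewrite e1 eq_sym incr_nth_neq.
  rewrite (sum_covers_up (Pdiag q t nw ne)) //.
  case: n s1 s2 lt {s3 le uniq_sum} => // n' s1 s2 lt; rewrite e1.
  by rewrite sum_Pdiag -?e1 // partition_last.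
have e3 : incr_nth ne k = incr_nth sw m by rewrite e1 e2 incr_nthC.
apply: (uniq_sum (incr_nth ne k)).
- by rewrite size_incr ?s2 -?s1.
- by rewrite psize_incr; lia.
- by rewrite e1; apply: partition_union; rewrite -?e1 -?e2 // eq_sym.
- apply: local_ruleN_size.
  + by rewrite s1.
  + by rewrite s1.
  + by rewrite size_incr ?s2 -?s1.
  + by rewrite e3 size_incr ?s3 -?s1.
  + by rewrite e1 coveq_incr.
  + by rewrite e2 coveq_incr.
  + by rewrite coveq_incr // s2 -s1.
  + by rewrite e3 coveq_incr // s3 -s1.
  + by rewrite psize_incr pse psw; lia.
- move=> y sy r; have sq : size y = size nw by rewrite sy s1.
  have := local_ruleP (etrans s2 (esym s1)) (etrans s3 (esym s1)) sq r.
  have neq1 : nw <> ne by rewrite e1 => /esym/eqP; rewrite (negbTE (incr_nth_neq _ _)).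
  have neq2 : nw <> sw by rewrite e2 => /esym/eqP; rewrite (negbTE (incr_nth_neq _ _)).
  case=> [//|//|k' m' _ _ _ e4 _ -> _|k' m' _ _ _ e _|//].
    by congr incr_nth; apply: (@incr_nth_inj nw); rewrite -e4 e2.
  by move: km; rewrite e1 e2 in e; case/eqP; apply: (@incr_nth_inj nw).
rewrite /sqw /typeIII ifN // negb_and; apply/orP; left.
by rewrite e1 e2; apply: contra km => /eqP /incr_nth_inj ->.
Qed.

(** Going backwards, whether the square contains a 1 is part of the random choice; hence both values
    are allowed at once. *)
Lemma sum_backward_rule (ne sw se : seq nat) :
  size ne = n -> size sw = n -> size se = n ->
  is_partition ne -> is_partition sw -> is_partition se -> (psize se <= n)%N ->
  coveq ne se -> coveq sw se ->
  \sum_(x : ptn n | is_partition (pseq x) &&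
      (local_rule false (pseq x) ne sw se || local_rule true (pseq x) ne sw se))
    sqwbar q t (pseq x) ne sw se = 1.
Proof.
move=> s1 s2 s3 p1 p2 p3 le c1 c2.
have nrt (x : ptn n) : ne <> sw \/ ne = se -> local_rule true (pseq x) ne sw se = false.
  case=> ns; apply/negbTE/negP => /and5P[_ _ _ _ /andP[/eqP e /= /andP[/eqP e1 /eqP e2]]] //.
  by move: e; rewrite -ns e1 -e2; lia.
have uniq_sum s0 : size s0 = n -> is_partition s0 -> ne <> sw \/ ne = se ->
    local_rule false s0 ne sw se ->
    (forall x, size x = n -> local_rule false x ne sw se -> x = s0) ->
    sqwbar q t s0 ne sw se = 1 ->
  \sum_(x : ptn n | is_partition (pseq x) &&
      (local_rule false (pseq x) ne sw se || local_rule true (pseq x) ne sw se))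
    sqwbar q t (pseq x) ne sw se = 1.
  move=> s4 p4 ns r4 u4 w4.
  have le4 : (psize s0 <= n)%N.
    apply: leq_trans le; apply: subp_psize; first by rewrite s4.
    case/and5P: r4 => /coveq_subp h1 _ /coveq_subp h2 _ _.
    by apply: subp_trans h1 h2; rewrite ?s4 ?s1.
  rewrite (big_pred1 (ptn_of n s0)) => [|x]; first by rewrite ptn_ofK.
  rewrite nrt // orbF; apply/andP/eqP => [[_ /u4 e]|->]; last by rewrite ptn_ofK.
  by apply: pseq_inj; rewrite ptn_ofK // e // size_pseq.
case/orP: (c1) => [/eqP e1|].
  apply: (uniq_sum sw); [by []|by []|by right| | |].
  - by apply: local_ruleN_size; rewrite ?s1 ?s2 ?s3 ?coveq_refl // ?e1 // addnC.
  - move=> x sx /and5P[_ c3 _ _ /andP[/eqP e _]]; apply: subp_eq; rewrite ?s2 ?sx //.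
      exact: coveq_subp.
    by move: e; rewrite e1; lia.
  by rewrite /sqwbar /typeIII e1 coversN !andbF.
move=> cne; case/orP: (c2) => [/eqP e2|csw].
  have nes : ne <> sw.
    by rewrite e2 => e; rewrite e coversN in cne.
  apply: (uniq_sum ne); [by []|by []|by left| | |].
  - by apply: local_ruleN_size; rewrite ?s1 ?s2 ?s3 ?coveq_refl // ?e2 // addnC.
  - move=> x sx /and5P[c3 _ _ _ /andP[/eqP e _]]; apply: subp_eq; rewrite ?s1 ?sx //.
      exact: coveq_subp.
    by move: e; rewrite e2; lia.
  by rewrite /sqwbar /typeIII; case: eqP.
have [k kn ek] := coversP (etrans s1 (esym s3)) cne.
have [m mn em] := coversP (etrans s2 (esym s3)) csw.
have psz : psize se = (psize ne).+1 by rewrite ek psize_incr.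
have psz' : psize se = (psize sw).+1 by rewrite em psize_incr.
rewrite s1 in kn; rewrite s2 in mn.
case: (eqVneq ne sw) => [esw|nsw].
  (* The NW label [ne] means that the square contains a 1 and gives the separate [Pbarup] term of
     [sum_Pbardiag]; a smaller NW label means that it contains none. *)
  have pred_x (x : ptn n) : is_partition (pseq x) &&
      (local_rule false (pseq x) ne sw se || local_rule true (pseq x) ne sw se) =
      (x == ptn_of n ne) || (is_partition (pseq x) && covers (pseq x) ne).
    have -> : (x == ptn_of n ne) = (pseq x == ne).
      by rewrite -(inj_eq (@pseq_inj n)) ptn_ofK // (leq_trans _ le) // psz.
    rewrite -esw /local_rule eqxx c1 /= !andbT !andbA !andbb /coveq addn0.
    case: eqP => [->|nx] /=; [by rewrite p1 andbT /=; apply/orP; right; apply/eqP; move: psz; clear; lia|].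
    rewrite !andbF orbF -[RHS]andbA -[subp _ _ && _]/(covers (pseq x) ne).
    case C: (covers (pseq x) ne); last by rewrite ?andbF.
    have -> : (psize se + psize (pseq x) == psize ne + psize ne)%N; last by [].
    by apply/eqP; case/andP: C => _ /eqP; move: psz; clear; lia.
  rewrite (eq_bigl _ _ pred_x) (bigD1 (ptn_of n ne)) ?eqxx //=.
  have le_ne : (psize ne <= n)%N by rewrite (leq_trans _ le) // psz.
  rewrite ptn_ofK //.
  rewrite -[RHS](sum_Pbardiag brk_neq0 q_neq0 t_neq0 p1 (k := k)) ?s1 // -?ek //.
  congr (_ + _); first by rewrite /sqwbar /typeIII -esw !eqxx cne.
  rewrite -(sum_covers_down (fun s => Pbardiag q t s ne se)) //.
  apply: eq_big => [x|x /andP[/orP[/eqP ->|/andP[_ C]] nx]]; last 2 first.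
  - by rewrite eqxx in nx.
  - rewrite /sqwbar /typeIII -esw eqxx C cne orbT /= ifN //.
    by apply: contraTneq C => ->; rewrite coversN.
  rewrite andb_orl andbN orFb; case C: (covers (pseq x) ne); last by rewrite !andbF.
  rewrite andbT; case: eqP => [e|]; last by rewrite andbT.
  by rewrite e ptn_ofK // coversN in C.
have km : k != m.
  apply: contraNneq nsw => e; move: ek; rewrite em e => E.
  apply/eqP/(@eq_from_nth _ 0%N) => [|i _]; first by rewrite s1.
  have := congr1 (nth 0%N ^~ i) E; rewrite !nth_incr_nth => /eqP.
  by rewrite eqn_add2l => /eqP.
have nE i : ((k == i) + nth 0%N ne i = (m == i) + nth 0%N sw i)%N.
  by have := congr1 (nth 0%N ^~ i) ek; rewrite em !nth_incr_nth.
have nem : (0 < nth 0%N ne m)%N by move: (nE m); rewrite eqxx (negbTE km); clear; lia.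
(* The NW label has to be the intersection of [ne] and [sw], that is [ne] without the box by which
   [sw] falls short of [se]. *)
pose x := decr_nth ne m.
have xn i : nth 0%N x i = (nth 0%N ne i - (m == i))%N.
  by rewrite nth_set_nth /= eq_sym; case: eqP => [->|_]; rewrite ?subn0 ?subn1.
have sx : size x = n by rewrite size_decr_nth ?s1.
have nex : ne = incr_nth x m by rewrite incr_decr_nth ?s1.
have swx : sw = incr_nth x k.
  apply: (@eq_from_nth _ 0%N) => [|i _]; first by rewrite size_incr sx.
  rewrite nth_incr_nth xn; move: (nE i); case: (eqVneq m i) => [<-|_]; last by clear; lia.
  by rewrite (negbTE km); clear; lia.
have px : is_partition x.
  apply/is_partitionP => i; rewrite !xn.
  move/is_partitionP/(_ i): p1 => h1; move/is_partitionP/(_ i): p2 => h2.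
  by move: (nE i) (nE i.+1) km h1 h2; clear; do 4![case: eqP => ?]; lia.
have psx : psize ne = (psize x).+1 by rewrite nex psize_incr.
apply: (uniq_sum x) => //; first by left; apply/eqP.
- apply: local_ruleN_size => //; rewrite ?s1 ?s2 ?s3 //.
  + by rewrite nex coveq_incr ?sx.
  + by rewrite swx coveq_incr ?sx.
  + by move: psz psz' psx; clear; lia.
- move=> y sy r; have := local_ruleP (etrans s1 (esym sy)) (etrans s2 (esym sy)) (etrans s3 (esym sy)) r.
  case=> [_ e|_ e|k' m' _ _ _ e4 e5 e6 e7|k' m' _ _ _ e _|k' _ _ e _].
  + by rewrite e coversN in csw.
  + by rewrite e coversN in cne.
  + have mm : m' = m by apply: (@incr_nth_inj sw); rewrite -e7 em.
    have := e5; rewrite mm nex => E.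
    apply: (@eq_from_nth _ 0%N) => [|i _]; first by rewrite sx.
    have := congr1 (nth 0%N ^~ i) E; rewrite !nth_incr_nth => /eqP.
    by rewrite eqn_add2l => /eqP.
  + by rewrite e eqxx in nsw.
  + by rewrite e eqxx in nsw.
by rewrite /sqwbar /typeIII (negbTE nsw).
Qed.

End Kernels.

(** * Growths *)

Lemma ones_NW_col n (s : 'S_n) i (j : 'I_n) :
  ones_NW s i j.+1 = (ones_NW s i j + (s j < i))%N.
Proof.
rewrite /ones_NW -!sum1dep_card !(big_mkcond (fun j' : 'I_n => (j' < _)%N && _)) /=.
rewrite (bigD1 j) //= [in RHS](bigD1 j) //= ltnSn ltnn /= add0n addnC; congr (_ + _)%N.
by apply: eq_bigr => j' j'j; rewrite ltnS leq_eqVlt val_eqE (negbTE j'j).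
Qed.

(** Transposing the permutation matrix replaces the permutation by its inverse. *)
Lemma ones_NW_row n (s : 'S_n) (i : 'I_n) j :
  ones_NW s i.+1 j = (ones_NW s i j + ((s^-1)%g i < j))%N.
Proof.
have sw i0 j0 : ones_NW s i0 j0 = ones_NW (s^-1)%g j0 i0.
  rewrite /ones_NW -!sum1dep_card (reindex_inj (@perm_inj _ (s^-1)%g)) /=.
  by apply: eq_bigl => k; rewrite permKV andbC.
by rewrite sw ones_NW_col -sw.
Qed.

Lemma ones_NW0l n (s : 'S_n) j : ones_NW s 0 j = 0%N.
Proof. by apply/eqP; rewrite cards_eq0; apply/eqP/setP => k; rewrite !inE ltn0 andbF. Qed.

Lemma ones_NW0r n (s : 'S_n) i : ones_NW s i 0 = 0%N.
Proof. by apply/eqP; rewrite cards_eq0; apply/eqP/setP => k; rewrite !inE ltn0. Qed.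

Lemma ones_NW_le n (s : 'S_n) i j : (ones_NW s i j <= n)%N.
Proof. by rewrite -[X in (_ <= X)%N]card_ord max_card. Qed.

Lemma ones_NW_square n (s : 'S_n) (i j : 'I_n) :
  (ones_NW s i.+1 j.+1 + ones_NW s i j = ones_NW s i.+1 j + ones_NW s i j.+1 + (s j == i))%N.
Proof.
rewrite !ones_NW_col ltnS leq_eqVlt val_eqE.
by case: eqP => [->|_] /=; rewrite ?ltnn; lia.
Qed.

Lemma ones_NW_at n (s : 'S_n) (i j : 'I_n) : s j = i ->
  ones_NW s i.+1 j = ones_NW s i j /\ ones_NW s i j.+1 = ones_NW s i j.
Proof.
by move=> e; rewrite ones_NW_row ones_NW_col e -e permK !ltnn !addn0.
Qed.

Lemma local_rule_sizes n (s : 'S_n) (i j : 'I_n) nw ne sw se :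
  size nw = n -> size ne = n -> size sw = n -> size se = n ->
  subp nw ne -> subp nw sw -> subp ne se -> subp sw se ->
  psize nw = ones_NW s i j -> psize ne = ones_NW s i j.+1 ->
  psize sw = ones_NW s i.+1 j -> psize se = ones_NW s i.+1 j.+1 ->
  local_rule (s j == i) nw ne sw se.
Proof.
move=> s1 s2 s3 s4 b1 b2 b3 b4 e1 e2 e3 e4.
apply/and5P; split.
- by apply: subp_coveq; rewrite ?s1 // e1 e2 ones_NW_col; lia.
- by apply: subp_coveq; rewrite ?s1 // e1 e3 ones_NW_row; lia.
- by apply: subp_coveq; rewrite ?s2 // e2 e4 ones_NW_row; lia.
- by apply: subp_coveq; rewrite ?s3 // e3 e4 ones_NW_col; lia.
rewrite e1 e2 e3 e4 ones_NW_square [(ones_NW s i.+1 j + _)%N]addnC eqxx /=.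
apply/implyP => /eqP /ones_NW_at[h1 h2]; rewrite h1 in e3; rewrite h2 in e2.
have en : nw = ne by apply: subp_eq; rewrite ?s1 ?e1.
have es : nw = sw by apply: subp_eq; rewrite ?s1 ?e1.
by rewrite -en -es !eqxx.
Qed.

Section Growths.
Variable n : nat.
Implicit Types (L : labeling n) (s : 'S_n) (T P Q : chain n).

Lemma size_gv L i j : size (gv L i j) = n. Proof. exact: size_pseq. Qed.

Lemma is_growthP s L : reflect
  [/\ forall i j, (i <= n)%N -> (j <= n)%N -> is_partition (gv L i j),
      forall i j, (i <= n)%N -> (j < n)%N -> subp (gv L i j) (gv L i j.+1),
      forall i j, (i < n)%N -> (j <= n)%N -> subp (gv L i j) (gv L i.+1 j) &
      forall i j, (i <= n)%N -> (j <= n)%N -> psize (gv L i j) = ones_NW s i j]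
  (is_growth s L).
Proof.
apply: (iffP and4P) => -[h1 h2 h3 h4]; split.
- by move=> i j _ _; apply: (forallP h1).
- move=> i j i_n jn; have := forallP (forallP h2 (Ordinal (i_n : i < n.+1)%N)) (Ordinal jn).
  by [].
- move=> i j i_n jn.
  by have := forallP (forallP h3 (Ordinal i_n)) (Ordinal (jn : j < n.+1)%N).
- move=> i j i_n jn; apply/eqP.
  by have := forallP (forallP h4 (Ordinal (i_n : i < n.+1)%N)) (Ordinal (jn : j < n.+1)%N).
- apply/forallP => -[i j]; have := h1 i j; rewrite /gv !inord_val.
  by apply; rewrite -ltnS.
- by apply/forallP => i; apply/forallP => j; apply: h2 => //; rewrite -ltnS.
- by apply/forallP => i; apply/forallP => j; apply: h3 => //; rewrite -ltnS.
- by apply/forallP => i; apply/forallP => j; apply/eqP; apply: h4; rewrite -ltnS.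
Qed.

Lemma growth_local_rule s L (i j : 'I_n) : is_growth s L ->
  local_rule (s j == i) (gv L i j) (gv L i j.+1) (gv L i.+1 j) (gv L i.+1 j.+1).
Proof.
case/is_growthP => h1 h2 h3 h4.
have [i_n jn] := (ltn_ord i, ltn_ord j).
have [i_n' jn'] := (ltnW i_n, ltnW jn).
by apply: local_rule_sizes; rewrite ?size_gv ?h4 ?h2 ?h3.
Qed.

Lemma is_sytP T : reflect
  [/\ psize (cv T 0) = 0%N, forall i, is_partition (cv T i) &
      forall i, (i < n)%N -> covers (cv T i) (cv T i.+1)]
  (is_syt T).
Proof.
apply: (iffP and3P) => -[h1 h2 h3]; split; first exact/eqP.
- by move=> i; apply: (forallP h2).
- by move=> i i_n; apply: (forallP h3 (Ordinal i_n)).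
- exact/eqP.
- by apply/forallP => i; have := h2 i; rewrite /cv inord_val.
by apply/forallP => i; apply: h3.
Qed.

Lemma psize_syt T i : is_syt T -> (i <= n)%N -> psize (cv T i) = i.
Proof.
case/is_sytP => h0 _ h; elim: i => // i IH i_n.
by have /andP[_ /eqP ->] := h i i_n; rewrite IH // ltnW.
Qed.

Lemma inord_n : inord n = ord_max :> 'I_n.+1.
Proof. by apply: val_inj; rewrite /= inordK. Qed.

Lemma cv_Ptab L i : cv (Ptab L) i = gv L i n.
Proof. by rewrite /cv /gv ffunE inord_n. Qed.

Lemma cv_Qtab L j : cv (Qtab L) j = gv L n j.
Proof. by rewrite /cv /gv ffunE inord_n. Qed.

Lemma ones_NW_nr s i : (i <= n)%N -> ones_NW s i n = i.
Proof.
elim: i => [|i IH] i_n; first by rewrite ones_NW0l.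
by rewrite (ones_NW_row s (Ordinal i_n)) /= IH ?(ltnW i_n) // ltn_ord addn1.
Qed.

Lemma ones_NW_nl s j : (j <= n)%N -> ones_NW s n j = j.
Proof.
elim: j => [|j IH] jn; first by rewrite ones_NW0r.
by rewrite (ones_NW_col s n (Ordinal jn)) /= IH ?(ltnW jn) // ltn_ord addn1.
Qed.

Lemma Ptab_syt s L : is_growth s L -> is_syt (Ptab L).
Proof.
case/is_growthP => h1 h2 h3 h4; apply/is_sytP; split => [|i|i i_n]; rewrite !cv_Ptab.
- by rewrite h4 // ones_NW0l.
- rewrite /gv; have := h1 (inord i : 'I_n.+1) n; rewrite /gv inord_val; apply=> //.
  by rewrite -ltnS.
- by have i_n' := ltnW i_n; rewrite /covers h3 // !h4 // !ones_NW_nr // eqxx.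
Qed.

Lemma Qtab_syt s L : is_growth s L -> is_syt (Qtab L).
Proof.
case/is_growthP => h1 h2 h3 h4; apply/is_sytP; split => [|i|i i_n]; rewrite !cv_Qtab.
- by rewrite h4 // ones_NW0r.
- rewrite /gv; have := h1 n (inord i : 'I_n.+1); rewrite /gv inord_val; apply=> //.
  by rewrite -ltnS.
- by have i_n' := ltnW i_n; rewrite /covers h2 // !h4 // !ones_NW_nl // eqxx.
Qed.

Lemma shape_tabs L : syt_shape (Qtab L) = syt_shape (Ptab L).
Proof. by rewrite /syt_shape cv_Ptab cv_Qtab. Qed.

End Growths.

Lemma psize_eq0 n (l : seq nat) : size l = n -> psize l = 0%N -> l = nseq n 0%N.
Proof.
move=> sz l0; apply: (@eq_from_nth _ 0%N) => [|i _]; first by rewrite size_nseq.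
by have := nth_le_psize l i; rewrite l0 nth_nseq if_same leqn0 => /eqP.
Qed.

Lemma subp_psize0 (mu lam : seq nat) : size mu = size lam -> psize mu = 0%N -> subp mu lam.
Proof.
move=> sz l0; apply/subpP => // i; apply: leq_trans (leq0n _).
by have := nth_le_psize mu i; rewrite l0.
Qed.

Lemma psize_nseq0 n : psize (nseq n 0%N) = 0%N.
Proof. by rewrite /psize sumn_nseq mul0n. Qed.

Lemma partition_nseq0 n : is_partition (nseq n 0%N).
Proof. by apply/is_partitionP => i; rewrite !nth_nseq !if_same. Qed.

(** * Revealing the labels row by row from the NW corner *)

Section Forward.
Variables (K : fieldType) (q t : K).
Hypothesis brk_neq0 : forall i j, (0 < i + j)%N -> brk q t i j != 0.
Hypotheses (q_neq0 : q != 0) (t_neq0 : t != 0).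
Variables (n : nat) (s : 'S_n).
Local Notation V := ('I_n.+1 * 'I_n.+1)%type.

(** Only the upper and left neighbours of [v] are consulted, so the condition concerns labels
    already revealed. *)
Definition fwd_adm (v : V) (L : labeling n) : bool :=
  [&& is_partition (gv L v.1 v.2), psize (gv L v.1 v.2) == ones_NW s v.1 v.2,
      (0 < v.1)%N ==> subp (gv L v.1.-1 v.2) (gv L v.1 v.2) &
      (0 < v.2)%N ==> subp (gv L v.1 v.2.-1) (gv L v.1 v.2)].

(** The weight of a square is charged to its SE vertex, the last of its four vertices to be
    revealed. *)
Definition fwd_wt (v : V) (L : labeling n) : K :=
  if (0 < v.1)%N && (0 < v.2)%N then
    sqw q t (gv L v.1.-1 v.2.-1) (gv L v.1.-1 v.2) (gv L v.1 v.2.-1) (gv L v.1 v.2)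
  else 1.

Definition fwd_rank (v : V) : nat := (v.1 * n.+1 + v.2)%N.

Lemma fwd_rank_inj : injective fwd_rank.
Proof.
move=> [i j] [i' j']; rewrite /fwd_rank /= => e.
have ii : val i = val i'.
  by have := congr1 (divn ^~ n.+1) e; rewrite /= !divnMDl // !divn_small // !addn0.
by congr pair; apply: val_inj => //; move: e; rewrite /= ii => /addnI.
Qed.

Lemma fwd_rank_le (i j i' j' : nat) : (i' <= i)%N -> (j' <= j)%N -> (i <= n)%N -> (j <= n)%N ->
  (fwd_rank (inord i', inord j') <= fwd_rank (inord i, inord j))%N.
Proof.
move=> ii jj i_n jn; rewrite /fwd_rank /= !inordK ?ltnS //; last 2 first.
- exact: leq_trans jj jn.
- exact: leq_trans ii i_n.
by rewrite leq_add ?leq_mul.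
Qed.

Lemma growth_fwd_adm (L : labeling n) : is_growth s L = [forall v, fwd_adm v L].
Proof.
apply/is_growthP/forallP => [[h1 h2 h3 h4] [i j]|h].
  have [i_n jn] : (i <= n)%N /\ (j <= n)%N by split; rewrite -ltnS.
  rewrite /fwd_adm /= h1 // h4 // eqxx /=; apply/andP; split; apply/implyP.
    by case: (val i) i_n => //= i' i_n _; apply: h3.
  by case: (val j) jn => //= j' jn _; apply: h2.
have hv i j (i_n : (i <= n)%N) (jn : (j <= n)%N) := h (Ordinal (i_n : i < n.+1)%N, Ordinal (jn : j < n.+1)%N).
split=> i j i_n jn.
- by have /and4P[] := hv i j i_n jn.
- by have /and4P[_ _ _ /=] := hv i j.+1 i_n jn.
- by have /and4P[_ _ /= + _] := hv i.+1 j i_n jn.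
- by have /and4P[_ /eqP] := hv i j i_n jn.
Qed.

Lemma growth_weight_fwd (L : labeling n) : growth_weight q t L = \prod_v fwd_wt v L.
Proof.
rewrite -(pair_bigA _ (fun i j => fwd_wt (i, j) L)) big_ord_recl /= [X in _ = X * _]big1 ?mul1r //.
apply: eq_bigr => i _; rewrite [RHS]big_ord_recl [X in _ = X * _]/fwd_wt /= ?andbF mul1r.
by apply: eq_bigr => j _; rewrite /fwd_wt /= ?add0n.
Qed.

Lemma gv_upd (L : labeling n) (v : V) x i j : (i <= n)%N -> (j <= n)%N ->
  (i, j) != (val v.1, val v.2) -> gv (upd L v x) i j = gv L i j.
Proof.
move=> i_n jn ne; rewrite /gv ffunE ifN //; apply: contra ne => /eqP <- /=.
by rewrite !inordK ?ltnS.
Qed.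

Lemma gv_updv (L : labeling n) (v : V) x : gv (upd L v x) v.1 v.2 = pseq x.
Proof. by rewrite /gv ffunE !inord_val -surjective_pairing eqxx. Qed.

Lemma sum_growth_weight : \sum_(L : labeling n | is_growth s L) growth_weight q t L = 1.
Proof.
under eq_bigl do rewrite growth_fwd_adm.
under eq_bigr do rewrite growth_weight_fwd.
apply: (sum_prod_sequential (ptn_of n [::]) fwd_rank_inj).
  move=> [i j] L L' h.
  have e i' j' : (i' <= i)%N -> (j' <= j)%N -> gv L i' j' = gv L' i' j'.
    move=> ii jj; rewrite /gv h // -[X in (_ <= fwd_rank (X, _))%N](inord_val i).
    rewrite -[X in (_ <= fwd_rank (_, X))%N](inord_val j).
    by apply: fwd_rank_le; rewrite // -ltnS.
  by rewrite /fwd_adm /fwd_wt /= !e // leq_pred.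
move=> [i j] L adm.
have [i_n jn] : (i <= n)%N /\ (j <= n)%N by split; rewrite -ltnS.
have lt_rank i' j' : (i' <= i)%N -> (j' <= j)%N -> (i' < i)%N || (j' < j)%N ->
    (i' * n.+1 + j' < i * n.+1 + j)%N.
  move=> ii jj; case/orP => lt; last by rewrite -addnS leq_add ?leq_mul.
  by rewrite -addSn leq_add // ltn_mul2r.
have before i' j' : (i' <= i)%N -> (j' <= j)%N -> (i' < i)%N || (j' < j)%N ->
    [/\ is_partition (gv L i' j'), psize (gv L i' j') = ones_NW s i' j',
     (0 < i')%N -> subp (gv L i'.-1 j') (gv L i' j') &
     (0 < j')%N -> subp (gv L i' j'.-1) (gv L i' j')].
  move=> ii jj lt.
  have i'n := leq_ltn_trans ii (ltn_ord i); have j'n := leq_ltn_trans jj (ltn_ord j).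
  have /and4P[a1 /eqP a2 /implyP a3 /implyP a4] := adm (Ordinal i'n, Ordinal j'n) (lt_rank _ _ ii jj lt).
  by split.
have gvE x i' j' : (i' <= i)%N -> (j' <= j)%N -> (i' < i)%N || (j' < j)%N ->
    gv (upd L (i, j) x) i' j' = gv L i' j'.
  move=> ii jj lt; apply: gv_upd; [exact: leq_trans ii i_n|exact: leq_trans jj jn|].
  by apply: contraTneq lt => -[-> ->]; rewrite !ltnn.
have gvv x : gv (upd L (i, j) x) i j = pseq x := gv_updv L (i, j) x.
(* The product of the coordinates vanishes exactly on the top row and the left column, where no
   square ends. *)
case: (posnP (i * j)%N) => [b|]; last first.
  rewrite muln_gt0 => /andP[i0 j0].
  have io : (i.-1 < n)%N by rewrite prednK.
  have jo : (j.-1 < n)%N by rewrite prednK.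
  have i1 := prednK i0; have j1 := prednK j0.
  have li : (i.-1 < i)%N by rewrite i1.
  have lj : (j.-1 < j)%N by rewrite j1.
  have [pnw znw _ _] := before i.-1 j.-1 (leq_pred _) (leq_pred _) (introT orP (or_introl li)).
  have [pne zne _ /(_ j0) sne] := before i.-1 j (leq_pred _) (leqnn _) (introT orP (or_introl li)).
  have [psw zsw /(_ i0) ssw _] := before i j.-1 (leqnn _) (leq_pred _) (introT orP (or_intror lj)).
  pose c := s (Ordinal jo) == Ordinal io.
  have sq := ones_NW_square s (Ordinal io) (Ordinal jo); rewrite -/c /= i1 j1 in sq.
  have rule x : fwd_adm (i, j) (upd L (i, j) x) = is_partition (pseq x) &&
      local_rule c (gv L i.-1 j.-1) (gv L i.-1 j) (gv L i j.-1) (pseq x).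
    rewrite /fwd_adm /= i0 j0 gvv !gvE ?leq_pred ?li ?lj ?orbT //=.
    case: (is_partition (pseq x)) => //=.
    apply/and3P/idP => [[/eqP e b1 b2]|r].
      apply: local_rule_sizes; rewrite ?size_gv ?size_pseq //= ?i1 ?j1 //.
    have /and5P[_ _ /coveq_subp b1 /coveq_subp b2 /andP[/eqP e _]] := r.
    split=> //; apply/eqP; move: e sq; rewrite znw zne zsw; clear; lia.
  rewrite (eq_bigl _ _ rule).
  under eq_bigr do rewrite /fwd_wt /= i0 j0 /= gvv !gvE ?leq_pred ?li ?lj ?orbT //.
  apply: sum_forward_rule => //; rewrite ?size_gv //.
  - by apply: subp_coveq; rewrite ?size_gv // zne znw -j1 (ones_NW_col s i.-1 (Ordinal jo)) /=; clear; lia.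
  - by apply: subp_coveq; rewrite ?size_gv // zsw znw -{1}i1 (ones_NW_row s (Ordinal io)) /=; clear; lia.
  - apply/implyP => /eqP /ones_NW_at /=; rewrite i1 j1 => -[h1 h2].
    have e1 : gv L i.-1 j.-1 = gv L i.-1 j by apply: subp_eq; rewrite ?size_gv // znw zne h2.
    have e2 : gv L i.-1 j.-1 = gv L i j.-1 by apply: subp_eq; rewrite ?size_gv // znw zsw h1.
    by rewrite -e1 -e2 !eqxx.
  - by move: (ones_NW_le s i j) sq; rewrite zne zsw znw; clear; lia.
(* On the top row and the left column the prescribed size is 0, so the empty partition is the only
   choice. *)
rewrite (eq_bigl (pred1 (ptn_of n (nseq n 0%N)))) => [|x].
  rewrite big_pred1_eq /fwd_wt /= -[(0 < i)%N && _]muln_gt0.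
  by rewrite -[(0 < _)%N]/(0 < i * j)%N b.
have ones0 i' j' : (i' <= i)%N -> (j' <= j)%N -> ones_NW s i' j' = 0%N.
  move/eqP: b; rewrite muln_eq0 => /orP[/eqP -> | /eqP ->] //.
    by rewrite leqn0 => /eqP -> _; rewrite ones_NW0l.
  by rewrite leqn0 => _ /eqP ->; rewrite ones_NW0r.
rewrite /fwd_adm /= gvv ones0 //; apply/and4P/eqP => [[_ /eqP x0 _ _]|->].
  by apply: pseq_inj; rewrite ptn_ofK ?size_nseq ?psize_nseq0 // (psize_eq0 (size_pseq x) x0).
rewrite ptn_ofK ?size_nseq ?psize_nseq0 // partition_nseq0; split=> //; apply/implyP => pos.
  rewrite gvE ?leq_pred ?prednK ?leqnn //.
  have li : (i.-1 < i)%N by rewrite prednK.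
  have [_ e _ _] := before i.-1 j (leq_pred _) (leqnn _) (introT orP (or_introl li)).
  by apply: subp_psize0; rewrite ?size_gv ?size_nseq // e ones0 // leq_pred.
rewrite gvE ?leq_pred ?prednK ?leqnn ?orbT //.
have lj : (j.-1 < j)%N by rewrite prednK.
have [_ e _ _] := before i j.-1 (leqnn _) (leq_pred _) (introT orP (or_intror lj)).
by apply: subp_psize0; rewrite ?size_gv ?size_nseq // e ones0 // leq_pred.
Qed.

Lemma sum_Pfwd :
  \sum_(P : chain n | is_syt P) \sum_(Q : chain n | is_syt Q && (syt_shape Q == syt_shape P))
    Pfwd q t s P Q = 1.
Proof.
rewrite -[RHS]sum_growth_weight pair_big_dep /=.
rewrite (partition_big (fun L : labeling n => (Ptab L, Qtab L))
  (fun PQ => is_syt PQ.1 && (is_syt PQ.2 && (syt_shape PQ.2 == syt_shape PQ.1)))) /=.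
  by apply: eq_bigr => -[P Q] _; apply: eq_bigl => L; rewrite xpair_eqE.
by move=> L gL; rewrite (Ptab_syt gL) (Qtab_syt gL) shape_tabs eqxx.
Qed.
End Forward.

(** * Revealing the labels from the SE boundary *)

Section Backward.
Variables (K : fieldType) (q t : K).
Hypothesis brk_neq0 : forall i j, (0 < i + j)%N -> brk q t i j != 0.
Hypotheses (q_neq0 : q != 0) (t_neq0 : t != 0).
Variables (n : nat) (P Q : chain n).
Hypotheses (sytP : is_syt P) (sytQ : is_syt Q) (shapePQ : syt_shape P = syt_shape Q).
Local Notation V := ('I_n.+1 * 'I_n.+1)%type.

Definition bwd_rule c (L : labeling n) (i j : nat) : bool :=
  local_rule c (gv L i j) (gv L i j.+1) (gv L i.+1 j) (gv L i.+1 j.+1).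

(** No permutation occurs here: the right and bottom sides are prescribed by the tableaux, and
    inside any square may or may not contain a 1. The corner takes its label from [P], which agrees
    with [Q] there by the common shape. *)
Definition bwd_adm (v : V) (L : labeling n) : bool :=
  if v.2 == n :> nat then gv L v.1 v.2 == cv P v.1
  else if v.1 == n :> nat then gv L v.1 v.2 == cv Q v.2
  else is_partition (gv L v.1 v.2) && (bwd_rule false L v.1 v.2 || bwd_rule true L v.1 v.2).

Definition bwd_wt (v : V) (L : labeling n) : K :=
  if (v.1 < n)%N && (v.2 < n)%N then
    sqwbar q t (gv L v.1 v.2) (gv L v.1 v.2.+1) (gv L v.1.+1 v.2) (gv L v.1.+1 v.2.+1)
  else 1.

Definition bwd_rank (v : V) : nat := ((n - v.1) * n.+1 + (n - v.2))%N.

Lemma bwd_rank_inj : injective bwd_rank.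
Proof.
move=> [i j] [i' j'] e.
have /= := @fwd_rank_inj n (rev_ord i, rev_ord j) (rev_ord i', rev_ord j').
rewrite /fwd_rank /= !subSS => /(_ e) E.
by congr pair; apply: rev_ord_inj; [exact: (congr1 fst E)|exact: (congr1 snd E)].
Qed.

Lemma growth_weightbar_bwd (L : labeling n) : growth_weightbar q t L = \prod_v bwd_wt v L.
Proof.
rewrite -(pair_bigA _ (fun i j => bwd_wt (i, j) L)) big_ord_recr /= [X in _ = _ * X]big1 ?mulr1.
  apply: eq_bigr => i _; rewrite [RHS]big_ord_recr [X in _ = _ * X]/bwd_wt /= ltnn andbF mulr1.
  by apply: eq_bigr => j _; rewrite /bwd_wt /= !ltn_ord.
by move=> j _; rewrite /bwd_wt /= ltnn.
Qed.

Lemma psize_cv_le T i : is_syt T -> (i <= n)%N -> (psize (@cv n T i) <= n)%N.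
Proof. by move=> sT i_n; rewrite psize_syt. Qed.

Lemma sum_growth_weightbar_adm :
  \sum_(L : labeling n | [forall v, bwd_adm v L]) growth_weightbar q t L = 1.
Proof.
under eq_bigr do rewrite growth_weightbar_bwd.
have [P0 Ppart Pcov] := elimT (is_sytP P) sytP.
have [Q0 Qpart Qcov] := elimT (is_sytP Q) sytQ.
have rank_le (i j i' j' : nat) : (i <= i')%N -> (j <= j')%N ->
    ((n - i') * n.+1 + (n - j') <= (n - i) * n.+1 + (n - j))%N.
  by move=> ii jj; rewrite leq_add ?leq_mul ?leq_sub2l.
apply: (sum_prod_sequential (ptn_of n [::]) bwd_rank_inj).
  move=> [i j] L L' h.
  have [i_n jn] : (i <= n)%N /\ (j <= n)%N by split; rewrite -ltnS.
  have e i' j' : (i <= i')%N -> (j <= j')%N -> (i' <= n)%N -> (j' <= n)%N ->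
      gv L i' j' = gv L' i' j'.
    by move=> ii jj i'n j'n; rewrite /gv h // /bwd_rank /= !inordK ?ltnS // rank_le.
  rewrite /bwd_adm /bwd_wt /bwd_rule /=; case: (ltngtP j n) jn => // jn _.
    case: (ltngtP i n) i_n => // i_n _ /=.
      by rewrite !e ?leqnSn ?leqnn ?(ltnW i_n) ?(ltnW jn).
    by rewrite !e ?leqnn ?(ltnW jn) // i_n.
  by rewrite andbF !e ?leqnn // jn.
move=> [i j] L adm.
have [i_n jn] : (i <= n)%N /\ (j <= n)%N by split; rewrite -ltnS.
have lt_rank i' j' : (i <= i')%N -> (j <= j')%N -> (i' <= n)%N -> (j' <= n)%N ->
    (i < i')%N || (j < j')%N ->
    ((n - i') * n.+1 + (n - j') < (n - i) * n.+1 + (n - j))%N.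
  move=> ii jj i'n j'n; case/orP => lt; last first.
    by rewrite -addnS leq_add ?leq_mul ?leq_sub2l // ltn_sub2l // (leq_trans lt).
  by rewrite -addSn leq_add ?leq_sub2l // ltn_mul2r /= ltn_sub2l // (leq_trans lt).
have admE i' j' (i'n : (i' <= n)%N) (j'n : (j' <= n)%N) : (i <= i')%N -> (j <= j')%N ->
    (i < i')%N || (j < j')%N ->
    bwd_adm (Ordinal (i'n : i' < n.+1)%N, Ordinal (j'n : j' < n.+1)%N) L.
  by move=> ii jj lt; apply: adm; apply: lt_rank.
have gvE x i' j' : (i <= i')%N -> (j <= j')%N -> (i' <= n)%N -> (j' <= n)%N ->
    (i < i')%N || (j < j')%N -> gv (upd L (i, j) x) i' j' = gv L i' j'.
  move=> ii jj i'n j'n lt; apply: gv_upd => //.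
  by apply: contraTneq lt => -[-> ->]; rewrite !ltnn.
have gvv x : gv (upd L (i, j) x) i j = pseq x := gv_updv L (i, j) x.
rewrite /bwd_adm /bwd_wt /=.
case: (ltngtP j n) (jn) => // [jn'|jn'] _; last first.
  rewrite andbF; under eq_bigl do rewrite gvv.
  by rewrite (big_pred1 (P (inord i))) // => x; rewrite /cv (inj_eq (@pseq_inj n)).
case: (ltngtP i n) (i_n) => // [i_n'|i_n'] _; last first.
  rewrite andFb; under eq_bigl do rewrite gvv.
  by rewrite (big_pred1 (Q (inord j))) // => x; rewrite /cv (inj_eq (@pseq_inj n)).
rewrite /bwd_rule /=.
under eq_bigl do rewrite gvv !gvE ?leqnSn ?ltnSn ?orbT //.
under eq_bigr do rewrite gvv !gvE ?leqnSn ?ltnSn ?orbT //.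
(* The size bound is known at once only on the bottom row, where the labels come from the tableaux;
   [size_le] carries it up the column by inclusion. *)
have info i' j' : (i <= i')%N -> (j <= j')%N -> (i' <= n)%N -> (j' <= n)%N ->
    (i < i')%N || (j < j')%N ->
    [/\ is_partition (gv L i' j'),
     (i' < n)%N -> coveq (gv L i' j') (gv L i'.+1 j'),
     (j' < n)%N -> coveq (gv L i' j') (gv L i' j'.+1) &
     (i' == n -> psize (gv L i' j') <= n)%N].
  move=> ii jj i'n j'n lt; have := admE i' j' i'n j'n ii jj lt; rewrite /bwd_adm /=.
  case: (ltngtP j' n) (j'n) => // [j'n' _|-> _ /eqP e]; last first.
    split; rewrite ?e ?ltnn //; [move=> i'n'|by move=> _; apply: psize_cv_le].
    have := admE i'.+1 n i'n' (leqnn n) (leqW ii) jn _; rewrite /bwd_adm /= eqxx.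
    by rewrite ltnS ii => /(_ isT) /eqP ->; apply/covers_coveq/Pcov.
  case: (ltngtP i' n) (i'n) => // [i'n' _|-> _ /eqP e]; last first.
    split; rewrite ?e ?ltnn //; [move=> _|by move=> _; apply: psize_cv_le].
    have := admE n j'.+1 (leqnn n) j'n' i_n (leqW jj) _; rewrite /bwd_adm /= eqxx.
    rewrite ltnS jj orbT => /(_ isT); have := covers_coveq (Qcov j' j'n').
    by case: eqP => [->|_] + /eqP -> //; rewrite -[cv Q n]/(syt_shape Q) -shapePQ.
  by case/andP=> pp /orP[] /and5P[c1 c2 _ _ _]; split=> //; rewrite ltn_eqF.
have size_le d i' : (n - i' = d)%N -> (i < i')%N -> (i' <= n)%N -> (psize (gv L i' j.+1) <= n)%N.
  elim: d i' => [|d IH] i' e lt i'n.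
    have [_ _ _] := info i' j.+1 (ltnW lt) (leqnSn j) i'n jn' (introT orP (or_introl lt)).
    by apply; rewrite eqn_leq i'n -subn_eq0 e.
  have i'n' : (i' < n)%N by rewrite -subn_gt0 e.
  have [_ /(_ i'n') /coveq_subp c _ _] :=
    info i' j.+1 (ltnW lt) (leqnSn j) i'n jn' (introT orP (or_introl lt)).
  apply: (leq_trans (subp_psize _ c)); first by rewrite !size_gv.
  by apply: IH => //; [rewrite subnS e | apply: ltnW].
have [p1 c1 _ _] := info i j.+1 (leqnn i) (leqnSn j) i_n jn' (introT orP (or_intror (ltnSn j))).
have [p2 _ c2 _] := info i.+1 j (leqnSn i) (leqnn j) i_n' jn (introT orP (or_introl (ltnSn i))).
have [p3 _ _ _] := info i.+1 j.+1 (leqnSn i) (leqnSn j) i_n' jn' (introT orP (or_introl (ltnSn i))).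
apply: sum_backward_rule => //; rewrite ?size_gv //; first exact: (size_le _ _ erefl).
- exact: c1.
- exact: c2.
Qed.

Lemma growth_bwd_adm (s : 'S_n) (L : labeling n) :
  is_growth s L -> Ptab L = P -> Qtab L = Q -> [forall v, bwd_adm v L].
Proof.
move=> gL eP eQ; apply/forallP => -[i j]; rewrite /bwd_adm /=.
case: (ltngtP j n) (leq_ord j) => // [jn|->] _; last by rewrite -eP cv_Ptab.
case: (ltngtP i n) (leq_ord i) => // [i_n|->] _; last by rewrite -eQ cv_Qtab.
have := growth_local_rule (Ordinal i_n) (Ordinal jn) gL; rewrite /bwd_rule /=.
case/is_growthP: gL => h1 _ _ _; rewrite h1 ?(ltnW i_n) ?(ltnW jn) //=.
by case: (_ == _) => ->; rewrite ?orbT.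
Qed.

(** The sizes of the labels count the 1s to the NW, and their mixed second difference at a square
    detects a 1 in it. *)
Lemma growth_perm_inj (s s' : 'S_n) (L : labeling n) : is_growth s L -> is_growth s' L -> s = s'.
Proof.
move=> /is_growthP[_ _ _ h] /is_growthP[_ _ _ h']; apply/permP => j.
have i_n := ltn_ord (s j); have jn := ltn_ord j.
have e i' j' : (i' <= n)%N -> (j' <= n)%N -> ones_NW s i' j' = ones_NW s' i' j'.
  by move=> ii jj; rewrite -h ?h'.
have := ones_NW_square s (s j) j; rewrite eqxx !e ?(ltnW i_n) ?(ltnW jn) // ones_NW_square.
by move/addnI; case: eqP => // ->.
Qed.

Lemma eq_square_recurrence (f g : nat -> nat -> nat) (M : nat -> nat -> nat) :
  (forall i, (i <= n)%N -> f i 0%N = g i 0%N) -> (forall j, (j <= n)%N -> f 0%N j = g 0%N j) ->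
  (forall i j, (i < n)%N -> (j < n)%N -> (f i.+1 j.+1 + f i j = f i.+1 j + f i j.+1 + M i j)%N) ->
  (forall i j, (i < n)%N -> (j < n)%N -> (g i.+1 j.+1 + g i j = g i.+1 j + g i j.+1 + M i j)%N) ->
  forall i j, (i <= n)%N -> (j <= n)%N -> f i j = g i j.
Proof.
move=> h0 h0' hf hg; elim=> [|i IH] j i_n jn; first exact: h0'.
elim: j jn => [|j IHj] jn; first exact: h0.
have := hf i j i_n jn; have := hg i j i_n jn.
by rewrite IHj ?(ltnW jn) // !IH ?(ltnW jn) ?(ltnW i_n) //; lia.
Qed.

(** The squares obeying the rule with a 1 form a 0-1 matrix [M], which is the mixed second
    difference of the label sizes. Along the prescribed sides the sizes grow by one at each step, so
    every row and column of [M] sums to 1. *)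
Lemma bwd_adm_growth (L : labeling n) : [forall v, bwd_adm v L] ->
  exists s : 'S_n, [/\ is_growth s L, Ptab L = P & Qtab L = Q].
Proof.
move=> /forallP adm.
have [P0 Ppart Pcov] := elimT (is_sytP P) sytP.
have [Q0 Qpart Qcov] := elimT (is_sytP Q) sytQ.
have gP i : (i <= n)%N -> gv L i n = cv P i.
  by move=> i_n; have := adm (Ordinal (i_n : i < n.+1)%N, ord_max); rewrite /bwd_adm /= eqxx => /eqP.
have gQ j : (j <= n)%N -> gv L n j = cv Q j.
  move=> jn; have := adm (ord_max, Ordinal (jn : j < n.+1)%N); rewrite /bwd_adm /= eqxx.
  by case: eqP => [-> /eqP ->|_ /eqP //]; apply: shapePQ.
have inner i j : (i < n)%N -> (j < n)%N ->
    is_partition (gv L i j) /\ (bwd_rule false L i j || bwd_rule true L i j).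
  move=> i_n jn; have := adm (Ordinal (ltnW i_n : i < n.+1)%N, Ordinal (ltnW jn : j < n.+1)%N).
  by rewrite /bwd_adm /= !ltn_eqF // => /andP.
pose M i j : nat := bwd_rule true L i j.
have part i j : (i <= n)%N -> (j <= n)%N -> is_partition (gv L i j).
  move=> i_n jn; case: (ltngtP j n) (jn) => // [jn' _|-> _]; last by rewrite gP.
  by case: (ltngtP i n) (i_n) => // [i_n' _|-> _]; [case: (inner i j) | rewrite gQ].
have subs i j : (i < n)%N -> (j < n)%N -> [/\ subp (gv L i j) (gv L i j.+1),
    subp (gv L i j) (gv L i.+1 j) & bwd_rule (M i j == 1%N) L i j].
  move=> i_n jn; have [_] := inner i j i_n jn; rewrite /M.
  case T: (bwd_rule true L i j) => /=.
    by move: (T) => /and5P[/coveq_subp ? /coveq_subp ? _ _ _].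
  by rewrite orbF => /[dup] /and5P[/coveq_subp ? /coveq_subp ? _ _ _].
have sub1 i j : (i <= n)%N -> (j < n)%N -> subp (gv L i j) (gv L i j.+1).
  move=> i_n jn; case: (ltngtP i n) (i_n) => // [i_n' _|-> _]; first by case: (subs i j).
  by rewrite !gQ ?(ltnW jn) //; case/andP: (Qcov j jn).
have sub2 i j : (i < n)%N -> (j <= n)%N -> subp (gv L i j) (gv L i.+1 j).
  move=> i_n jn; case: (ltngtP j n) (jn) => // [jn' _|-> _]; first by case: (subs i j).
  by rewrite !gP ?(ltnW i_n) //; case/andP: (Pcov i i_n).
pose S i j := psize (gv L i j).
have Srec i j : (i < n)%N -> (j < n)%N -> (S i.+1 j.+1 + S i j = S i.+1 j + S i j.+1 + M i j)%N.
  move=> i_n jn; have [_ _ /and5P[_ _ _ _ /andP[/eqP e _]]] := subs i j i_n jn.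
  by move: e; rewrite /S /M; case: (bwd_rule _ _ _ _) => /=; lia.
have SP i : (i <= n)%N -> S i n = i by move=> i_n; rewrite /S gP // psize_syt.
have SQ j : (j <= n)%N -> S n j = j by move=> jn; rewrite /S gQ // psize_syt.
(* The left column is not prescribed, but its sizes increase downwards to the SW corner, where the
   first shape of [Q] is empty. *)
have S0r i : (i <= n)%N -> S i 0%N = 0%N.
  have mono d k : (k + d <= n)%N -> (S k 0 <= S (k + d) 0)%N.
    elim: d => [|d IH] kd; rewrite ?addn0 // addnS in kd *.
    apply: leq_trans (IH (ltnW kd)) _; apply: subp_psize; first by rewrite !size_gv.
    exact: sub2.
  by move=> i_n; apply/eqP; have := mono (n - i)%N i; rewrite subnKC // SQ // leqn0; apply.
have S0l j : (j <= n)%N -> S 0%N j = 0%N.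
  have mono d k : (k + d <= n)%N -> (S 0 k <= S 0 (k + d))%N.
    elim: d => [|d IH] kd; rewrite ?addn0 // addnS in kd *.
    apply: leq_trans (IH (ltnW kd)) _; apply: subp_psize; first by rewrite !size_gv.
    exact: sub1.
  by move=> jn; apply/eqP; have := mono (n - j)%N j; rewrite subnKC // SP // leqn0; apply.
have rowS i j : (i < n)%N -> (j <= n)%N -> (S i.+1 j = S i j + \sum_(j' < j) M i j')%N.
  move=> i_n; elim: j => [|j IH] jn; first by rewrite big_ord0 !S0r // ltnW.
  have := Srec i j i_n jn; rewrite IH ?(ltnW jn) // big_ord_recr /=; lia.
have colS i j : (i <= n)%N -> (j < n)%N -> (S i j.+1 = S i j + \sum_(i' < i) M i' j)%N.
  move=> + jn; elim: i => [|i IH] i_n; first by rewrite big_ord0 !S0l // ltnW.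
  have := Srec i j i_n jn; rewrite IH ?(ltnW i_n) // big_ord_recr /=; lia.
have row1 (i : 'I_n) : (\sum_(j < n) M i j = 1)%N.
  by have := rowS i n (ltn_ord i) (leqnn n); rewrite !SP ?(ltnW (ltn_ord i)) //; lia.
have col1 (j : 'I_n) : (\sum_(i < n) M i j = 1)%N.
  by have := colS n j (leqnn n) (ltn_ord j); rewrite !SQ ?(ltnW (ltn_ord j)) //; lia.
have uniq1 (F : pred 'I_n) : (\sum_i (F i : nat) = 1)%N -> {i | F =1 pred1 i}.
  move=> F1; have cF : #|F| = 1%N.
    by rewrite -F1 -sum1_card big_mkcond; apply: eq_bigr => i _; rewrite unfold_in; case: (F i).
  by have [i Fi] := mem_card1 cF; exists i => k; have := Fi k; rewrite unfold_in.
(* [f j] is the row of the only 1 in column [j]; the row sums make [f] injective. *)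
pose f j := sval (uniq1 _ (col1 j)).
have fM (i j : 'I_n) : bwd_rule true L i j = (f j == i).
  by rewrite /f; case: (uniq1 _ _) => k /= ->; rewrite eq_sym.
have f_inj : injective f.
  move=> j j' e; have [k hk] := uniq1 _ (row1 (f j)).
  have := hk j; have := hk j'; rewrite !fM e eqxx /= => /esym/eqP -> /esym/eqP ->.
  by [].
pose s := perm f_inj; exists s.
have eqS := @eq_square_recurrence S (ones_NW s) M _ _ Srec.
have sizes i j : (i <= n)%N -> (j <= n)%N -> psize (gv L i j) = ones_NW s i j.
  apply: eqS => [i' i'n|j' j'n|i' j' i'n j'n]; first by rewrite S0r // ones_NW0r.
    by rewrite S0l // ones_NW0l.
  have := ones_NW_square s (Ordinal i'n) (Ordinal j'n); rewrite permE -fM /=.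
  by move=> ->.
split; first by apply/is_growthP.
- by apply/ffunP => i; rewrite ffunE; apply: pseq_inj; have := gP i; rewrite /gv /cv inord_val inord_n; apply; rewrite -ltnS.
- by apply/ffunP => i; rewrite ffunE; apply: pseq_inj; have := gQ i; rewrite /gv /cv inord_val inord_n; apply; rewrite -ltnS.
Qed.

Lemma sum_Pbwd : \sum_(s : 'S_n) Pbwd q t s P Q = 1.
Proof.
rewrite -[RHS]sum_growth_weightbar_adm.
rewrite (exchange_big_dep (fun L : labeling n => [forall v, bwd_adm v L])) /=; last first.
  by move=> s L _ /and3P[gL /eqP eP /eqP eQ]; apply: growth_bwd_adm gL eP eQ.
apply: eq_bigr => L /bwd_adm_growth[s [gL eP eQ]].
rewrite (big_pred1 s) // => s'; rewrite eP eQ !eqxx !andbT.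
by apply/idP/eqP => [gL'|-> //]; apply: growth_perm_inj gL' gL.
Qed.
End Backward.

(** * The balance between the weights of a growth *)

Section DetailedBalance.
Variables (K : fieldType) (q t : K).
Hypothesis brk_neq0 : forall i j, (0 < i + j)%N -> brk q t i j != 0.
Hypotheses (q_neq0 : q != 0) (t_neq0 : t != 0).
Variable n : nat.
Implicit Types (L : labeling n) (s : 'S_n).

Lemma bcell_neq0 lam c : bcell q t lam c != 0.
Proof. by rewrite mulf_neq0 ?invr_eq0 // brk_neq0 ?addnS. Qed.

Lemma psi_edge_neq0 mu lam : psi_edge q t mu lam != 0.
Proof.
rewrite /psi_edge; case: (mu =P lam) => _; first exact: oner_neq0.
rewrite prodf_seq_neq0; apply/allP => c _ /=.
by rewrite mulf_neq0 ?invr_eq0 ?bcell_neq0.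
Qed.

Lemma phi_edge_neq0 mu lam : phi_edge q t mu lam != 0.
Proof.
rewrite /phi_edge; case: (mu =P lam) => _; first exact: oner_neq0.
rewrite mulf_neq0 ?onem_ratio_neq0 // prodf_seq_neq0; apply/allP => c _ /=.
by rewrite mulf_neq0 ?invr_eq0 ?bcell_neq0.
Qed.

Lemma prod_shift (f : nat -> K) : f 0%N = 1 ->
  \prod_(j < n) f j.+1 = \prod_(j < n) f j * f n.
Proof.
move=> f0; transitivity (\prod_(j < n.+1) f j); last by rewrite big_ord_recr.
by rewrite big_ord_recl f0 mul1r.
Qed.

Lemma growth_detailed_balance s L : is_growth s L ->
  ((1 - t) / (1 - q)) ^+ n * growth_weight q t L =
  growth_weightbar q t L * (psiT q t (Ptab L) * phiT q t (Qtab L)).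
Proof.
move=> gL; have [h1 h2 h3 h4] := elimT (is_growthP s L) gL.
pose psi i j := psi_edge q t (gv L i j) (gv L i.+1 j).
pose phi i j := phi_edge q t (gv L i j) (gv L i j.+1).
have psi0 i : (i < n)%N -> psi i 0%N = 1.
  move=> i_n; rewrite /psi (@subp_eq (gv L i 0%N) (gv L i.+1 0%N)) ?psi_edgexx ?size_gv ?h3 //.
  by rewrite !h4 ?ones_NW0r // ltnW.
have phi0 j : (j < n)%N -> phi 0%N j = 1.
  move=> jn; rewrite /phi (@subp_eq (gv L 0 j) (gv L 0 j.+1)) ?phi_edgexx ?size_gv ?h2 //.
  by rewrite !h4 ?ones_NW0l // ltnW.
have psiTE : psiT q t (Ptab L) = \prod_(i < n) psi i n.
  apply: eq_bigr => i _; rewrite !cv_Ptab /psi /psi_edge ifN //.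
  have /is_sytP[_ _ /(_ i (ltn_ord i))] := Ptab_syt gL; rewrite !cv_Ptab.
  by apply: contraTneq => ->; rewrite coversN.
have phiTE : phiT q t (Qtab L) = \prod_(j < n) phi n j.
  apply: eq_bigr => j _; rewrite !cv_Qtab /phi /phi_edge ifN //.
  have /is_sytP[_ _ /(_ j (ltn_ord j))] := Qtab_syt gL; rewrite !cv_Qtab.
  by apply: contraTneq => ->; rewrite coversN.
(* [X] and [Y] collect the weights of the left and upper edges of all squares. Passing to the right
   and lower edges only trades the trivial left and top sides for those carrying [P] and [Q]. *)
pose X := \prod_(i < n) \prod_(j < n) psi i j.
pose Y := \prod_(i < n) \prod_(j < n) phi i j.
have X0 : X != 0 by apply/prodf_neq0 => i _; apply/prodf_neq0 => j _; apply: psi_edge_neq0.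
have Y0 : Y != 0 by apply/prodf_neq0 => i _; apply/prodf_neq0 => j _; apply: phi_edge_neq0.
have XE : \prod_(i < n) \prod_(j < n) psi i j.+1 = X * \prod_(i < n) psi i n.
  rewrite -big_split; apply: eq_bigr => i _ /=.
  by rewrite (@prod_shift (psi i)) // psi0.
have YE : \prod_(i < n) \prod_(j < n) phi i.+1 j = Y * \prod_(j < n) phi n j.
  rewrite /Y exchange_big [X in _ = X * _]exchange_big -big_split; apply: eq_bigr => j _ /=.
  by rewrite (@prod_shift (phi ^~ j)) // phi0.
(* The $n$ factors of $\omega$ are distributed over the $n$ squares containing a 1, as
   [square_relation] requires. *)
have rE : ((1 - t) / (1 - q)) ^+ n = \prod_(i < n) \prod_(j < n) ((1 - t) / (1 - q)) ^+ (s j == i).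
  rewrite exchange_big -[in LHS](card_ord n) -prodr_const; apply: eq_bigr => j _.
  by rewrite (bigD1 (s j)) //= eqxx expr1 big1 ?mulr1 // => i; rewrite eq_sym => /negbTE ->.
apply: (mulIf (mulf_neq0 X0 Y0)).
rewrite psiTE phiTE.
transitivity (growth_weightbar q t L * ((X * \prod_(i < n) psi i n) * (Y * \prod_(j < n) phi n j))); last by ring.
rewrite -XE -YE rE /X /Y /growth_weight /growth_weightbar -!big_split /=.
apply: eq_bigr => i _; rewrite -!big_split /=; apply: eq_bigr => j _.
have [i_n jn] := (ltn_ord i, ltn_ord j); have [i_n' jn'] := (ltnW i_n, ltnW jn).
apply: square_relation; rewrite ?size_gv ?h1 //.
exact: growth_local_rule.
Qed.

Lemma detailed_balance s (P Q : chain n) :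
  omega q t n * Pfwd q t s P Q = Pbwd q t s P Q * omegabar q t P Q.
Proof.
rewrite /omega -expr_div_n /Pfwd /Pbwd mulr_sumr mulr_suml.
apply: eq_bigr => L /and3P[gL /eqP <- /eqP <-].
exact: growth_detailed_balance gL.
Qed.
End DetailedBalance.

(** * Values at real points *)

Section Evaluation.
Variables (R : realFieldType) (a b : R).

Definition ev1 : {poly rat} -> R := horner_eval a \o map_poly (@ratr R).

(** This form exhibits evaluation as a composite of ring morphisms, from which its compatibility
    with the operations follows. *)
Lemma ev2E (p : {poly {poly rat}}) : ev2 a b p = (horner_eval b \o map_poly ev1) p.
Proof. by []. Qed.

Lemma ev2D p p' : ev2 a b (p + p') = ev2 a b p + ev2 a b p'.
Proof. by rewrite !ev2E rmorphD. Qed.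

Lemma ev2M p p' : ev2 a b (p * p') = ev2 a b p * ev2 a b p'.
Proof. by rewrite !ev2E rmorphM. Qed.

Lemma ev2N p : ev2 a b (- p) = - ev2 a b p.
Proof. by rewrite !ev2E rmorphN. Qed.

Lemma ev2_0 : ev2 a b 0 = 0.
Proof. by rewrite !ev2E rmorph0. Qed.

Lemma ev2_1 : ev2 a b 1 = 1.
Proof. by rewrite !ev2E rmorph1. Qed.

Lemma ev2_neq0 p : ev2 a b p != 0 -> FracField.tofrac p != 0.
Proof. by move=> h; rewrite tofrac_eq0; apply: contraNneq h => ->; rewrite ev2_0. Qed.

Lemma rf_value_uniq f v w : rf_value f a b v -> rf_value f a b w -> v = w.
Proof.
case=> p1 [p2 [h2 -> ->]] [r1 [r2 [k2 /eqP e ->]]].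
move: e; rewrite eqr_div ?ev2_neq0 // -!tofracM tofrac_eq => /eqP e.
by apply/eqP; rewrite eqr_div // -!ev2M e.
Qed.

Lemma rf_value_add f g v w : rf_value f a b v -> rf_value g a b w -> rf_value (f + g) a b (v + w).
Proof.
case=> p1 [p2 [h2 -> ->]] [r1 [r2 [k2 -> ->]]].
exists (p1 * r2 + r1 * p2), (p2 * r2); split.
- by rewrite ev2M mulf_neq0.
- by rewrite addf_div ?ev2_neq0 // tofracD !tofracM.
- by rewrite addf_div // ev2D !ev2M.
Qed.

Lemma rf_value_mul f g v w : rf_value f a b v -> rf_value g a b w -> rf_value (f * g) a b (v * w).
Proof.
case=> p1 [p2 [h2 -> ->]] [r1 [r2 [k2 -> ->]]].
exists (p1 * r1), (p2 * r2); split.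
- by rewrite ev2M mulf_neq0.
- by rewrite mulf_div !tofracM.
- by rewrite mulf_div !ev2M.
Qed.

Lemma rf_value_inv f v : v != 0 -> rf_value f a b v -> rf_value f^-1 a b v^-1.
Proof.
move=> v0 [p1 [p2 [h2 -> e]]]; exists p2, p1; split; rewrite ?e ?invf_div //.
by apply: contraNneq v0 => p0; rewrite e p0 mul0r.
Qed.

Lemma rf_value_poly p : rf_value (FracField.tofrac p) a b (ev2 a b p).
Proof.
by exists p, 1; rewrite ev2_1 tofrac1 !divr1 oner_neq0.
Qed.

Lemma rf_value0 : rf_value 0 a b 0.
Proof. by have := rf_value_poly 0; rewrite ev2_0 tofrac0. Qed.

Lemma rf_value1 : rf_value 1 a b 1.
Proof. by have := rf_value_poly 1; rewrite ev2_1 tofrac1. Qed.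

Lemma rf_value_q : rf_value qQT a b a.
Proof.
have := rf_value_poly (('X : {poly rat})%:P); congr rf_value.
by rewrite ev2E /= map_polyC /= /horner_eval hornerC /ev1 /= map_polyX /horner_eval hornerX.
Qed.

Lemma rf_value_t : rf_value tQT a b b.
Proof.
have := rf_value_poly ('X : {poly {poly rat}}); congr rf_value.
by rewrite ev2E /= map_polyX /horner_eval hornerX.
Qed.

Lemma rf_value_exp f v i : rf_value f a b v -> rf_value (f ^+ i) a b (v ^+ i).
Proof.
move=> h; elim: i => [|i IH]; first by rewrite !expr0; apply: rf_value1.
by rewrite !exprS; apply: rf_value_mul.
Qed.

Lemma rf_value_opp f v : rf_value f a b v -> rf_value (- f) a b (- v).
Proof.
case=> p1 [p2 [h2 -> ->]]; exists (- p1), p2; split=> //.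
  by rewrite tofracN mulNr.
by rewrite ev2N mulNr.
Qed.

Lemma rf_value_brk i j : rf_value (brk qQT tQT i j) a b (brk a b i j).
Proof.
apply: rf_value_add rf_value1 _; apply: rf_value_opp; apply: rf_value_mul.
  exact: rf_value_exp rf_value_q.
exact: rf_value_exp rf_value_t.
Qed.

End Evaluation.

(** A zero rational function cannot take the value $1-2^{-(i+j)}$, which is what the bracket gives
    at $q=t=1/2$. *)
Lemma brk_QT_neq0 i j : (0 < i + j)%N -> brk qQT tQT i j != 0.
Proof.
move=> ij; apply/eqP => e.
have := rf_value_brk (2^-1 : rat) 2^-1 i j; rewrite e => h.
have := rf_value_uniq h (rf_value0 _ _) => /eqP; apply/negP.
rewrite /brk -exprD subr_eq0 eq_sym lt_eqF //.
by rewrite exprn_ilt1 // -lt0n.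
Qed.

Lemma qQT_neq0 : qQT != 0.
Proof.
apply/eqP => e; have := rf_value_q (1 : rat) 1; rewrite e => h.
by have /eqP := rf_value_uniq h (rf_value0 _ _); rewrite oner_eq0.
Qed.

Lemma tQT_neq0 : tQT != 0.
Proof.
apply/eqP => e; have := rf_value_t (1 : rat) 1; rewrite e => h.
by have /eqP := rf_value_uniq h (rf_value0 _ _); rewrite oner_eq0.
Qed.

(** The exponents $A$ and $B$ may be negative, which would obstruct evaluation at $q=0$ or $t=0$.
    After clearing denominators only natural exponents remain, times ratios of brackets. *)
Lemma gamma_incr (K : fieldType) (q t : K) :
  (forall i j, (0 < i + j)%N -> brk q t i j != 0) -> q != 0 -> t != 0 ->
  forall (mu : seq nat) m k, is_partition mu -> (m < size mu)%N ->
  is_partition (incr_nth mu m) -> (k < size mu)%N ->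
  is_partition (incr_nth (incr_nth mu m) k) ->
  exists e f i j i' j', [/\ (0 < i + j)%N, (0 < i' + j')%N &
    t ^ (Bexp mu (incr_nth mu m) (incr_nth (incr_nth mu m) k) - 1)
      / gamma q t mu (incr_nth mu m) (incr_nth (incr_nth mu m) k) =
    q ^+ e * t ^+ f * (brk q t 1 0 / brk q t i j * (brk q t 0 1 / brk q t i' j'))].
Proof.
move=> brk_neq0 q0 t0 mu m k pm mn pl kn plk.
rewrite /gamma AexpE // BexpE //; set lam := incr_nth mu m in pl plk *.
have b10 := brk_neq0 1 0 isT; have b01 := brk_neq0 0 1 isT.
have q1 : 1 - q = brk q t 1 0 by rewrite /brk expr0 mulr1.
have t1 : 1 - t = brk q t 0 1 by rewrite /brk expr0 mul1r.
(* If $m<k$, then $A\ge 0$ and $B\ge 1$, so [gamma] is already made of brackets. Otherwise $A<0$ and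
   $B\le 0$. *)
rewrite q1 t1; case: (ltnP m k) => mk.
  have le : (nth 0%N lam k <= nth 0%N mu m)%N.
    by rewrite nth_incr_nth (ltn_eqF mk) partition_nth_le // ltnW.
  have -> : (nth 0%N mu m)%:Z - (nth 0%N lam k)%:Z = (nth 0%N mu m - nth 0%N lam k)%N by lia.
  have -> : k%:Z - m%:Z = (k - m)%N by lia.
  move: (nth 0%N mu m - nth 0%N lam k)%N => A.
  have -> : (k - m)%N%:Z - 1 = (k - m.+1)%N by lia.
  have -> : A%:Z + 1 = A.+1 by lia.
  exists 0%N, (k - m.+1)%N, A, (k - m)%N, A.+1, (k - m.+1)%N; split; first lia.
    by [].
  have h1 : brk q t A (k - m) != 0 by apply: brk_neq0; lia.
  have h2 := brk_neq0 A.+1 (k - m.+1)%N isT.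
  rewrite -!exprnP -/(brk q t A (k - m)) -/(brk q t A.+1 (k - m.+1)) expr0 mul1r.
  by field; rewrite h1 h2 b10 b01.
have le : (nth 0%N mu m < nth 0%N lam k)%N.
  by have := partition_nth_le pl mk; rewrite [nth 0%N lam m]nth_incr_nth eqxx add1n.
have -> : (nth 0%N mu m)%:Z - (nth 0%N lam k)%:Z = - (nth 0%N lam k - nth 0%N mu m)%N%:Z by lia.
have : (0 < nth 0%N lam k - nth 0%N mu m)%N by rewrite subn_gt0.
move: (nth 0%N lam k - nth 0%N mu m)%N => [//|A] _.
have -> : k%:Z - m%:Z = - (m - k)%N%:Z by lia.
move: (m - k)%N => B.
have -> : - B%:Z - 1 = - (B.+1)%:Z by lia.
have -> : - (A.+1)%:Z + 1 = - A%:Z by lia.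
(* Both factors of [gamma] change sign when their negative exponents are cleared, so the signs
   cancel. With [A] and [B] now natural, what is left of the monomials is
   $q^{2A+1}t^{2B+1}t^{-B-1}$. *)
exists (A + A.+1)%N, B, A.+1, B, A, B.+1; split; rewrite ?addnS //.
rewrite -!exprnN.
have h1 := brk_neq0 A.+1 B isT; have h2 : brk q t A B.+1 != 0 by apply: brk_neq0; rewrite addnS.
have qA : q ^+ A != 0 by rewrite expf_neq0.
have tB : t ^+ B != 0 by rewrite expf_neq0.
have e1 : 1 - q ^- A.+1 * t ^- B = - (brk q t A.+1 B / (q ^+ A.+1 * t ^+ B)).
  by rewrite /brk !exprS; field; rewrite ?q0 ?t0 ?qA ?tB.
have e2 : 1 - q ^- A * t ^- B.+1 = - (brk q t A B.+1 / (q ^+ A * t ^+ B.+1)).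
  by rewrite /brk !exprS; field; rewrite ?q0 ?t0 ?qA ?tB.
rewrite e1 e2 !(exprS, exprD).
by field; rewrite !oppr_eq0 h1 h2 b10 b01 tB t0 qA q0.
Qed.

(** * Regularity and signs at real points *)

Section Range.
Variables (R : realFieldType) (a b : R).
Hypothesis ab : ((0 <= a < 1) && (0 <= b < 1)) || ((1 < a) && (1 < b)).

(** Regularity at $(a,b)$ is part of the claim. Strict positivity is kept apart because only it
    passes to inverses. *)
Definition pos_value (f : QT) : Prop := exists2 v : R, rf_value f a b v & 0 < v.
Definition nneg_value (f : QT) : Prop := exists2 v : R, rf_value f a b v & 0 <= v.

Lemma pos_nneg f : pos_value f -> nneg_value f.
Proof. by case=> v h /ltW v0; exists v. Qed.

Lemma pos_value_mul f g : pos_value f -> pos_value g -> pos_value (f * g).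
Proof. by move=> [v hv v0] [w hw w0]; exists (v * w); [apply: rf_value_mul | apply: mulr_gt0]. Qed.

Lemma nneg_value_mul f g : nneg_value f -> nneg_value g -> nneg_value (f * g).
Proof. by move=> [v hv v0] [w hw w0]; exists (v * w); [apply: rf_value_mul | apply: mulr_ge0]. Qed.

Lemma nneg_value_add f g : nneg_value f -> nneg_value g -> nneg_value (f + g).
Proof. by move=> [v hv v0] [w hw w0]; exists (v + w); [apply: rf_value_add | apply: addr_ge0]. Qed.

Lemma pos_value_inv f : pos_value f -> pos_value f^-1.
Proof.
by move=> [v hv v0]; exists v^-1; [apply: rf_value_inv; rewrite ?gt_eqF | rewrite invr_gt0].
Qed.

Lemma pos_value1 : pos_value 1.
Proof. by exists 1; [apply: rf_value1 | apply: ltr01]. Qed.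

Lemma nneg_value0 : nneg_value 0.
Proof. by exists 0; [apply: rf_value0 | apply: lexx]. Qed.

Lemma pos_value_prod (I : Type) (r : seq I) (C : pred I) (F : I -> QT) :
  (forall i, C i -> pos_value (F i)) -> pos_value (\prod_(i <- r | C i) F i).
Proof. by move=> h; apply: big_ind h; [apply: pos_value1 | apply: pos_value_mul]. Qed.

Lemma nneg_value_prod (I : Type) (r : seq I) (C : pred I) (F : I -> QT) :
  (forall i, C i -> nneg_value (F i)) -> nneg_value (\prod_(i <- r | C i) F i).
Proof.
by move=> h; apply: big_ind h; [apply/pos_nneg/pos_value1 | apply: nneg_value_mul].
Qed.

Lemma nneg_value_sum (I : Type) (r : seq I) (C : pred I) (F : I -> QT) :
  (forall i, C i -> nneg_value (F i)) -> nneg_value (\sum_(i <- r | C i) F i).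
Proof. by move=> h; apply: big_ind h; [apply: nneg_value0 | apply: nneg_value_add]. Qed.

Lemma a_ge0 : 0 <= a.
Proof. by case/orP: ab => /andP[]; [case/andP | move=> /ltW /(le_trans ler01)]. Qed.

Lemma b_ge0 : 0 <= b.
Proof. by case/orP: ab => /andP[_]; [case/andP | move=> /ltW /(le_trans ler01)]. Qed.

Lemma nneg_value_q i : nneg_value (qQT ^+ i).
Proof. by exists (a ^+ i); [apply/rf_value_exp/rf_value_q | rewrite exprn_ge0 ?a_ge0]. Qed.

Lemma nneg_value_t i : nneg_value (tQT ^+ i).
Proof. by exists (b ^+ i); [apply/rf_value_exp/rf_value_t | rewrite exprn_ge0 ?b_ge0]. Qed.

(* Both brackets are positive when q, t < 1 and both are negative when q, t > 1. *)
Lemma pos_value_brk_ratio i j k l : (0 < i + j)%N -> (0 < k + l)%N ->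
  pos_value (brk qQT tQT i j / brk qQT tQT k l).
Proof.
have sgn i' j' : (0 < i' + j')%N ->
    if a < 1 then 0 < brk a b i' j' else brk a b i' j' < 0.
  rewrite addn_gt0 !lt0n => ij; case/orP: ab => /andP[].
    case/andP=> a0 a1 /andP[b0 b1]; rewrite a1 subr_gt0.
    have [a1' b1'] := (ltW a1, ltW b1).
    case/orP: ij => [i0|j0].
      apply: (@le_lt_trans _ _ (a ^+ i')); last by rewrite exprn_ilt1.
      by rewrite ler_piMr ?exprn_ge0 ?exprn_ile1.
    apply: (@le_lt_trans _ _ (b ^+ j')); last by rewrite exprn_ilt1.
    by rewrite ler_piMl ?exprn_ge0 ?exprn_ile1.
  move=> a1 b1; have [a1' b1'] := (ltW a1, ltW b1); rewrite ltNge a1' /= subr_lt0.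
  case/orP: ij => [i0|j0].
    apply: (@lt_le_trans _ _ (a ^+ i')); first by rewrite exprn_egt1.
    by rewrite ler_peMr ?exprn_ge0 ?a_ge0 ?exprn_ege1.
  apply: (@lt_le_trans _ _ (b ^+ j')); first by rewrite exprn_egt1.
  by rewrite ler_peMl ?exprn_ge0 ?b_ge0 ?exprn_ege1.
move=> /sgn h1 /sgn h2; exists (brk a b i j / brk a b k l).
  apply: rf_value_mul; first exact: rf_value_brk.
  apply: rf_value_inv; last exact: rf_value_brk.
  by case: ifP h2 => _ h2; [rewrite gt_eqF | rewrite lt_eqF].
by case: ifP h1 h2 => _ h1 h2; [rewrite divr_gt0 | rewrite nmulr_rgt0 ?invr_lt0].
Qed.

Lemma pos_value_alpha lam nu : pos_value (alpha qQT tQT lam nu).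
Proof.
by apply: pos_value_mul; apply: pos_value_prod => c _; apply: pos_value_brk_ratio; rewrite ?addnS.
Qed.

Lemma pos_value_alphabar lam nu : pos_value (alphabar qQT tQT lam nu).
Proof.
by apply: pos_value_mul; apply: pos_value_prod => c _; apply: pos_value_brk_ratio; rewrite ?addnS.
Qed.

Lemma nneg_value_squares nw ne sw se : size ne = size nw -> size se = size nw ->
  is_partition nw -> is_partition ne -> is_partition se ->
  nneg_value (sqw qQT tQT nw ne sw se) /\ nneg_value (sqwbar qQT tQT nw ne sw se).
Proof.
move=> s1 s2 p1 p2 p3; rewrite /sqw /sqwbar.
have one : nneg_value 1 by apply/pos_nneg/pos_value1.
case: ifP => // /and3P[_ c1 c2].
have [k kn ek] := coversP (etrans s1 (esym s2)) c2.
case: eqP c1 => [_ _|_ /= c1].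
  (* The prefactor is $t^k$ with $k$ natural, hence regular also at $t=0$. *)
  rewrite /Pup /Pbarup ek expz_nskew // -?ek //.
  by split; apply: nneg_value_mul (nneg_value_t k) _; apply: pos_nneg;
    [apply: pos_value_alpha | apply: pos_value_alphabar].
have [m mn em] := coversP (esym s1) c1.
rewrite s1 in kn.
have := @gamma_incr _ _ _ brk_QT_neq0 qQT_neq0 tQT_neq0 nw m k p1 mn.
rewrite -em -ek => /(_ p2 kn p3) [e [f [i [j [i' [j' [ij ij' g]]]]]]].
rewrite /Pdiag /Pbardiag ![tQT ^ _ * _ / _]mulrAC g.
have G : nneg_value (qQT ^+ e * tQT ^+ f * (brk qQT tQT 1 0 / brk qQT tQT i j *
   (brk qQT tQT 0 1 / brk qQT tQT i' j'))).
  apply: nneg_value_mul; first exact: nneg_value_mul (nneg_value_q e) (nneg_value_t f).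
  by apply/pos_nneg/pos_value_mul; apply: pos_value_brk_ratio.
by split; apply: nneg_value_mul G _; apply: pos_nneg; apply: pos_value_mul;
  rewrite ?/beta ?/betabar; try apply: pos_value_inv;
  (apply: pos_value_alpha || apply: pos_value_alphabar).
Qed.

Lemma nneg_value_growth n (s : 'S_n) (L : labeling n) : is_growth s L ->
  nneg_value (growth_weight qQT tQT L) /\ nneg_value (growth_weightbar qQT tQT L).
Proof.
case/is_growthP => h1 _ _ _.
split; apply: nneg_value_prod => i _; apply: nneg_value_prod => j _;
  have [i_n jn] := (ltn_ord i, ltn_ord j); have [i_n' jn'] := (ltnW i_n, ltnW jn);
  by apply nneg_value_squares; rewrite ?size_gv ?h1.
Qed.

Lemma nneg_value_Pfwd n (s : 'S_n) (P Q : chain n) : nneg_value (Pfwd qQT tQT s P Q).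
Proof. by apply: nneg_value_sum => L /and3P[/nneg_value_growth[]]. Qed.

Lemma nneg_value_Pbwd n (s : 'S_n) (P Q : chain n) : nneg_value (Pbwd qQT tQT s P Q).
Proof. by apply: nneg_value_sum => L /and3P[/nneg_value_growth[]]. Qed.

Lemma value_le1 f g : nneg_value f -> nneg_value g -> f + g = 1 ->
  exists v : R, rf_value f a b v /\ 0 <= v <= 1.
Proof.
move=> [v hv v0] [w hw w0] e; exists v; split=> //; rewrite v0 /=.
have := rf_value_add hv hw; rewrite e => h.
by rewrite (rf_value_uniq (rf_value1 a b) h) lerDl.
Qed.
End Range.

Theorem theorem4p24 (n : nat) (hn : (0 < n)%N) :
  (* (1) *)
  (forall s : 'S_n,
     \sum_(P : chain n | is_syt P) \sum_(Q : chain n | is_syt Q && (syt_shape Q == syt_shape P))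
        Pfwd qQT tQT s P Q = 1) /\
  (* (2) *)
  (forall P Q : chain n, is_syt P -> is_syt Q -> syt_shape P = syt_shape Q ->
     \sum_(s : 'S_n) Pbwd qQT tQT s P Q = 1) /\
  (* (3) *)
  (forall (s : 'S_n) (P Q : chain n), is_syt P -> is_syt Q -> syt_shape P = syt_shape Q ->
     omega qQT tQT n * Pfwd qQT tQT s P Q
     = Pbwd qQT tQT s P Q * omegabar qQT tQT P Q) /\
  (* Moreover: values in [0,1] *)
  (forall (R : realFieldType) (a b : R),
     ((0 <= a < 1) && (0 <= b < 1)) || ((1 < a) && (1 < b)) ->
     forall (s : 'S_n) (P Q : chain n), is_syt P -> is_syt Q -> syt_shape P = syt_shape Q ->
       (exists v : R, rf_value (Pfwd qQT tQT s P Q) a b v /\ 0 <= v <= 1) /\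
       (exists v : R, rf_value (Pbwd qQT tQT s P Q) a b v /\ 0 <= v <= 1)).
Proof.
have fwd := sum_Pfwd brk_QT_neq0 qQT_neq0 tQT_neq0.
have bwd := sum_Pbwd brk_QT_neq0 qQT_neq0 tQT_neq0.
split; [exact: fwd | split; [exact: bwd | split]].
  by move=> s P Q _ _ _; apply: detailed_balance; apply: brk_QT_neq0.
move=> R a b ab s P Q sP sQ PQ; split.
  have := fwd n s; rewrite (bigD1 P) //= (bigD1 Q) /=; last by rewrite sQ PQ eqxx.
  rewrite -addrA; apply: value_le1; first exact: nneg_value_Pfwd.
  apply: nneg_value_add; first by apply: nneg_value_sum => ? _; apply: nneg_value_Pfwd.
  by do 2!apply: nneg_value_sum => ? _; apply: nneg_value_Pfwd.
have := bwd n P Q sP sQ PQ; rewrite (bigD1 s) //=.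
apply: value_le1; first exact: nneg_value_Pbwd.
by apply: nneg_value_sum => ? _; apply: nneg_value_Pbwd.
Qed.
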